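(* Fix $V\in\mathfrak M_S$. The maximal Lie triple subsystems of $\mathfrak m_4^V$ are exactly the following: (1) $\mathfrak h_1\cap\mathfrak m_4^V$, for a principal subalgebra $\mathfrak h_1$ of $\mathfrak g_2$ adapted to $V$; (2) $\mathfrak h_2^\ell\cap\mathfrak m_4^V$, for a fixed $0\neq\ell\in V^\perp$; (3) $\mathfrak h_2^{u}\cap\mathfrak m_4^V$, for a fixed $0\neq u\in V$; (4) $\mathfrak h_4^W\cap\mathfrak m_4^V$, for a fixed $W\in\mathfrak M_S$ such that both $W\cap V$ and $W\cap V^\perp$ are nonzero.
   Context: Setup: Let $\langle\cdot,\cdot\rangle$ be the standard inner product on $\mathbb R^7$ with standard basis $e_1,\dots,e_7$, and let $\times$ be the anticommutative bilinear product on $\mathbb R^7$ determined by $e_i\times e_{i+1}=e_{i+3}$, $e_{i+1}\times e_{i+3}=e_i$, $e_{i+3}\times e_i=e_{i+1}$ (indices mod 7); it is a cross product. $G_2=\mathrm{Aut}(\mathbb R^7,\times)$, with Lie algebra $\mathfrak g_2=\mathrm{Der}(\mathbb R^7,\times)=\{d\in\mathfrak{gl}(7,\mathbb R): d(x\times y)=d(x)\times y+x\times d(y)\}$. $\mathfrak M_S=\{V\le\mathbb R^7:\dim V=3,\ V\times V\subseteq V\}$. For $0\neq u\in\mathbb R^7$: $\mathfrak h_2^u=\{d\in\mathfrak g_2:d(u)=0\}$. For $V\in\mathfrak M_S$: $\mathfrak h_4^V=\{d\in\mathfrak g_2: d(V^\perp)\subseteq V^\perp\}$ and $\mathfrak m_4^V=\{d\in\mathfrak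 g_2: d(V)\subseteq V^\perp,\ d(V^\perp)\subseteq V\}$; $\mathfrak g_2=\mathfrak h_4^V\oplus\mathfrak m_4^V$ is a $\mathbb Z_2$-grading, and $\mathfrak m_4^V$ is a Lie triple system under $[x,y,z]=[[x,y],z]$. A Lie triple subsystem of $\mathfrak m_4^V$ is a subspace $S$ with $[[S,S],S]\subseteq S$; it is maximal if it is proper and not properly contained in a proper Lie triple subsystem of $\mathfrak m_4^V$. A principal subalgebra of $\mathfrak g_2$ is a three-dimensional simple subalgebra $\mathfrak h$ whose complexification contains a principal (regular) nilpotent element of $\mathfrak g_2\otimes\mathbb C$ (one whose adjoint orbit is dense in the nilpotent variety). A principal subalgebra $\mathfrak h$ is adapted to $V\in\mathfrak M_S$ if $\mathfrak h=(\mathfrak h\cap\mathfrak h_4^V)\oplus(\mathfrak h\cap\mathfrak m_4^V)$. *)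

(* Defs.v *)
From HB Require Import structures.
From mathcomp Require Import all_boot all_order all_algebra.
From mathcomp Require Import reals.
From mathcomp Require Import complex.
Set Implicit Arguments. Unset Strict Implicit. Unset Printing Implicit Defensive.
Import Order.TTheory GRing.Theory Num.Theory.
Local Open Scope ring_scope.

(* basis indices 0..6 stand for e_1..e_7; "mod 7" is taken on 0-based indices,
   which is the same Fano-plane rule e_i x e_(i+1) = e_(i+3). *)
Definition fano_line (i a b c : nat) : bool :=
  [&& a == i, b == ((i + 1) %% 7)%N & c == ((i + 3) %% 7)%N].

Definition fano_cyc (a b c : 'I_7) : bool :=
  [exists i : 'I_7, [|| fano_line i a b c, fano_line i b c a | fano_line i c a b]].

Definition g2eps (T : pzRingType) (a b c : 'I_7) : T :=
  if fano_cyc a b c then 1 else if fano_cyc b a c then -1 else 0.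

Definition cross (T : comPzRingType) (x y : 'rV[T]_7) : 'rV[T]_7 :=
  \row_c \sum_(a < 7) \sum_(b < 7) g2eps T a b c * x 0 a * y 0 b.

Definition dot (T : comPzRingType) (x y : 'rV[T]_7) : T := (x *m y^T) 0 0.

(* a matrix d acts on vectors as the linear map x |-> d x (column convention,
   written on row vectors); composition of maps = matrix product *)
Definition app (T : comPzRingType) (d : 'M[T]_7) (x : 'rV[T]_7) : 'rV[T]_7 :=
  x *m d^T.

Definition lie (T : comPzRingType) (A B : 'M[T]_7) : 'M[T]_7 := A *m B - B *m A.

Definition is_der (T : comPzRingType) (d : 'M[T]_7) : Prop :=
  forall x y, app d (cross x y) = cross (app d x) y + cross x (app d y).

Definition is_aut (T : comUnitRingType) (g : 'M[T]_7) : Prop :=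
  g \in unitmx /\ forall x y, app g (cross x y) = cross (app g x) (app g y).

Section Real.
Variable R : realType.

(* subspaces of R^7 are represented by row spaces of 7x7 matrices *)
Definition inperp (V : 'M[R]_7) (x : 'rV[R]_7) : Prop :=
  forall y : 'rV[R]_7, (y <= V)%MS -> dot x y = 0.

Definition inMS (V : 'M[R]_7) : Prop :=
  \rank V = 3 /\
  forall x y : 'rV[R]_7, (x <= V)%MS -> (y <= V)%MS -> (cross x y <= V)%MS.

Definition g2 (d : 'M[R]_7) : Prop := is_der d.

Definition h2 (u : 'rV[R]_7) (d : 'M[R]_7) : Prop := g2 d /\ app d u = 0.

Definition h4 (V : 'M[R]_7) (d : 'M[R]_7) : Prop :=
  g2 d /\ forall x, inperp V x -> inperp V (app d x).

Definition m4 (V : 'M[R]_7) (d : 'M[R]_7) : Prop :=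
  g2 d /\ (forall x, (x <= V)%MS -> inperp V (app d x))
       /\ (forall x, inperp V x -> (app d x <= V)%MS).

(* linear subspaces of gl(7,R) = row spaces of (7*7)x(7*7) matrices, via mxvec *)
Definition inS (S : 'M[R]_(7 * 7)) (A : 'M[R]_7) : Prop := (mxvec A <= S)%MS.

Definition lts_m4 (V : 'M[R]_7) (S : 'M[R]_(7 * 7)) : Prop :=
  (forall A, inS S A -> m4 V A) /\
  (forall A B C, inS S A -> inS S B -> inS S C -> inS S (lie (lie A B) C)).

Definition proper_m4 (V : 'M[R]_7) (S : 'M[R]_(7 * 7)) : Prop :=
  exists A, m4 V A /\ ~ inS S A.

Definition maximal_lts_m4 (V : 'M[R]_7) (S : 'M[R]_(7 * 7)) : Prop :=
  [/\ lts_m4 V S, proper_m4 V S &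
      forall T : 'M[R]_(7 * 7), lts_m4 V T -> proper_m4 V T ->
        (S <= T)%MS -> (T <= S)%MS].

Local Notation C := (complex R).

Definition complexify (A B : 'M[R]_7) : 'M[C]_7 :=
  \matrix_(i, j) Complex (A i j) (B i j).

Definition g2C (X : 'M[C]_7) : Prop := is_der X.

Definition nilvarC (X : 'M[C]_7) : Prop :=
  g2C X /\ exists n : nat, forall Y, g2C Y -> iter n (lie X) Y = 0.

(* principal nilpotent: nilpotent, and its adjoint orbit under
   G2(C) = Aut(C^7, x) is dense (entrywise/classical topology) in the
   nilpotent variety *)
Definition principal_nilpotent (e : 'M[C]_7) : Prop :=
  nilvarC e /\
  forall X, nilvarC X -> forall eps : R, 0 < eps ->
    exists g : 'M[C]_7, is_aut g /\
      forall i j, `|(g *m e *m invmx g) i j - X i j| < (eps%:C)%C.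

Definition principal_subalg (h : 'M[R]_(7 * 7)) : Prop :=
  [/\ (forall A, inS h A -> g2 A),
      \rank h = 3,
      (forall A B, inS h A -> inS h B -> inS h (lie A B)),
      (exists A B, [/\ inS h A, inS h B & lie A B != 0]) /\
      (forall I : 'M[R]_(7 * 7), (I <= h)%MS ->
         (forall A B, inS h A -> inS I B -> inS I (lie A B)) ->
         \rank I = 0%N \/ (h <= I)%MS)
    & exists A B, [/\ inS h A, inS h B & principal_nilpotent (complexify A B)]].

(* h = (h /\ h4^V) (+) (h /\ m4^V)  (the sum is automatically direct) *)
Definition adapted (V : 'M[R]_7) (h : 'M[R]_(7 * 7)) : Prop :=
  forall A, inS h A -> exists A1 A2,
    [/\ inS h A1, h4 V A1, inS h A2, m4 V A2 & A = A1 + A2].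

End Real.

(* Main.v *)
Require Import Defs.
From Stdlib Require Classical_Prop.
From HB Require Import structures.
From mathcomp Require Import all_boot all_order all_algebra.
From mathcomp Require Import reals.
From mathcomp Require Import complex polyrcf ring lra zify.

(** For a frame p1, p2, p1 x p2 of V and a unit w orthogonal to V, the elements of [m4 V]
    correspond to traceless real 3x3 matrices, and every element is diagonal in a suitable
    frame.  Splitting a proper Lie triple subsystem P along the eigenspaces of the square of
    ad x for a diagonal x in P, and distinguishing x generic, proportional to diag(1,2,-3),
    diag(-2,1,1) or diag(1,-1,0), shows that P kills a nonzero vector of V or of its
    orthogonal, stabilizes a quaternionic W = <v, w, v x w>, or lies in the span of x and y
    where x, y, [x,y] span a principal subalgebra.  Each of the listed subsystems therefore is
    maximal as soon as it is not contained in another one of a different kind.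

    Over the complex numbers, a null frame of the cross product brings every nilpotent
    derivation to strictly triangular form with coefficients a1, a2 on the simple roots; all
    those with a1, a2 nonzero are conjugate and they are dense, so they are principal.
    Conversely a principal e is not killed by the sixth power, which is a closed condition
    failing for one nilpotent.  Hence a principal subalgebra has no invariant subspace: on an
    invariant subspace and its orthogonal complement e^6 would vanish. *)

Set Implicit Arguments. Unset Strict Implicit. Unset Printing Implicit Defensive.
Import Order.TTheory GRing.Theory Num.Theory.
Local Open Scope ring_scope.

(** [m4 V] is the tangent space of the rank two symmetric space G2/SO(4), with restricted root
    system of type G2. On diag(a, b, -a-b) the short roots are a, b, a+b and the long ones a-b,
    a+2b, 2a+b; B -> [[x,B],x] multiplies each root space by the squared root. So x is generic when
    the six squares are nonzero and distinct. The excluded values form twelve lines, which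
    permutations of (a, b, -a-b) reduce to the three named types. The obstacle is that eigenspaces
    merge on these lines. A component y of P in a merged eigenspace is constrained only through
    [[x,y],y], which must lie in the part of P commuting with x. The types are excluded one after
    another because the last case needs information on all of P: once every nonzero element of P is
    proportional to diag(1,-1,0) in some frame, every element of P kills a vector of V. Principality
    is defined by a dense orbit, so it demands a normal form of all nilpotent elements;
    ad-nilpotency on g2 has to be converted beforehand into nilpotency on C^7. *)

Notation "''o_' k" := (@Ordinal 7 k isT) (at level 8, k at level 2, format "''o_' k").

(** * Coordinates in dimension seven *)

Lemma ord7_ind (P : 'I_7 -> Prop) :
  P 'o_0 -> P 'o_1 -> P 'o_2 -> P 'o_3 -> P 'o_4 -> P 'o_5 -> P 'o_6 -> forall i, P i.
Proof.
move=> h0 h1 h2 h3 h4 h5 h6 [[|[|[|[|[|[|[|k]]]]]]] hk] //;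
  by rewrite (bool_irrelevance hk isT).
Qed.

Lemma sum7 (U : nmodType) (F : 'I_7 -> U) :
  \sum_i F i = F 'o_0 + F 'o_1 + F 'o_2 + F 'o_3 + F 'o_4 + F 'o_5 + F 'o_6.
Proof.
rewrite !big_ord_recl big_ord0 addr0 !addrA.
by congr (_ + _ + _ + _ + _ + _ + _); congr F; apply: val_inj.
Qed.

Lemma row7P (T : Type) (x y : 'rV[T]_7) :
  x 0 'o_0 = y 0 'o_0 -> x 0 'o_1 = y 0 'o_1 -> x 0 'o_2 = y 0 'o_2 ->
  x 0 'o_3 = y 0 'o_3 -> x 0 'o_4 = y 0 'o_4 -> x 0 'o_5 = y 0 'o_5 ->
  x 0 'o_6 = y 0 'o_6 -> x = y.
Proof. by move=> *; apply/rowP; elim/ord7_ind. Qed.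

Definition v7 (T : pzRingType) (a0 a1 a2 a3 a4 a5 a6 : T) : 'rV[T]_7 :=
  \row_j nth 0 [:: a0; a1; a2; a3; a4; a5; a6] j.

Lemma v7_eta (T : pzRingType) (x : 'rV[T]_7) :
  x = v7 (x 0 'o_0) (x 0 'o_1) (x 0 'o_2) (x 0 'o_3) (x 0 'o_4) (x 0 'o_5) (x 0 'o_6).
Proof. by apply: row7P; rewrite mxE. Qed.

(** Replaces the quantifier over ordinals, which does not reduce, by [has] over an explicit list, so
    that the structure constants can be computed in [crossE]. *)
Lemma fano_cycE (a b c : 'I_7) : fano_cyc a b c =
  has (fun i => [|| fano_line i a b c, fano_line i b c a | fano_line i c a b]) (iota 0 7).
Proof.
apply/existsP/hasP.
  by case=> i hi; exists (val i); rewrite // mem_iota ltn_ord.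
case=> i; rewrite mem_iota => hi hP; exact: (ex_intro _ (Ordinal (hi : (i < 7)%N)) hP).
Qed.

Section Cross.
Variable T : comNzRingType.
Implicit Types x y z : 'rV[T]_7.

Lemma crossE x y : cross x y =
  v7 (x 0 'o_1 * y 0 'o_3 + x 0 'o_2 * y 0 'o_6 - x 0 'o_3 * y 0 'o_1 + x 0 'o_4 * y 0 'o_5 - x 0 'o_5 * y 0 'o_4 - x 0 'o_6 * y 0 'o_2)
     (- x 0 'o_0 * y 0 'o_3 + x 0 'o_2 * y 0 'o_4 + x 0 'o_3 * y 0 'o_0 - x 0 'o_4 * y 0 'o_2 + x 0 'o_5 * y 0 'o_6 - x 0 'o_6 * y 0 'o_5)
     (- x 0 'o_0 * y 0 'o_6 - x 0 'o_1 * y 0 'o_4 + x 0 'o_3 * y 0 'o_5 + x 0 'o_4 * y 0 'o_1 - x 0 'o_5 * y 0 'o_3 + x 0 'o_6 * y 0 'o_0)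
     (x 0 'o_0 * y 0 'o_1 - x 0 'o_1 * y 0 'o_0 - x 0 'o_2 * y 0 'o_5 + x 0 'o_4 * y 0 'o_6 + x 0 'o_5 * y 0 'o_2 - x 0 'o_6 * y 0 'o_4)
     (- x 0 'o_0 * y 0 'o_5 + x 0 'o_1 * y 0 'o_2 - x 0 'o_2 * y 0 'o_1 - x 0 'o_3 * y 0 'o_6 + x 0 'o_5 * y 0 'o_0 + x 0 'o_6 * y 0 'o_3)
     (x 0 'o_0 * y 0 'o_4 - x 0 'o_1 * y 0 'o_6 + x 0 'o_2 * y 0 'o_3 - x 0 'o_3 * y 0 'o_2 - x 0 'o_4 * y 0 'o_0 + x 0 'o_6 * y 0 'o_1)
     (x 0 'o_0 * y 0 'o_2 + x 0 'o_1 * y 0 'o_5 - x 0 'o_2 * y 0 'o_0 + x 0 'o_3 * y 0 'o_4 - x 0 'o_4 * y 0 'o_3 - x 0 'o_5 * y 0 'o_1).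
Proof.
(* [eps] takes plain natural numbers, so that [/=] evaluates every structure constant. *)
pose eps (a b c : nat) : T := let cyc a b c :=
  has (fun i => [|| fano_line i a b c, fano_line i b c a | fano_line i c a b]) (iota 0 7) in
  if cyc a b c then 1 else if cyc b a c then - 1 else 0.
have E c : cross x y 0 c = \sum_(a < 7) \sum_(b < 7) eps a b c * x 0 a * y 0 b.
  by rewrite mxE; apply: eq_bigr => a _; apply: eq_bigr => b _; rewrite /g2eps !fano_cycE.
by apply: row7P; rewrite E [RHS]mxE !sum7 /eps /=; ring.
Qed.

Lemma cross_v7 (x0 x1 x2 x3 x4 x5 x6 y0 y1 y2 y3 y4 y5 y6 : T) :
  cross (v7 x0 x1 x2 x3 x4 x5 x6) (v7 y0 y1 y2 y3 y4 y5 y6) =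
  v7 (x1 * y3 + x2 * y6 + x4 * y5 - x3 * y1 - x5 * y4 - x6 * y2)
     (x2 * y4 + x3 * y0 + x5 * y6 - x0 * y3 - x4 * y2 - x6 * y5)
     (x3 * y5 + x4 * y1 + x6 * y0 - x0 * y6 - x1 * y4 - x5 * y3)
     (x0 * y1 + x4 * y6 + x5 * y2 - x1 * y0 - x2 * y5 - x6 * y4)
     (x1 * y2 + x5 * y0 + x6 * y3 - x0 * y5 - x2 * y1 - x3 * y6)
     (x0 * y4 + x2 * y3 + x6 * y1 - x1 * y6 - x3 * y2 - x4 * y0)
     (x0 * y2 + x1 * y5 + x3 * y4 - x2 * y0 - x4 * y3 - x5 * y1) :> 'rV[T]_7.
Proof. by rewrite crossE; apply: row7P; rewrite !mxE /=; ring. Qed.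

Lemma dot_v7 (x0 x1 x2 x3 x4 x5 x6 y0 y1 y2 y3 y4 y5 y6 : T) :
  dot (v7 x0 x1 x2 x3 x4 x5 x6) (v7 y0 y1 y2 y3 y4 y5 y6) = x0 * y0 + x1 * y1 + x2 * y2 + x3 * y3 + x4 * y4 + x5 * y5 + x6 * y6 :> T.
Proof. by rewrite /dot mxE sum7 !mxE. Qed.

Lemma add_v7 (x0 x1 x2 x3 x4 x5 x6 y0 y1 y2 y3 y4 y5 y6 : T) :
  v7 x0 x1 x2 x3 x4 x5 x6 + v7 y0 y1 y2 y3 y4 y5 y6 = v7 (x0 + y0) (x1 + y1) (x2 + y2) (x3 + y3) (x4 + y4) (x5 + y5) (x6 + y6) :> 'rV[T]_7.
Proof. by apply: row7P; rewrite !mxE. Qed.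

Lemma opp_v7 (x0 x1 x2 x3 x4 x5 x6 : T) :
  - v7 x0 x1 x2 x3 x4 x5 x6 = v7 (- x0) (- x1) (- x2) (- x3) (- x4) (- x5) (- x6) :> 'rV[T]_7.
Proof. by apply: row7P; rewrite !mxE. Qed.

Lemma scale_v7 (k x0 x1 x2 x3 x4 x5 x6 : T) :
  k *: v7 x0 x1 x2 x3 x4 x5 x6 = v7 (k * x0) (k * x1) (k * x2) (k * x3) (k * x4) (k * x5) (k * x6) :> 'rV[T]_7.
Proof. by apply: row7P; rewrite !mxE. Qed.

Definition v7E := (cross_v7, scale_v7, opp_v7, add_v7, dot_v7).
End Cross.

Ltac coords x :=
  rewrite (v7_eta x); move: (x 0 'o_0) (x 0 'o_1) (x 0 'o_2) (x 0 'o_3) (x 0 'o_4) (x 0 'o_5) (x 0 'o_6) => {x} ? ? ? ? ? ? ?.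

(** * The seven-dimensional cross product *)

Section CrossTheory.
Variable T : comNzRingType.
Implicit Types (x y z : 'rV[T]_7) (k : T) (d : 'M[T]_7).

Lemma dotE x y : dot x y =
  x 0 'o_0 * y 0 'o_0 + x 0 'o_1 * y 0 'o_1 + x 0 'o_2 * y 0 'o_2 + x 0 'o_3 * y 0 'o_3
  + x 0 'o_4 * y 0 'o_4 + x 0 'o_5 * y 0 'o_5 + x 0 'o_6 * y 0 'o_6.
Proof. by rewrite /dot mxE sum7 !mxE. Qed.

Lemma dotC x y : dot x y = dot y x. Proof. rewrite !dotE; ring. Qed.
Lemma dotDl x y z : dot (x + y) z = dot x z + dot y z.
Proof. by rewrite /dot mulmxDl mxE. Qed.
Lemma dotDr x y z : dot z (x + y) = dot z x + dot z y.
Proof. by rewrite dotC dotDl !(dotC z). Qed.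
Lemma dotZl k x y : dot (k *: x) y = k * dot x y.
Proof. by rewrite /dot -scalemxAl mxE. Qed.
Lemma dotZr k x y : dot x (k *: y) = k * dot x y.
Proof. by rewrite dotC dotZl dotC. Qed.
Lemma dotNl x y : dot (- x) y = - dot x y.
Proof. by rewrite -scaleN1r dotZl mulN1r. Qed.
Lemma dotNr x y : dot x (- y) = - dot x y.
Proof. by rewrite dotC dotNl dotC. Qed.
Lemma dot0l x : dot 0 x = 0. Proof. by rewrite /dot mul0mx mxE. Qed.
Lemma dot0r x : dot x 0 = 0. Proof. by rewrite dotC dot0l. Qed.

Definition dot_lin := (dotDl, dotDr, dotZl, dotZr, dotNl, dotNr, dot0l, dot0r).

Lemma crossC x y : cross x y = - cross y x.
Proof. by coords x; coords y; rewrite !v7E; congr v7; ring. Qed.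
Lemma crossDl x y z : cross (x + y) z = cross x z + cross y z.
Proof. by coords x; coords y; coords z; rewrite !v7E; congr v7; ring. Qed.
Lemma crossZl k x y : cross (k *: x) y = k *: cross x y.
Proof. by coords x; coords y; rewrite !v7E; congr v7; ring. Qed.
Lemma crossDr x y z : cross z (x + y) = cross z x + cross z y.
Proof. by rewrite crossC crossDl opprD -!crossC. Qed.
Lemma crossZr k x y : cross x (k *: y) = k *: cross x y.
Proof. by rewrite crossC crossZl -scalerN -crossC. Qed.
Lemma crossNl x y : cross (- x) y = - cross x y.
Proof. by rewrite -scaleN1r crossZl scaleN1r. Qed.
Lemma crossNr x y : cross x (- y) = - cross x y.
Proof. by rewrite -scaleN1r crossZr scaleN1r. Qed.
Lemma cross0l x : cross 0 x = 0. Proof. by have := crossZl 0 0 x; rewrite !scale0r. Qed.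
Lemma cross0r x : cross x 0 = 0. Proof. by have := crossZr 0 x 0; rewrite !scale0r. Qed.
Lemma crossxx x : cross x x = 0.
Proof. by coords x; rewrite !v7E; apply: row7P; rewrite !mxE /=; ring. Qed.

Definition cross_lin :=
  (crossDl, crossDr, crossZl, crossZr, crossNl, crossNr, cross0l, cross0r).

(** Polarization of the rule for x × (x × z). It stands in for associativity: when the scalar
    products vanish, two factors may be exchanged at the cost of a sign. *)
Lemma cross_cross x y z :
  cross x (cross y z) + cross y (cross x z)
  = dot x z *: y + dot y z *: x - (2 * dot x y) *: z.
Proof. by coords x; coords y; coords z; rewrite !v7E; congr v7; ring. Qed.

Lemma cross_crossx x y : cross x (cross x y) = dot x y *: x - dot x x *: y.
Proof. by coords x; coords y; rewrite !v7E; congr v7; ring. Qed.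

Lemma dot_cross x y z : dot (cross x y) z = dot x (cross y z).
Proof. by coords x; coords y; coords z; rewrite !v7E; ring. Qed.

Lemma dot_cross2 x y z :
  dot (cross x y) (cross x z) = dot x x * dot y z - dot x y * dot x z.
Proof.
by rewrite (crossC x y) dotNl dot_cross cross_crossx !dot_lin (dotC y x); ring.
Qed.

Lemma dot_crossl x y : dot x (cross x y) = 0.
Proof. by rewrite -dot_cross crossxx dot0l. Qed.
Lemma dot_crossr x y : dot y (cross x y) = 0.
Proof. by rewrite dotC dot_cross crossxx dot0r. Qed.

Lemma appD d x y : app d (x + y) = app d x + app d y.
Proof. exact: mulmxDl. Qed.
Lemma appZ d k x : app d (k *: x) = k *: app d x.
Proof. by rewrite /app scalemxAl. Qed.
Lemma appN d x : app d (- x) = - app d x.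
Proof. exact: mulNmx. Qed.
Lemma app0 d : app d 0 = 0.
Proof. exact: mul0mx. Qed.
Lemma app_mulmx d d' x : app (d *m d') x = app d (app d' x).
Proof. by rewrite /app trmx_mul mulmxA. Qed.
Lemma app_addmx d d' x : app (d + d') x = app d x + app d' x.
Proof. by rewrite /app linearD mulmxDr. Qed.
Lemma app_oppmx d x : app (- d) x = - app d x.
Proof. by rewrite /app linearN mulmxN. Qed.
Lemma app_scalemx k d x : app (k *: d) x = k *: app d x.
Proof. by rewrite /app linearZ /= scalemxAr. Qed.
Lemma app_0mx x : app 0 x = 0.
Proof. by rewrite /app linear0 mulmx0. Qed.
Lemma app_1mx x : app 1%:M x = x.
Proof. by rewrite /app trmx1 mulmx1. Qed.
Lemma app_lie d d' x : app (lie d d') x = app d (app d' x) - app d' (app d x).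
Proof. by rewrite /lie app_addmx app_oppmx !app_mulmx. Qed.
Definition app_lin := (appD, appZ, appN, app0).
Definition app_mxlin := (app_addmx, app_oppmx, app_scalemx, app_0mx, app_1mx).

Lemma app_inj d d' : (forall x, app d x = app d' x) -> d = d'.
Proof.
move=> h; apply: trmx_inj; apply/row_matrixP => i.
by rewrite !rowE; apply: h.
Qed.

Lemma lieC d d' : lie d d' = - lie d' d.
Proof. by rewrite /lie opprB. Qed.
Lemma lieDl d1 d2 d : lie (d1 + d2) d = lie d1 d + lie d2 d.
Proof. rewrite /lie mulmxDl mulmxDr opprD !addrA; congr (_ - _); rewrite -!addrA; congr (_ + _); exact: addrC. Qed.
Lemma lieZl k d d' : lie (k *: d) d' = k *: lie d d'.
Proof. by rewrite /lie -scalemxAl -scalemxAr scalerBr. Qed.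
Lemma lieDr d1 d2 d : lie d (d1 + d2) = lie d d1 + lie d d2.
Proof. by rewrite lieC lieDl opprD -!lieC. Qed.
Lemma lieZr k d d' : lie d (k *: d') = k *: lie d d'.
Proof. by rewrite lieC lieZl -scalerN -lieC. Qed.
Lemma liexx d : lie d d = 0. Proof. by rewrite /lie subrr. Qed.
Lemma lieNr d d' : lie d (- d') = - lie d d'.
Proof. by rewrite -scaleN1r lieZr scaleN1r. Qed.
Lemma lie0r d : lie d 0 = 0. Proof. by rewrite /lie mulmx0 mul0mx subrr. Qed.
Lemma lie0l d : lie 0 d = 0. Proof. by rewrite /lie mulmx0 mul0mx subrr. Qed.

Lemma is_der_lin k d d' : is_der d -> is_der d' -> is_der (k *: d + d').
Proof.
move=> h h' x y; rewrite !app_mxlin h h' !cross_lin scalerDr.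
by rewrite -!addrA; congr (_ + _); rewrite addrCA.
Qed.

Lemma is_der_lie d d' : is_der d -> is_der d' -> is_der (lie d d').
Proof.
move=> h h' x y; rewrite !app_lie h h' !appD h h' !h' !h !cross_lin.
set a := cross _ (app d (app d' y)); set b := cross _ (app d' (app d y)).
set a' := cross (app d (app d' x)) _; set b' := cross (app d' (app d x)) _.
set p := cross (app d' x) _; set q := cross (app d x) _.
by apply/rowP => j; rewrite !mxE; ring.
Qed.

Lemma is_der0 : is_der (0 : 'M[T]_7).
Proof. by move=> x y; rewrite !app_0mx !cross_lin addr0. Qed.

Lemma app_row x d : app d x = \sum_j x 0 j *: row j d^T.
Proof. exact: mulmx_sum_row. Qed.

Lemma delta_v7 (i : 'I_7) (x : 'rV[T]_7) : dot x (delta_mx 0 i) = x 0 i.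
Proof. by rewrite /dot trmx_delta -colE mxE. Qed.

Lemma dot_eq0P x : (forall y, dot x y = 0) -> x = 0.
Proof. by move=> h; apply/rowP => j; rewrite -delta_v7 h mxE. Qed.

End CrossTheory.

(** * Basic triples and the automorphisms they determine *)

Section Triple.
Variable T : fieldType.
Implicit Types (a b c u v w x y z : 'rV[T]_7).

Lemma line_cyc u v w : dot u u = 1 -> dot v v = 1 -> dot u v = 0 -> cross u v = w ->
  [/\ cross v w = u, cross w u = v, dot w w = 1, dot u w = 0 & dot v w = 0].
Proof.
move=> uu vv uv <-; split.
- by rewrite (crossC u) crossNr cross_crossx vv (dotC v) uv scale0r scale1r sub0r opprK.
- by rewrite crossC cross_crossx uv uu scale0r scale1r sub0r opprK.
- by rewrite dot_cross2 uu vv uv mulr0 subr0 mulr1.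
- exact: dot_crossl.
- exact: dot_crossr.
Qed.

Lemma dot_app_tr (d : 'M[T]_7) x y : dot (app d^T x) y = dot x (app d y).
Proof. by rewrite /dot /app trmxK trmx_mul trmxK mulmxA. Qed.

Lemma dot_app_orth (d : 'M[T]_7) :
  (forall x y, dot (app d x) (app d y) = dot x y) -> d *m d^T = 1%:M.
Proof.
move=> h; apply: mulmx1C; apply: app_inj => x; apply/eqP; rewrite -subr_eq0; apply/eqP.
by apply: dot_eq0P => y; rewrite !dot_lin app_mulmx dot_app_tr h app_1mx subrr.
Qed.

Definition triple_rows a b c : seq 'rV[T]_7 :=
  [:: a; b; c; cross a b; cross b c; cross c (cross a b); cross a c].

(* [e3 = e0 x e1], [e4 = e1 x e2], [e5 = e2 x e3] and [e6 = e0 x e2]. *)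
Definition triple_mx a b c : 'M[T]_7 := (\matrix_(i < 7) nth 0 (triple_rows a b c) i)^T.

Lemma app_triple a b c x : app (triple_mx a b c) x =
  x 0 'o_0 *: a + x 0 'o_1 *: b + x 0 'o_2 *: c + x 0 'o_3 *: cross a b
  + x 0 'o_4 *: cross b c + x 0 'o_5 *: cross c (cross a b) + x 0 'o_6 *: cross a c.
Proof. by rewrite /app trmxK mulmx_sum_row sum7 !rowK. Qed.

Section Basic.
Variables a b c : 'rV[T]_7.
Hypotheses (aa : dot a a = 1) (bb : dot b b = 1) (cc : dot c c = 1).
Hypotheses (ab : dot a b = 0) (ac : dot a c = 0) (bc : dot b c = 0).
Hypothesis (abc : dot c (cross a b) = 0).
Let o := cross a b.
Let p := cross b c.
Let q := cross c o.
Let r := cross a c.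

(** Each of the seven Fano lines needs one product, which [line_cyc] then rotates. Four lines hold
    by the definition of o, p, q, r; for (o, p, r), (p, q, a) and (q, r, b) the product comes from
    [cross_cross], orthogonality removing the scalar terms. *)
Lemma triple_orthonormal_cross :
  [/\ [/\ cross a b = o, cross b o = a & cross o a = b],
      [/\ cross b c = p, cross c p = b & cross p b = c],
      [/\ cross c o = q, cross o q = c & cross q c = o],
      [/\ cross o p = r, cross p r = o & cross r o = p] &
   [/\ [/\ cross p q = a, cross q a = p & cross a p = q],
      [/\ cross q r = b, cross r b = q & cross b q = r],
      [/\ cross r a = c, cross a c = r & cross c r = a],
     [/\ dot o o = 1, dot p p = 1, dot q q = 1 & dot r r = 1] &
  [/\ [/\ dot a o = 0, dot a p = 0, dot a q = 0 & dot a r = 0],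
      [/\ dot b o = 0, dot b p = 0, dot b q = 0 & dot b r = 0],
      [/\ dot c o = 0, dot c p = 0, dot c q = 0 & dot c r = 0],
      [/\ dot o p = 0, dot o q = 0 & dot o r = 0] &
      [/\ dot p q = 0, dot p r = 0 & dot q r = 0]] ]].
Proof.
have co : dot c o = 0 by [].
have [e1 e2 oo ao bo] := line_cyc aa bb ab (erefl o).
have [e3 e4 pp bp cp] := line_cyc bb cc bc (erefl p).
have [e5 e6 qq cq oq] := line_cyc cc oo co (erefl q).
have [e7 e8 rr ar cr] := line_cyc aa cc ac (erefl r).
have ap : dot a p = 0 by rewrite -dot_cross dotC.
have op : cross o p = r.
  have := cross_cross p a b; rewrite -/o (dotC p b) bp ab (dotC p a) ap e4 -/r.
  rewrite mulr0 !scale0r subr0 addr0 => /eqP; rewrite addr_eq0 => /eqP h.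
  by rewrite crossC h opprK.
have dop : dot o p = 0.
  by rewrite /o (crossC a) dotNl dot_cross2 ac bc mulr0 mulr0 subr0 oppr0.
have [f1 f2 _ dor dpr] := line_cyc oo pp dop op.
have dpq : dot p q = 0.
  by rewrite /p (crossC b) dotNl dot_cross2 bo co !mulr0 subr0 oppr0.
have pq : cross p q = a.
  have := cross_cross p c o; rewrite -/q (dotC p o) dop co (dotC p c) cp.
  rewrite (crossC p o) op !crossNr e7 mulr0 !scale0r !addr0 subr0 => /eqP.
  by rewrite subr_eq0 => /eqP.
have [g1 g2 _ dpa dqa] := line_cyc pp qq dpq pq.
have qr : cross q r = b.
  have := cross_cross q a c; rewrite -/r (dotC q c) cq ac dqa e6 (crossC a o) e2.
  by rewrite mulr0 !scale0r !addr0 subr0 => /eqP; rewrite subr_eq0 => /eqP.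
have dqr : dot q r = 0.
  by rewrite /r (crossC a) dotNr dot_cross2 (dotC o) ao (dotC c a) ac !mulr0 subr0 oppr0.
have [h1 h2 _ dqb drb] := line_cyc qq rr dqr qr.
do !split => //; by rewrite dotC.
Qed.

Lemma dot_app_triple x y :
  dot (app (triple_mx a b c) x) (app (triple_mx a b c) y) = dot x y.
Proof.
have [_ _ _ _ [_ _ _ [oo pp qq rr] [[? ? ? ?] [? ? ? ?] [? ? ? ?] [? ? ?] [? ? ?]]]] :=
  triple_orthonormal_cross.
rewrite !app_triple -/o -/p -/q -/r !dot_lin.
have H (u v : 'rV[T]_7) : dot u v = 0 -> dot v u = 0 by rewrite dotC.
rewrite !(aa, bb, cc, oo, pp, qq, rr).
have [ba ca cb] : [/\ dot b a = 0, dot c a = 0 & dot c b = 0] by rewrite !(dotC _ a) (dotC c).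
rewrite !(ab, ac, bc, ba, ca, cb).
do !match goal with h : dot ?u ?v = 0 |- _ => rewrite ?h ?(H _ _ h); clear h end.
rewrite dotE; ring.
Qed.

Lemma triple_mx_orth : triple_mx a b c *m (triple_mx a b c)^T = 1%:M.
Proof. exact: dot_app_orth dot_app_triple. Qed.

Lemma cross_app_triple x y :
  cross (app (triple_mx a b c) x) (app (triple_mx a b c) y) = app (triple_mx a b c) (cross x y).
Proof.
have [[a1 a2 a3] [b1 b2 b3] [c1 c2 c3] [d1 d2 d3] [[e1 e2 e3] [f1 f2 f3] [g1 g2 g3] _ _]] :=
  triple_orthonormal_cross.
rewrite !app_triple -/o -/p -/q -/r !cross_lin !crossxx.
rewrite !(a1, a2, a3, b1, b2, b3, c1, c2, c3, d1, d2, d3, e1, e2, e3, f1, f2, f3, g1, g2, g3).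
rewrite (crossC b a) (crossC o b) (crossC a o) (crossC c b) (crossC p c) (crossC b p).
rewrite (crossC o c) (crossC q o) (crossC c q) (crossC p o) (crossC r p) (crossC o r).
rewrite (crossC q p) (crossC a q) (crossC p a) (crossC r q) (crossC b r) (crossC q b).
rewrite (crossC a r) (crossC c a) (crossC r c).
rewrite !(a1, a2, a3, b1, b2, b3, c1, c2, c3, d1, d2, d3, e1, e2, e3, f1, f2, f3, g1, g2, g3).
coords x; coords y; rewrite cross_v7; move: a b c o p q r => a' b' c' o' p' q' r'.
apply/rowP => j; rewrite !mxE /=; ring.
Qed.

(** A basic triple has the multiplication table of e0, e1, e2, so the linear map sending one to the
    other is an automorphism. Adapted frames and null frames are both obtained this way. *)
Lemma triple_mx_aut : is_aut (triple_mx a b c).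
Proof.
split; last by move=> x y; rewrite cross_app_triple.
by case/mulmx1_unit: triple_mx_orth.
Qed.
End Basic.

End Triple.

(** * Derivations are skew-symmetric *)

Section Der.
Variable T : numFieldType.
Implicit Types (x y z : 'rV[T]_7) (d : 'M[T]_7).

(* Differentiate [x x (x x y) = <x,y> x - <x,x> y] at [d]. *)
Lemma der_dot d x y : is_der d ->
  (dot (app d x) y + dot x (app d y)) *: x = (2 * dot x (app d x)) *: y.
Proof.
move=> hd; have h := congr1 (app d) (cross_crossx x y).
move: h; rewrite !hd !app_lin !cross_lin cross_crossx.
have := cross_cross (app d x) x y; rewrite addrA.
move=> -> ; rewrite -addrA => h.
apply/rowP => j; have := congr1 (fun v : 'rV[T]_7 => v 0 j) h; rewrite !mxE => e.
rewrite (dotC (app d x) x) in e.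
apply/eqP; rewrite -subr_eq0; apply/eqP; move/eqP: e; rewrite -subr_eq0 => /eqP <-; ring.
Qed.

Lemma app_delta d i j : app d (delta_mx 0 i) 0 j = d j i.
Proof. by rewrite /app -rowE !mxE. Qed.

(** For two different basis vectors in [der_dot], the coordinate along the first gives the
    antisymmetry of the off-diagonal entries, and the one along the second kills the diagonal. *)
Lemma der_skew d : is_der d -> d^T = - d.
Proof.
move=> hd; have H (i j : 'I_7) : i != j -> d i i = 0 /\ d i j = - d j i.
  move=> ij; have := der_dot (delta_mx 0 i) (delta_mx 0 j) hd => h.
  have hi := congr1 (fun v : 'rV[T]_7 => v 0 i) h; have hj := congr1 (fun v : 'rV[T]_7 => v 0 j) h.
  move: hi hj; rewrite !mxE !eqxx (negPf ij) eq_sym (negPf ij) /= !mulr1 !mulr0.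
  rewrite !(dotC (delta_mx 0 i)) !delta_v7 !app_delta => hij hii.
  split; last by apply/eqP; rewrite -addr_eq0 addrC hij.
  by apply/eqP; move/esym/eqP: hii; rewrite mulf_eq0 pnatr_eq0.
apply/matrixP => i j; rewrite !mxE; case: (eqVneq i j) => [<-|ij]; last first.
  by rewrite eq_sym in ij; case: (H _ _ ij).
have [k ik] : exists k, i != k.
  by case: (eqVneq i 'o_0) => [->|ij]; [exists 'o_1 | exists 'o_0].
by case: (H _ _ ik) => -> _; rewrite oppr0.
Qed.

Lemma der_dot_skew d x y : is_der d -> dot (app d x) y = - dot x (app d y).
Proof. by move=> hd; rewrite -{1}(trmxK d) dot_app_tr der_skew // app_oppmx dot_lin. Qed.

Lemma der_dotxx d x : is_der d -> dot x (app d x) = 0.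
Proof.
move=> hd; have /eqP := der_dot_skew x x hd; rewrite dotC -addr_eq0 -mulr2n.
by rewrite mulrn_eq0 /= => /eqP.
Qed.
End Der.

Lemma app_delta_v7 (T : comNzRingType) (d : 'M[T]_7) x : app d x =
  x 0 'o_0 *: app d (delta_mx 0 'o_0) + x 0 'o_1 *: app d (delta_mx 0 'o_1)
  + x 0 'o_2 *: app d (delta_mx 0 'o_2) + x 0 'o_3 *: app d (delta_mx 0 'o_3)
  + x 0 'o_4 *: app d (delta_mx 0 'o_4) + x 0 'o_5 *: app d (delta_mx 0 'o_5)
  + x 0 'o_6 *: app d (delta_mx 0 'o_6).
Proof. by rewrite app_row sum7 !rowE. Qed.

Lemma delta_v7E (T : comNzRingType) :
  (delta_mx 0 'o_0 = v7 1 0 0 0 0 0 0 :> 'rV[T]_7) *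
  (delta_mx 0 'o_1 = v7 0 1 0 0 0 0 0 :> 'rV[T]_7) *
  (delta_mx 0 'o_2 = v7 0 0 1 0 0 0 0 :> 'rV[T]_7) *
  (delta_mx 0 'o_3 = v7 0 0 0 1 0 0 0 :> 'rV[T]_7) *
  (delta_mx 0 'o_4 = v7 0 0 0 0 1 0 0 :> 'rV[T]_7) *
  (delta_mx 0 'o_5 = v7 0 0 0 0 0 1 0 :> 'rV[T]_7) *
  (delta_mx 0 'o_6 = v7 0 0 0 0 0 0 1 :> 'rV[T]_7).
Proof. by do !split; apply: row7P; rewrite !mxE. Qed.

Section Mx.
Variable T : comNzRingType.

Definition mxcols (s : seq 'rV[T]_7) : 'M[T]_7 := (\matrix_(i < 7) nth 0 s i)^T.

Lemma app_mxcols s x : app (mxcols s) x =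
  x 0 'o_0 *: s`_0 + x 0 'o_1 *: s`_1 + x 0 'o_2 *: s`_2 + x 0 'o_3 *: s`_3
  + x 0 'o_4 *: s`_4 + x 0 'o_5 *: s`_5 + x 0 'o_6 *: s`_6.
Proof. by rewrite /app trmxK mulmx_sum_row sum7 !rowK. Qed.

(* With p = (e0, e2, e6) and w = - e3: the derivation with d p_i = sum_j A_ij (p_j x w) + s_i w, where A
   has diagonal (a, b, - a - b), symmetric part t, antisymmetric part r, and s = 2 (r1, r2, r3). *)
Definition Mx (a b t1 t2 t3 r1 r2 r3 : T) : 'M[T]_7 := mxcols [::
  v7 0 (a) 0 (- 2 * r1) (- t2 + r2) (- t3 - r3) 0;
  v7 (- a) 0 (- t3 + r3) 0 0 0 (- t2 - r2);
  v7 0 (t3 - r3) 0 (- 2 * r2) (- t1 - r1) (- b) 0;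
  v7 (2 * r1) 0 (2 * r2) 0 0 0 (2 * r3);
  v7 (t2 - r2) 0 (t1 + r1) 0 0 0 (- a - b);
  v7 (t3 + r3) 0 (b) 0 0 0 (t1 - r1);
  v7 0 (t2 + r2) 0 (- 2 * r3) (a + b) (- t1 + r1) 0].

Lemma app_Mx (a b t1 t2 t3 r1 r2 r3 x0 x1 x2 x3 x4 x5 x6 : T) : app (Mx a b t1 t2 t3 r1 r2 r3) (v7 x0 x1 x2 x3 x4 x5 x6) = v7
  ((- a) * x1 + (2 * r1) * x3 + (t2 - r2) * x4 + (t3 + r3) * x5)
  ((a) * x0 + (t3 - r3) * x2 + (t2 + r2) * x6)
  ((- t3 + r3) * x1 + (2 * r2) * x3 + (t1 + r1) * x4 + (b) * x5)
  ((- 2 * r1) * x0 + (- 2 * r2) * x2 + (- 2 * r3) * x6)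
  ((- t2 + r2) * x0 + (- t1 - r1) * x2 + (a + b) * x6)
  ((- t3 - r3) * x0 + (- b) * x2 + (- t1 + r1) * x6)
  ((- t2 - r2) * x1 + (2 * r3) * x3 + (- a - b) * x4 + (t1 - r1) * x5).
Proof. rewrite app_mxcols /= !mxE /= !v7E; congr v7; ring. Qed.

Lemma Mx_lin k a b t1 t2 t3 r1 r2 r3 a' b' t1' t2' t3' r1' r2' r3' :
  k *: Mx a b t1 t2 t3 r1 r2 r3 + Mx a' b' t1' t2' t3' r1' r2' r3' = Mx
    (k * a + a') (k * b + b') (k * t1 + t1') (k * t2 + t2') (k * t3 + t3')
    (k * r1 + r1') (k * r2 + r2') (k * r3 + r3').
Proof.
apply: app_inj => x; coords x; rewrite app_addmx app_scalemx !app_Mx !v7E; congr v7; ring.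
Qed.

Lemma Mx_der a b t1 t2 t3 r1 r2 r3 : is_der (Mx a b t1 t2 t3 r1 r2 r3).
Proof.
move=> x y; coords x; coords y; rewrite !(app_Mx, v7E); congr v7; ring.
Qed.
End Mx.

(** * The model [V = <e0, e2, e6>] *)

Section M4std.
Variable T : numFieldType.
Implicit Types (x y : 'rV[T]_7) (d : 'M[T]_7).

Definition inV0 x := [/\ x 0 'o_1 = 0, x 0 'o_3 = 0, x 0 'o_4 = 0 & x 0 'o_5 = 0].
Definition inVp0 x := [/\ x 0 'o_0 = 0, x 0 'o_2 = 0 & x 0 'o_6 = 0].

Definition m4std d := [/\ is_der d, forall x, inV0 x -> inVp0 (app d x)
  & forall x, inVp0 x -> inV0 (app d x)].

Lemma inV0_lin k x y : inV0 x -> inV0 y -> inV0 (k *: x + y).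
Proof. by case=> h1 h2 h3 h4 [k1 k2 k3 k4]; split; rewrite !mxE ?(h1, h2, h3, h4, k1, k2, k3, k4) mulr0 addr0. Qed.

Lemma inVp0_lin k x y : inVp0 x -> inVp0 y -> inVp0 (k *: x + y).
Proof. by case=> h1 h2 h3 [k1 k2 k3]; split; rewrite !mxE ?(h1, h2, h3, k1, k2, k3) mulr0 addr0. Qed.

Lemma inV0B x y : inV0 x -> inV0 y -> inV0 (x - y).
Proof. by move=> hx hy; rewrite addrC -scaleN1r; apply: inV0_lin. Qed.
Lemma inVp0B x y : inVp0 x -> inVp0 y -> inVp0 (x - y).
Proof. by move=> hx hy; rewrite addrC -scaleN1r; apply: inVp0_lin. Qed.

Lemma m4std_lin k d d' : m4std d -> m4std d' -> m4std (k *: d + d').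
Proof.
move=> [h1 h2 h3] [h1' h2' h3']; split; first exact: is_der_lin.
  by move=> x hx; rewrite !app_mxlin; apply: inVp0_lin; auto.
by move=> x hx; rewrite !app_mxlin; apply: inV0_lin; auto.
Qed.

Lemma m4std_lie3 d1 d2 d3 : m4std d1 -> m4std d2 -> m4std d3 -> m4std (lie (lie d1 d2) d3).
Proof.
move=> [h1 k1 l1] [h2 k2 l2] [h3 k3 l3]; split; first by do 2?apply: is_der_lie.
  by move=> x hx; rewrite !app_lie; apply: inVp0B; [apply: inVp0B | apply: k3; apply: inV0B]; auto.
by move=> x hx; rewrite !app_lie; apply: inV0B; [apply: inV0B | apply: l3; apply: inVp0B]; auto.
Qed.

(** As e6 = e0 × e2, the derivation kills V. On the orthogonal complement its values lie in V and
    are tested against V by skew-symmetry. Identities in the model thus reduce to the images of e0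
    and e2. *)
Lemma m4std_eq0 d : m4std d -> app d (delta_mx 0 'o_0) = 0 -> app d (delta_mx 0 'o_2) = 0 -> d = 0.
Proof.
move=> [h1 h2 h3] e0 e2.
have e6 : app d (delta_mx 0 'o_6) = 0.
  have -> : delta_mx 0 'o_6 = cross (delta_mx 0 'o_0) (delta_mx 0 'o_2) :> 'rV[T]_7.
    rewrite !delta_v7E cross_v7; congr v7; ring.
  by rewrite h1 e0 e2 !cross_lin addr0.
have H i : inVp0 (delta_mx 0 i) -> app d (delta_mx 0 i) = 0.
  move=> /h3 [x1 x3 x4 x5]; apply: row7P; rewrite [RHS]mxE ?x1 ?x3 ?x4 ?x5 //;
  by rewrite -delta_v7 der_dot_skew // ?e0 ?e2 ?e6 dot_lin oppr0.
apply: app_inj => x; rewrite app_0mx app_delta_v7 e0 e2 e6 !H ?scaler0 ?addr0 //;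
  by split; rewrite !mxE.
Qed.

Lemma m4std_ext d d' : m4std d -> m4std d' ->
  app d (delta_mx 0 'o_0) = app d' (delta_mx 0 'o_0) ->
  app d (delta_mx 0 'o_2) = app d' (delta_mx 0 'o_2) -> d = d'.
Proof.
move=> h h' e0 e2; apply/eqP; rewrite -subr_eq0 addrC -scaleN1r; apply/eqP.
apply: m4std_eq0; first exact: m4std_lin; by rewrite !app_mxlin ?e0 ?e2 scaleN1r addNr.
Qed.

Lemma Mx_m4std a b t1 t2 t3 r1 r2 r3 : m4std (Mx a b t1 t2 t3 r1 r2 r3).
Proof.
split; first exact: Mx_der.
  by move=> x; coords x; case; rewrite !mxE /= => -> -> -> ->; rewrite app_Mx; split; rewrite !mxE /=; ring.
by move=> x; coords x; case; rewrite !mxE /= => -> -> ->; rewrite app_Mx; split; rewrite !mxE /=; ring.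
Qed.

Lemma m4std_Mx d : m4std d -> exists a b t1 t2 t3 r1 r2 r3, d = Mx a b t1 t2 t3 r1 r2 r3.
Proof.
move=> h; have [hd hV hVp] := h.
set u := app d (delta_mx 0 'o_0); set v := app d (delta_mx 0 'o_2).
have [u0 u2 u6] : inVp0 u by apply: hV; split; rewrite mxE.
have [v0 v2 v6] : inVp0 v by apply: hV; split; rewrite mxE.
(* The images of e0 and e2 have four free coordinates each; these eight linear equations are solved
   for the eight parameters. *)
exists (u 0 'o_1), (- v 0 'o_5), (- v 0 'o_4 + u 0 'o_3 / 2), (- v 0 'o_3 / 2 - u 0 'o_4),
  ((v 0 'o_1 - u 0 'o_5) / 2), (- u 0 'o_3 / 2), (- v 0 'o_3 / 2), ((- u 0 'o_5 - v 0 'o_1) / 2).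
apply: m4std_ext => //; first exact: Mx_m4std; rewrite -/u -/v delta_v7E.
  by rewrite app_Mx [LHS]v7_eta u0 u2 u6; congr v7; field.
by rewrite app_Mx [LHS]v7_eta v0 v2 v6; congr v7; field.
Qed.

(** Source of the triple products below. The factors a+2b, 2a+b, a-b attached to y2, y3, y4 and a,
    b, a+b attached to y5, y6, y7 are the long and the short restricted roots evaluated at the
    diagonal element. *)
Lemma lie_diag_Mx (a b y0 y1 y2 y3 y4 y5 y6 y7 z0 z1 z2 z3 z4 z5 z6 z7 : T) :
  lie (lie (Mx a b 0 0 0 0 0 0) (Mx y0 y1 y2 y3 y4 y5 y6 y7)) (Mx z0 z1 z2 z3 z4 z5 z6 z7) = Mx
  ((- 4 * a - 2 * b) * (y3 * z3) + (- 2 * a + 2 * b) * (y4 * z4) + (- 4 * a) * (y5 * z5) + (2 * b) * (y6 * z6) + (- 2 * a - 2 * b) * (y7 * z7))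
  ((- 2 * a - 4 * b) * (y2 * z2) + (2 * a - 2 * b) * (y4 * z4) + (2 * a) * (y5 * z5) + (- 4 * b) * (y6 * z6) + (- 2 * a - 2 * b) * (y7 * z7))
  ((a + 2 * b) * (y2 * z0) + (2 * a + 4 * b) * (y2 * z1) + (2 * a + b) * (y3 * z4) + (a - b) * (y4 * z3) + (- 3 * b) * (y6 * z7) + (3 * a + 3 * b) * (y7 * z6))
  ((a + 2 * b) * (y2 * z4) + (4 * a + 2 * b) * (y3 * z0) + (2 * a + b) * (y3 * z1) + (- a + b) * (y4 * z2) + (- 3 * a) * (y5 * z7) + (3 * a + 3 * b) * (y7 * z5))
  ((- a - 2 * b) * (y2 * z3) + (- 2 * a - b) * (y3 * z2) + (a - b) * (y4 * z0) + (- a + b) * (y4 * z1) + (- 3 * a) * (y5 * z6) + (- 3 * b) * (y6 * z5))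
  ((- 2 * a - b) * (y3 * z7) + (- a + b) * (y4 * z6) + (a) * (y5 * z0) + (b) * (y6 * z4) + (2 * b) * (y6 * z7) + (- a - b) * (y7 * z3) + (2 * a + 2 * b) * (y7 * z6))
  ((- a - 2 * b) * (y2 * z7) + (a - b) * (y4 * z5) + (a) * (y5 * z4) + (- 2 * a) * (y5 * z7) + (b) * (y6 * z1) + (- a - b) * (y7 * z2) + (- 2 * a - 2 * b) * (y7 * z5))
  ((a + 2 * b) * (y2 * z6) + (2 * a + b) * (y3 * z5) + (a) * (y5 * z3) + (2 * a) * (y5 * z6) + (b) * (y6 * z2) + (- 2 * b) * (y6 * z5) + (a + b) * (y7 * z0) + (a + b) * (y7 * z1)).
Proof.
apply: m4std_ext; [apply: m4std_lie3; exact: Mx_m4std|exact: Mx_m4std| |];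
  rewrite !(delta_v7E, app_lie, app_Mx, v7E); congr v7; ring.
Qed.
End M4std.

(** * Frames adapted to a subalgebra and diagonal form *)

Section Frame.
Variable R : realType.
Implicit Types (x y u v w : 'rV[R]_7) (d g : 'M[R]_7) (V : 'M[R]_7).

Lemma dot_ge0 x : 0 <= dot x x.
Proof. by rewrite dotE !addr_ge0 // -expr2 sqr_ge0. Qed.

Lemma dot_eq0 x : (dot x x == 0) = (x == 0).
Proof.
apply/eqP/eqP => [|->]; last by rewrite dot0l.
rewrite dotE -!expr2 => h.
have H (k : 'I_7) : x 0 k = 0.
  apply/eqP; rewrite -sqrf_eq0; move: k.
  have q i := sqr_ge0 (x 0 i).
  move: (q 'o_0) (q 'o_1) (q 'o_2) (q 'o_3) (q 'o_4) (q 'o_5) (q 'o_6) => {q} ? ? ? ? ? ? ?.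
  by elim/ord7_ind; rewrite eq_le sqr_ge0 andbT; lra.
by apply/rowP => k; rewrite H mxE.
Qed.

Lemma dot_gt0 x : x != 0 -> 0 < dot x x.
Proof. by rewrite lt_def dot_ge0 dot_eq0 andbT. Qed.

Lemma normalize x : x != 0 -> exists2 k, 0 < k & dot (k *: x) (k *: x) = 1.
Proof.
move=> /dot_gt0 h; exists (Num.sqrt (dot x x))^-1; first by rewrite invr_gt0 sqrtr_gt0.
rewrite !dot_lin mulrA -expr2 exprVn sqr_sqrtr ?ltW // mulVf //.
by rewrite gt_eqF.
Qed.

Lemma ex_orthogonal m k (A : 'M[R]_(m, 7)) (B : 'M[R]_(7, k)) :
  (k < \rank A)%N -> exists x : 'rV[R]_7, [/\ x != 0, (x <= A)%MS & x *m B = 0].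
Proof.
move=> h; have := mxrank_mul_ker A B => e.
have : (A :&: kermx B)%MS != 0.
  rewrite -mxrank_eq0; apply: contraTneq h => c0.
  by rewrite -e c0 addn0 -leqNgt rank_leq_col.
case/rowV0Pn => x; rewrite sub_capmx => /andP [xA /sub_kermxP xB] x0.
by exists x.
Qed.

Definition frame V g := [/\ is_aut g, g *m g^T = 1%:M,
  forall x, (app g x <= V)%MS <-> inV0 x & forall x, inperp V (app g x) <-> inVp0 x].

(** In the model e0 and e2 lie in V and e1 in its complement, so the basic triple is (u, u × w, v).
    Its fourth vector is u × (u × w) = -w, which explains the sign of w in all frames. *)
Lemma frame_triple V u v w : inMS V ->
  (u <= V)%MS -> (v <= V)%MS -> inperp V w ->
  dot u u = 1 -> dot v v = 1 -> dot w w = 1 -> dot u v = 0 ->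
  [/\ frame V (triple_mx u (cross u w) v),
     app (triple_mx u (cross u w) v) (delta_mx 0 'o_0) = u,
     app (triple_mx u (cross u w) v) (delta_mx 0 'o_2) = v &
     app (triple_mx u (cross u w) v) (delta_mx 0 'o_3) = - w].
Proof.
move=> [_ Vcl] uV vV wV uu vv ww uv.
have Vp x y : (x <= V)%MS -> inperp V y -> inperp V (cross x y).
  move=> xV yV z zV; rewrite crossC dotNl dot_cross.
  by rewrite yV ?oppr0 //; apply: Vcl.
have uw : dot u w = 0 by rewrite dotC wV.
have vw : dot v w = 0 by rewrite dotC wV.
have uuw : cross u (cross u w) = - w by rewrite cross_crossx uw uu scale0r scale1r sub0r.
have h1 : dot (cross u w) (cross u w) = 1 by rewrite dot_cross2 uu ww uw mulr0 subr0 mulr1.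
have h2 : dot u (cross u w) = 0 by exact: dot_crossl.
have uwv : dot (cross u w) v = 0 by apply: Vp.
have h3 : dot v (cross u (cross u w)) = 0 by rewrite uuw dotNr vw oppr0.
have G x := app_triple u (cross u w) v x.
have O := dot_app_triple uu h1 vv h2 uv uwv h3.
have A := triple_mx_aut uu h1 vv h2 uv uwv h3.
have orth := triple_mx_orth uu h1 vv h2 uv uwv h3.
set g := triple_mx _ _ _ in G O A orth *.
have g0 : app g (delta_mx 0 'o_0) = u by rewrite G !mxE /= !scale0r !addr0 scale1r.
have g1 : app g (delta_mx 0 'o_1) = cross u w by rewrite G !mxE /= !scale0r !addr0 add0r scale1r.
have g2' : app g (delta_mx 0 'o_2) = v by rewrite G !mxE /= !scale0r !addr0 !add0r scale1r.
have g3 : app g (delta_mx 0 'o_3) = - w by rewrite G !mxE /= !scale0r !addr0 !add0r scale1r uuw.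
have g4 : app g (delta_mx 0 'o_4) = cross (cross u w) v by rewrite G !mxE /= !scale0r !addr0 !add0r scale1r.
have g5 : app g (delta_mx 0 'o_5) = cross v (- w) by rewrite G !mxE /= !scale0r !addr0 !add0r scale1r uuw.
have g6 : app g (delta_mx 0 'o_6) = cross u v by rewrite G !mxE /= !scale0r !add0r scale1r.
have V1 : inperp V (cross u w) by apply: Vp.
have V3 : inperp V (- w) by move=> z zV; rewrite dotNl wV ?oppr0.
have V4 : inperp V (cross (cross u w) v) by move=> z zV; rewrite crossC dotNl Vp ?oppr0.
have V5 : inperp V (cross v (- w)) by apply: Vp.
have V6 : (cross u v <= V)%MS by apply: Vcl.
have D (i : 'I_7) x : x 0 i = dot (app g x) (app g (delta_mx 0 i)) by rewrite O delta_v7.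
split => //; split => // x; split.
- by move=> xV; split; rewrite D ?g1 ?g3 ?g4 ?g5 dotC; [apply: V1|apply: V3|apply: V4|apply: V5].
- case=> x1 x3 x4 x5; rewrite G x1 x3 x4 x5 !scale0r !addr0.
  by rewrite !addmx_sub ?scalemx_sub.
- by move=> xV; split; rewrite D ?g0 ?g2' ?g6; apply: xV.
- case=> x0 x2 x6 z zV; rewrite G x0 x2 x6 !scale0r add0r !addr0 !dot_lin uuw.
  by rewrite V1 // V3 // V4 // V5 // !mulr0 !addr0.
Qed.

Lemma inMS_nonzero V : inMS V -> exists u w, [/\ (u <= V)%MS, dot u u = 1, inperp V w & dot w w = 1].
Proof.
case=> rV Vcl.
have [|u [u0 uV _]] := @ex_orthogonal _ 0 V (0 : 'M_(7, 0)); first by rewrite rV.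
have [|w [w0 _ wV]] := @ex_orthogonal _ _ (1%:M : 'M[R]_7) (row_base V)^T.
  by rewrite rV mxrank1.
have [k _ hk] := normalize u0; have [l _ hl] := normalize w0.
exists (k *: u), (l *: w); split=> //; first exact: scalemx_sub.
move=> z; rewrite -(eq_row_base V) => /submxP [D ->].
rewrite dotZl /dot trmx_mul mulmxA wV mul0mx mxE mulr0 //.
Qed.

Lemma inMS_orthogonal V u : inMS V -> exists v, [/\ (v <= V)%MS, dot v v = 1 & dot u v = 0].
Proof.
case=> rV _; have [|v [v0 vV uv]] := @ex_orthogonal _ 1 V u^T; first by rewrite rV.
have [k _ hk] := normalize v0; exists (k *: v); split=> //; first exact: scalemx_sub.
by rewrite dotC dotZl /dot uv mxE mulr0.
Qed.

Definition cj g d := g *m d *m g^T.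

Lemma orth_tr g : g *m g^T = 1%:M -> g^T *m g = 1%:M. Proof. exact: mulmx1C. Qed.

Lemma app_cj g d x : app (cj g d) x = app g (app d (app g^T x)).
Proof. by rewrite !app_mulmx. Qed.

Lemma app_trK g x : g *m g^T = 1%:M -> app g (app g^T x) = x.
Proof. by move=> h; rewrite -app_mulmx h app_1mx. Qed.
Lemma app_Ktr g x : g *m g^T = 1%:M -> app g^T (app g x) = x.
Proof. by move=> /orth_tr h; rewrite -app_mulmx h app_1mx. Qed.

Lemma cjK g d : g *m g^T = 1%:M -> cj g^T (cj g d) = d.
Proof.
by move=> h; apply: app_inj => x; rewrite !app_cj trmxK !app_Ktr.
Qed.
Lemma cjVK g d : g *m g^T = 1%:M -> cj g (cj g^T d) = d.
Proof. by move=> h; apply: app_inj => x; rewrite !app_cj trmxK !app_trK. Qed.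

Lemma cj_lin g k d d' : cj g (k *: d + d') = k *: cj g d + cj g d'.
Proof. by rewrite /cj mulmxDr mulmxDl -scalemxAr -scalemxAl. Qed.

Lemma cj_mul g d d' : g *m g^T = 1%:M -> cj g (d *m d') = cj g d *m cj g d'.
Proof. by move=> /orth_tr h; rewrite /cj !mulmxA; congr (_ *m _); rewrite -!mulmxA (mulmxA g^T) h mul1mx. Qed.

Lemma cj_lie g d d' : g *m g^T = 1%:M -> cj g (lie d d') = lie (cj g d) (cj g d').
Proof.
by move=> h; rewrite /lie -!cj_mul // [_ - _]addrC -scaleN1r cj_lin addrC scaleN1r.
Qed.

Lemma aut_cross g x y : is_aut g -> app g (cross x y) = cross (app g x) (app g y).
Proof. by case. Qed.

Lemma autV_cross g x y : is_aut g -> g *m g^T = 1%:M ->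
  app g^T (cross x y) = cross (app g^T x) (app g^T y).
Proof.
by move=> ha h; rewrite -{1}(app_trK x h) -{1}(app_trK y h) -aut_cross // app_Ktr.
Qed.

Lemma cj_der g d : is_aut g -> g *m g^T = 1%:M -> is_der d -> is_der (cj g d).
Proof.
move=> ha h hd x y; rewrite !app_cj autV_cross // hd appD !aut_cross //.
by rewrite !app_trK.
Qed.

Lemma is_aut_tr g : is_aut g -> g *m g^T = 1%:M -> is_aut g^T.
Proof.
move=> ha h; split; first by rewrite unitmx_tr; case: ha.
by move=> x y; rewrite autV_cross.
Qed.

Lemma frame_m4 V g d : frame V g -> m4 V (cj g d) <-> m4std d.
Proof.
case=> ha h hV hVp; split.
  case=> h1 [h2 h3]; split.
  - rewrite -(cjK d h); apply: cj_der => //; [exact: is_aut_tr | by rewrite trmxK orth_tr].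
  - by move=> x /hV /h2; rewrite app_cj app_Ktr // => /hVp.
  - by move=> x /hVp /h3; rewrite app_cj app_Ktr // => /hV.
case=> h1 h2 h3; split; first exact: cj_der.
split => x hx; rewrite app_cj.
- by apply/hVp/h2/hV; rewrite app_trK.
- by apply/hV/h3/hVp; rewrite app_trK.
Qed.
End Frame.

(** * Diagonalization of the elements of [m4 V] *)

Section Kak.
Variable R : realType.
Implicit Types (x y u v w : 'rV[R]_7) (d g : 'M[R]_7) (V : 'M[R]_7).

(** In the frame p = (u, v, u × v), each p_i goes to a multiple of p_i × w. The third eigenvalue
    -a-b is not recorded: it follows from the derivation property in [diag_in_next]. *)
Definition diag_in V d a b u v w :=
  [/\ [/\ (u <= V)%MS, (v <= V)%MS & inperp V w],
      [/\ dot u u = 1, dot v v = 1, dot w w = 1 & dot u v = 0],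
      app d u = a *: cross u w & app d v = b *: cross v w].

Lemma frame_ex V : inMS V -> exists g, frame V g.
Proof.
move=> hV; have [u [w [uV uu wV ww]]] := inMS_nonzero hV.
have [v [vV vv uv]] := inMS_orthogonal u hV.
by have [h _ _ _] := frame_triple hV uV vV wV uu vv ww uv; exists (triple_mx u (cross u w) v).
Qed.

Lemma m4_skew V d x y : m4 V d -> dot (app d x) y = - dot x (app d y).
Proof. by case=> h _; apply: der_dot_skew. Qed.

Lemma m4_eq0 V d u v : inMS V -> m4 V d -> (u <= V)%MS -> (v <= V)%MS ->
  dot u u = 1 -> dot v v = 1 -> dot u v = 0 -> app d u = 0 -> app d v = 0 -> d = 0.
Proof.
move=> hV hd uV vV uu vv uv du dv; have [_ [w [_ _ wV ww]]] := inMS_nonzero hV.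
have [hg g0 g2 _] := frame_triple hV uV vV wV uu vv ww uv.
set g := triple_mx _ _ _ in hg g0 g2; have [_ go _ _] := hg.
have h : cj g^T d = 0; last by rewrite -(cjVK d go) h /cj mulmx0 mul0mx.
apply: m4std_eq0; first by apply/(frame_m4 _ hg); rewrite cjVK.
  by rewrite app_cj trmxK g0 du app0.
by rewrite app_cj trmxK g2 dv app0.
Qed.

Lemma inMS_span V u v y : inMS V -> (u <= V)%MS -> (v <= V)%MS -> (y <= V)%MS ->
  dot u u = 1 -> dot v v = 1 -> dot u v = 0 ->
  exists a b c, y = a *: u + b *: v + c *: cross u v.
Proof.
move=> hV uV vV yV uu vv uv; have [_ [w [_ _ wV ww]]] := inMS_nonzero hV.
have [hg g0 g2 g3] := frame_triple hV uV vV wV uu vv ww uv.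
set g := triple_mx _ _ _ in hg g0 g2 g3; have [ga go gV _] := hg.
rewrite -(app_trK y go) in yV *; move/gV: yV; move: (app g^T y) => x [x1 x3 x4 x5].
exists (x 0 'o_0), (x 0 'o_2), (x 0 'o_6).
rewrite -g0 -g2 -aut_cross // -!appZ -!appD; congr app.
apply: row7P; rewrite !delta_v7E cross_v7 !v7E !mxE /= ?x1 ?x3 ?x4 ?x5; ring.
Qed.

(** The square of d maps the three-dimensional V to itself, and a real polynomial of odd degree has
    a root. *)
Lemma m4_eigenvector V d : inMS V -> m4 V d ->
  exists u k, [/\ (u <= V)%MS, dot u u = 1 & app d (app d u) = k *: u].
Proof.
move=> hV hd; have rV : \rank V = 3 by case: hV.
pose B := row_base V; pose f := d^T *m d^T; pose C := B *m f *m pinvmx B.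
have stab : (B *m f <= B)%MS.
  apply/row_subP => i; rewrite row_mul; have : (row i B <= V)%MS by rewrite -(eq_row_base V) row_sub.
  case: hd => _ [h1 h2] /h1 /h2; rewrite /app -mulmxA eq_row_base //.
have [|k] := @odd_poly_root _ (char_poly C); first by rewrite size_char_poly rV.
rewrite -eigenvalue_root_char => /eigenvalueP [x xC x0].
have u0 : x *m B != 0.
  by apply: contraNneq x0 => h; move/row_freeP: (row_base_free V) => [D hD]; rewrite -[x]mulmx1 -hD mulmxA h mul0mx.
have [l _ hl] := normalize u0.
exists (l *: (x *m B)), k; split => //.
  by apply: scalemx_sub; rewrite (submx_trans (submxMl _ _)) // eq_row_base.
rewrite !appZ scalerA mulrC -scalerA; congr (_ *: _).
have -> : app d (app d (x *m B)) = x *m (B *m f) by rewrite /app /f !mulmxA.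
by rewrite -(mulmxKpV stab) -/C mulmxA xC scalemxAl.
Qed.

(** An eigenvector u of the square of d has the property by skew-symmetry, unless d kills it. In
    that case take a unit v in V orthogonal to u: d(u × v) = u × d v is orthogonal to d v. *)
Lemma m4_principal_vector V d : inMS V -> m4 V d -> d != 0 ->
  exists u, [/\ (u <= V)%MS, dot u u = 1, app d u != 0 &
    forall y, (y <= V)%MS -> dot y u = 0 -> dot (app d y) (app d u) = 0].
Proof.
move=> hV hd d0; have [u [k [uV uu ddu]]] := m4_eigenvector hV hd.
have [du|du] := eqVneq (app d u) 0; last first.
  exists u; split => // y yV yu.
  by rewrite (m4_skew _ _ hd) ddu dotZr yu mulr0 oppr0.
have [v [vV vv uv]] := inMS_orthogonal u hV.
have dv : app d v != 0.
  by apply: contraNneq d0 => dv; rewrite (m4_eq0 hV hd uV vV).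
exists v; split => // y yV yv.
have [a [b [c e]]] := inMS_span hV uV vV yV uu vv uv.
have b0 : b = 0.
  by move: yv; rewrite e !dot_lin uv vv dotC dot_crossr !mulr0 mulr1 add0r addr0.
rewrite e b0 scale0r addr0 !app_lin du scaler0 add0r.
have -> : app d (cross u v) = cross u (app d v) by case: hd => h _; rewrite h du cross0l add0r.
by rewrite dotZl dotC dot_crossr mulr0.
Qed.

Lemma sym2_eigenvector (b t c : R) :
  exists p q m, [/\ p ^+ 2 + q ^+ 2 = 1, p * b + q * t = m * p & p * t + q * c = m * q].
Proof.
have [->|t0] := eqVneq t 0.
  by exists 1, 0, b; split; ring.
(* D is the discriminant of the characteristic polynomial of the symmetric matrix with entries b, t,
   c. The larger root is m, and (t, m - b) is an eigenvector, nonzero because t is. *)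
pose D := (b - c) ^+ 2 + 4 * t ^+ 2.
have D0 : 0 <= D by apply: addr_ge0; [exact: sqr_ge0 | apply: mulr_ge0; rewrite ?sqr_ge0 ?ler0n].
pose s := Num.sqrt D; have sD : s ^+ 2 = D by rewrite sqr_sqrtr.
pose m := (b + c + s) / 2; pose n := t ^+ 2 + (m - b) ^+ 2.
have n0 : 0 < n by rewrite ltr_wpDr ?sqr_ge0 // exprn_even_gt0.
pose k := Num.sqrt n; have kn : k ^+ 2 = n by rewrite sqr_sqrtr ?ltW.
have k0 : k != 0 by rewrite gt_eqF // sqrtr_gt0.
exists (t / k), ((m - b) / k), m; split.
- by rewrite !expr_div_n -mulrDl -/n kn divff // gt_eqF.
- by field.
- have e : m * m = (b + c) * m - b * c + t ^+ 2.
    apply/eqP; rewrite -subr_eq0; apply/eqP.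
    have -> : m * m - ((b + c) * m - b * c + t ^+ 2) = (s ^+ 2 - D) / 4 by rewrite /m /D; field.
    by rewrite sD subrr mul0r.
  apply/eqP; rewrite -subr_eq0; apply/eqP.
  have -> : t / k * t + (m - b) / k * c - m * ((m - b) / k)
    = ((b + c) * m - b * c + t ^+ 2 - m * m) / k by field.
  by rewrite e subrr mul0r.
Qed.
End Kak.

Section Kak2.
Variable R : realType.
Implicit Types (x y u v w : 'rV[R]_7) (d g : 'M[R]_7) (V : 'M[R]_7).

Lemma diag_in_frame V d a b u v w : inMS V -> m4 V d -> diag_in V d a b u v w ->
  exists g, [/\ frame V g, app g (delta_mx 0 'o_0) = u, app g (delta_mx 0 'o_2) = v,
    app g (delta_mx 0 'o_3) = - w & cj g^T d = Mx a b 0 0 0 0 0 0].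
Proof.
move=> hV hd [[uV vV wV] [uu vv ww uv] du dv].
have [hg g0 g2 g3] := frame_triple hV uV vV wV uu vv ww uv.
set g := triple_mx _ _ _ in hg g0 g2 g3; exists g; split => //.
have [ga go _ _] := hg.
have w3 : w = app g (- delta_mx 0 'o_3) by rewrite appN g3 opprK.
apply: m4std_ext; [by apply/(frame_m4 _ hg); rewrite cjVK | exact: Mx_m4std | |].
- rewrite app_cj trmxK g0 du w3 -g0 -aut_cross // appZ app_Ktr //.
  by rewrite !delta_v7E app_Mx !v7E; congr v7; ring.
- rewrite app_cj trmxK g2 dv w3 -g2 -aut_cross // appZ app_Ktr //.
  by rewrite !delta_v7E app_Mx !v7E; congr v7; ring.
Qed.

(** Exchanging two orthogonal arguments in a double product costs a sign, so the product of pairwise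
    orthogonal vectors is anti-associative. *)
Lemma cross_assoc_perp u v w : dot u w = 0 -> dot v w = 0 -> dot u v = 0 ->
  cross u (cross v w) = - cross (cross u v) w /\ cross (cross u w) v = - cross (cross u v) w.
Proof.
move=> uw vw uv; have h := cross_cross w u v.
rewrite (dotC w) vw uv (dotC w) uw mulr0 !scale0r !addr0 subr0 in h.
have k : cross u (cross v w) = - cross (cross u v) w.
  rewrite (crossC v w) crossNr (crossC (cross u v)) opprK.
  by apply/eqP; rewrite eq_sym -addr_eq0 h.
split=> //; rewrite (crossC (cross u w)) -k; apply/eqP.
rewrite eq_sym -addr_eq0 addrC cross_cross uw vw (dotC v) uv.
by rewrite mulr0 !scale0r oppr0 !addr0.
Qed.

Lemma diag_in_swap V d a b u v w : diag_in V d a b u v w -> diag_in V d b a v u w.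
Proof. by case=> [[? ? ?] [? ? ? ?] ? ?]; split => //; split => //; rewrite dotC. Qed.

Lemma diag_in_next V d a b u v w : inMS V -> m4 V d ->
  diag_in V d a b u v w -> diag_in V d a (- a - b) u (cross u v) w.
Proof.
move=> [_ Vcl] [hd _] [[uV vV wV] [uu vv ww uv] du dv].
have uw : dot u w = 0 by rewrite dotC wV.
have vw : dot v w = 0 by rewrite dotC wV.
have [e1 e2] := cross_assoc_perp uw vw uv.
split; [split|split|by []|] => //; first exact: Vcl.
- by rewrite dot_cross2 uu vv uv mulr0 subr0 mulr1.
- exact: dot_crossl.
- by rewrite hd du dv crossZl crossZr e1 e2 !scalerN -!scaleNr -scalerDl.
Qed.

(** The block of d on v and u × v is symmetric; turning v to a unit eigenvector inside that plane
    diagonalizes it. *)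
Lemma rotate_diag_in V d a b t c u v w : inMS V -> m4 V d ->
  [/\ (u <= V)%MS, (v <= V)%MS & inperp V w] ->
  [/\ dot u u = 1, dot v v = 1, dot w w = 1 & dot u v = 0] ->
  app d u = a *: cross u w ->
  app d v = b *: cross v w + t *: cross (cross u v) w ->
  app d (cross u v) = t *: cross v w + c *: cross (cross u v) w ->
  exists m v', diag_in V d a m u v' w.
Proof.
move=> [_ Vcl] hd [uV vV wV] [uu vv ww uv] du dv dq.
have [p [q [m [pq e1 e2]]]] := sym2_eigenvector b t c.
exists m, (p *: v + q *: cross u v); split => //.
- by split=> //; apply: addmx_sub; apply: scalemx_sub => //; apply: Vcl.
- have h1 := dot_crossr u v; have h2 : dot (cross u v) v = 0 by rewrite dotC.
  have h3 : dot (cross u v) (cross u v) = 1 by rewrite dot_cross2 uu vv uv mulr0 subr0 mulr1.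
  by split=> //; rewrite !dot_lin ?(h1, h2, h3, vv, uv, dot_crossl) -?[RHS]pq; ring.
- rewrite !app_lin dv dq !cross_lin !scalerDr !scalerA -e1 -e2 addrACA -!scalerDl.
  by rewrite mulrC [q * t]mulrC (mulrC p t) (mulrC q c).
Qed.

(** With w chosen so that d u is proportional to u × w, the first row of the matrix of d has only
    its diagonal entry, and the orthogonality from [m4_principal_vector] clears the first column. A
    symmetric block remains, handled by a rotation. *)
Lemma diagonalize V d : inMS V -> m4 V d -> d != 0 ->
  exists a b u v w, diag_in V d a b u v w.
Proof.
move=> hV hd d0; have [u [uV uu du E]] := m4_principal_vector hV hd d0.
have [k k0 dk] := normalize du.
have hu : inperp V (app d u) by case: hd => _ [h _]; apply: h.
have udu : dot u (app d u) = 0 by rewrite dotC hu.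
(* Solves u × w = k d u: on vectors orthogonal to the unit vector u, crossing twice with u is -1. *)
pose w := - (k *: cross u (app d u)).
have uw : cross u w = k *: app d u.
  by rewrite /w crossNr crossZr cross_crossx udu uu scale0r scale1r sub0r scalerN opprK.
have ww : dot w w = 1.
  rewrite /w dotNl dotNr opprK !dot_lin dot_cross2 uu udu mulr0 subr0 mul1r; move: dk.
  by rewrite !dot_lin.
have wV : inperp V w.
  move=> z zV; rewrite /w !dot_lin crossC dotNl dot_cross.
  by rewrite hu ?oppr0 ?mulr0 ?oppr0 //; case: hV => _; apply.
have [v [vV vv uv]] := inMS_orthogonal u hV.
have := frame_triple hV uV vV wV uu vv ww uv.
move: (triple_mx _ _ _) => g [hg g0 g2 g3]; have [ga go _ _] := hg.
have hd' : m4std (cj g^T d) by apply/(frame_m4 _ hg); rewrite cjVK.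
have w3 : w = app g (- delta_mx 0 'o_3) by rewrite appN g3 opprK.
have [a [b [t1 [t2 [t3 [r1 [r2 [r3 hM]]]]]]]] := m4std_Mx hd'.
have dE x : app d (app g x) = app g (app (Mx a b t1 t2 t3 r1 r2 r3) x).
  by rewrite -hM app_cj trmxK app_trK.
have ki : app d u = k^-1 *: cross u w by rewrite uw scalerA mulVf ?scale1r ?gt_eqF.
have : app (Mx a b t1 t2 t3 r1 r2 r3) (delta_mx 0 'o_0) = k^-1 *: delta_mx 0 'o_1.
  rewrite -[LHS](app_Ktr _ go) -dE g0 ki w3 -{1}g0 -aut_cross // appZ app_Ktr //.
  by rewrite !delta_v7E !v7E; congr v7; ring.
rewrite !delta_v7E app_Mx !v7E => h.
have h1 := congr1 (fun x : 'rV[R]_7 => x 0 'o_1) h; have h3 := congr1 (fun x : 'rV[R]_7 => x 0 'o_3) h.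
have h4 := congr1 (fun x : 'rV[R]_7 => x 0 'o_4) h; have h5 := congr1 (fun x : 'rV[R]_7 => x 0 'o_5) h.
rewrite !mxE /= in h1 h3 h4 h5; clear h.
have gD x y : dot (app g x) (app g y) = dot x y.
  by rewrite -[g in app g x]trmxK dot_app_tr app_Ktr.
have d2 : dot (app d v) (app d u) = 0 by apply: E; rewrite // dotC.
have d6 : dot (app d (cross u v)) (app d u) = 0.
  by apply: E; [case: hV => _; apply | rewrite dotC dot_crossl].
move: d2 d6; rewrite -g0 -g2 -aut_cross // !dE !gD !delta_v7E !cross_v7 !app_Mx !v7E => d2 d6.
rewrite !(mulr0, mul0r, mulr1, addr0, add0r) in h1 h3 h4 h5 d2 d6.
have R1 : r1 = 0 by clear - h3; lra.
rewrite h4 h5 R1 in d2 d6.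
have a0 : a != 0 by rewrite h1 invr_eq0 gt_eqF.
have a2 : t3 - r3 = 0 by apply: (mulIf a0); rewrite mul0r -[RHS]d2; ring.
have a6 : t2 + r2 = 0 by apply: (mulIf a0); rewrite mul0r -[RHS]d6; ring.
have [T2 T3] : t2 = 0 /\ t3 = 0 by clear - h4 h5 a2 a6; split; lra.
have [R2 R3] : r2 = 0 /\ r3 = 0 by clear - a2 a6 T2 T3; split; lra.
rewrite T2 T3 R1 R2 R3 in dE.
have [m [v' h]] : exists m v', diag_in V d a m u v' w.
  apply: (@rotate_diag_in _ _ _ b t1 (- a - b) _ v) => //.
  - by rewrite ki; congr (_ *: _); clear - h1; lra.
  - rewrite -g0 -g2 w3 -!aut_cross // dE -!appZ -appD; congr app.
    by rewrite !delta_v7E app_Mx !v7E; congr v7; ring.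
  - rewrite -g0 -g2 w3 -!aut_cross // dE -!appZ -appD; congr app.
    by rewrite !delta_v7E cross_v7 app_Mx !v7E; congr v7; ring.
by exists a, m, u, v', w.
Qed.
End Kak2.

(** * Subspaces as predicates and their splitting into eigencomponents *)

(** Predicates rather than matrices, so that conjugation by a frame is a substitution; [subspace_mx]
    leads back to matrices. *)
Definition subsp (R : pzRingType) (U : lmodType R) (P : U -> Prop) :=
  P 0 /\ forall k A B, P A -> P B -> P (k *: A + B).

Section Subsp.
Variables (R : fieldType) (U : lmodType R) (P : U -> Prop).
Hypothesis hP : subsp P.

Lemma subspZ k A : P A -> P (k *: A).
Proof. by case: hP => h0 h hA; rewrite -[_ *: _]addr0; apply: h. Qed.
Lemma subspD A B : P A -> P B -> P (A + B).
Proof. by case: hP => h0 h hA hB; rewrite -[A]scale1r; apply: h. Qed.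
Lemma subspN A : P A -> P (- A).
Proof. by rewrite -scaleN1r; apply: subspZ. Qed.
Lemma subspB A B : P A -> P B -> P (A - B).
Proof. by move=> hA hB; apply: subspD => //; apply: subspN. Qed.
Lemma subspZr k A : k != 0 -> P (k *: A) -> P A.
Proof. by move=> k0 /(subspZ k^-1); rewrite scalerA mulVf // scale1r. Qed.

(** Applying T - l removes the component with eigenvalue l and multiplies the others by nonzero
    factors, so induction puts those into P. The removed one is the difference between the whole sum
    and the rest. *)
Lemma eigen_components (T : U -> U) (s : seq (R * U)) :
  (forall k A B, T (k *: A + B) = k *: T A + T B) -> (forall A, P A -> P (T A)) ->
  uniq (map fst s) -> (forall p, p \in s -> T p.2 = p.1 *: p.2) ->
  P (\sum_(p <- s) p.2) -> forall p, p \in s -> P p.2.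
Proof.
move=> Tl TP; move En: (size s) => n.
have T0 : T 0 = 0.
  by have := Tl (- 1) 0 0; rewrite scaler0 addr0 scaleN1r addNr.
have Tsum (r : seq (R * U)) : T (\sum_(p <- r) p.2) = \sum_(p <- r) T p.2.
  elim: r => [|p r ih]; rewrite ?big_nil // !big_cons -ih.
  by rewrite -[p.2]scale1r Tl !scale1r.
elim: n s En => [|n ih] [|[l y] s] //= [En] /andP [ls us] hs.
rewrite big_cons /= => hsum.
have key : forall p, p \in s -> P p.2.
  pose s' := [seq (p.1, (p.1 - l) *: p.2) | p : R * U <- s].
  have hs' : forall p, p \in s' -> P p.2.
    apply: ih; first by rewrite size_map.
    - by rewrite -map_comp.
    - move=> _ /mapP [p ps ->] /=.
      have := Tl (p.1 - l) p.2 0; rewrite !addr0 T0 addr0 => ->.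
      by rewrite hs ?inE ?ps ?orbT // !scalerA mulrC.
    - rewrite big_map /=; have -> : \sum_(p <- s) (p.1 - l) *: p.2
        = T (y + \sum_(p <- s) p.2) - l *: (y + \sum_(p <- s) p.2).
        rewrite -{1}[y]scale1r Tl scale1r (hs (l, y)) ?mem_head // scalerDr.
        rewrite opprD addrACA subrr add0r Tsum scaler_sumr -sumrB big_seq [RHS]big_seq.
        by apply: eq_bigr => p ps; rewrite hs ?inE ?ps ?orbT // scalerBl.
      by apply: subspB; [apply: TP | apply: subspZ].
  move=> p ps; apply: (@subspZr (p.1 - l)).
    rewrite subr_eq0; apply: contraNneq ls => <-; exact: map_f.
  exact: (hs' (p.1, _) (map_f _ ps)).
move=> p; rewrite inE => /orP [/eqP -> /= | /key //].
rewrite -[y](addrK (\sum_(p <- s) p.2)); apply: subspB => //.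
rewrite big_seq; elim/big_ind: _ => //; [by case: hP | exact: subspD].
Qed.
End Subsp.

(** The condition defining [h4 W] for W = <v, w, v × w>, expressed by scalar products so that the
    classification handles no matrix for W. *)
Definition preserves_perp (R : comPzRingType) (v w : 'rV[R]_7) (d : 'M[R]_7) : Prop :=
  forall z, dot z v = 0 -> dot z w = 0 -> dot z (cross v w) = 0 ->
  [/\ dot (app d z) v = 0, dot (app d z) w = 0 & dot (app d z) (cross v w) = 0].

Definition lts (R : comPzRingType) (P : 'M[R]_7 -> Prop) : Prop :=
  forall A B C, P A -> P B -> P C -> P (lie (lie A B) C).

(** With z = [x,y] these are the so(3) relations [x,y] = z, [y,z] = x, [z,x] = y. Then y + i z is an
    eigenvector of ad x with eigenvalue -i, the natural candidate for a nilpotent element. *)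
Definition principal_pair (R : realType) (x y : 'M[R]_7) : Prop :=
  [/\ lie (lie x y) x = y, lie (lie x y) y = - x
    & principal_nilpotent (complexify y (lie x y))].

(* The four containments, over abstract counterparts of [V], its orthogonal and [m4 V]. *)
Definition in_maximal (R : realType) (inV inVp : 'rV[R]_7 -> Prop) (mm P : 'M[R]_7 -> Prop) : Prop :=
  [\/ exists x y, [/\ mm x, mm y, principal_pair x y &
                   forall A, P A -> exists a b, A = a *: x + b *: y],
      exists l, [/\ l != 0, inVp l & forall A, P A -> app A l = 0],
      exists u, [/\ u != 0, inV u & forall A, P A -> app A u = 0]
    | exists v w, [/\ inV v, inVp w, dot v v = 1, dot w w = 1 &
                   forall A, P A -> preserves_perp v w A] ].

Local Notation D a b := (Mx a b 0 0 0 0 0 0).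
Local Notation T1 t := (Mx 0 0 t 0 0 0 0 0).
Local Notation T2 t := (Mx 0 0 0 t 0 0 0 0).
Local Notation T3 t := (Mx 0 0 0 0 t 0 0 0).
Local Notation R1 t := (Mx 0 0 0 0 0 t 0 0).
Local Notation R2 t := (Mx 0 0 0 0 0 0 t 0).
Local Notation R3 t := (Mx 0 0 0 0 0 0 0 t).

Section MxLinear.
Variable R : realType.

Lemma Mx0 : Mx 0 0 0 0 0 0 0 0 = 0 :> 'M[R]_7.
Proof. by apply: app_inj => x; coords x; rewrite app_Mx app_0mx; apply: row7P; rewrite !mxE /=; ring. Qed.

Lemma Mx_scale (k a b t1 t2 t3 r1 r2 r3 : R) : k *: Mx a b t1 t2 t3 r1 r2 r3
  = Mx (k * a) (k * b) (k * t1) (k * t2) (k * t3) (k * r1) (k * r2) (k * r3).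
Proof. by rewrite -[LHS]addr0 -Mx0 Mx_lin !addr0. Qed.

Lemma Mx_add (a b t1 t2 t3 r1 r2 r3 a' b' t1' t2' t3' r1' r2' r3' : R) :
  Mx a b t1 t2 t3 r1 r2 r3 + Mx a' b' t1' t2' t3' r1' r2' r3'
  = Mx (a + a') (b + b') (t1 + t1') (t2 + t2') (t3 + t3') (r1 + r1') (r2 + r2') (r3 + r3').
Proof. by rewrite -[Mx a b _ _ _ _ _ _]scale1r Mx_lin !mul1r. Qed.

Lemma lie_diag2 a b y0 y1 y2 y3 y4 y5 y6 y7 :
  lie (lie (D a b) (Mx y0 y1 y2 y3 y4 y5 y6 y7)) (D a b)
  = Mx 0 0 ((a + 2 * b) ^+ 2 * y2) ((2 * a + b) ^+ 2 * y3) ((a - b) ^+ 2 * y4)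
       (a ^+ 2 * y5) (b ^+ 2 * y6) ((a + b) ^+ 2 * y7) :> 'M[R]_7.
Proof. by rewrite lie_diag_Mx; congr Mx; ring. Qed.

(** W = <e0, e3, e1> meets V in the line of e0. The parameters t and r belong to the orthogonal
    roots a+2b and a; [preserves_perp2] and [preserves_perp3] treat the two other orthogonal
    pairs. *)
Lemma preserves_perp1 (a b t r : R) : preserves_perp (delta_mx 0 'o_0) (delta_mx 0 'o_3) (Mx a b t 0 0 r 0 0).
Proof.
move=> z; rewrite (v7_eta z) !delta_v7E app_Mx !v7E.
move: (z 0 'o_0) (z 0 'o_1) (z 0 'o_2) (z 0 'o_3) (z 0 'o_4) (z 0 'o_5) (z 0 'o_6) => x0 x1 x2 x3 x4 x5 x6 h1 h2 h3.
have z1 : x0 = 0 by rewrite -h1; ring.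
have z2 : x3 = 0 by rewrite -h2; ring.
have z3 : x1 = 0 by apply: oppr_inj; rewrite oppr0 -h3; ring.
by rewrite z1 z2 z3; split; ring.
Qed.

Lemma preserves_perp2 (a b t r : R) : preserves_perp (delta_mx 0 'o_2) (delta_mx 0 'o_3) (Mx a b 0 t 0 0 r 0).
Proof.
move=> z; rewrite (v7_eta z) !delta_v7E app_Mx !v7E.
move: (z 0 'o_0) (z 0 'o_1) (z 0 'o_2) (z 0 'o_3) (z 0 'o_4) (z 0 'o_5) (z 0 'o_6) => x0 x1 x2 x3 x4 x5 x6 h1 h2 h3.
have z1 : x2 = 0 by rewrite -h1; ring.
have z2 : x3 = 0 by rewrite -h2; ring.
have z3 : x5 = 0 by rewrite -h3; ring.
by rewrite z1 z2 z3; split; ring.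
Qed.

Lemma preserves_perp3 (a b t r : R) : preserves_perp (delta_mx 0 'o_6) (delta_mx 0 'o_3) (Mx a b 0 0 t 0 0 r).
Proof.
move=> z; rewrite (v7_eta z) !delta_v7E app_Mx !v7E.
move: (z 0 'o_0) (z 0 'o_1) (z 0 'o_2) (z 0 'o_3) (z 0 'o_4) (z 0 'o_5) (z 0 'o_6) => x0 x1 x2 x3 x4 x5 x6 h1 h2 h3.
have z1 : x6 = 0 by rewrite -h1; ring.
have z2 : x3 = 0 by rewrite -h2; ring.
have z3 : x4 = 0 by rewrite -h3; ring.
by rewrite z1 z2 z3; split; ring.
Qed.

End MxLinear.

Ltac neq_num := repeat (apply/andP; split); try by []; apply/eqP => ?; lra.
Ltac eigen_tac := move=> p; rewrite !inE; repeat case/orP; move/eqP => -> /=; rewrite lie_diag2 Mx_scale; congr Mx; ring.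
Ltac sum_tac := rewrite !big_cons big_nil /= addr0 !Mx_add; congr Mx; ring.

(** * Lie triple subsystems of the model *)

Section Core.
Variables (R : realType) (P : 'M[R]_7 -> Prop).
Hypotheses (hP : subsp P) (hL : lts P) (hM : forall A, P A -> m4std A).

Lemma P_eq A B : P A -> A = B -> P B. Proof. by move=> h <-. Qed.

(** B -> [[x,B],x] preserves P by closure under triple products. Its eigenspaces are sums of root
    spaces with equal squared root. The conclusion is a nested conjunction, to be destructed for a
    concrete list. *)
Lemma diag_components a b (s : seq (R * 'M[R]_7)) A : P (D a b) -> P A ->
  uniq (map fst s) -> (forall p, p \in s -> lie (lie (D a b) p.2) (D a b) = p.1 *: p.2) ->
  A = \sum_(p <- s) p.2 -> foldr (fun p Q => P p.2 /\ Q) True s.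
Proof.
move=> hD hA us hs eA.
have : forall p, p \in s -> P p.2.
  apply: (@eigen_components _ _ _ hP (fun A => lie (lie (D a b) A) (D a b))) => //.
  - by move=> k B C; rewrite lieDr lieZr lieDl lieZl.
  - by move=> B hB; apply: hL.
  - by rewrite -eA.
elim: s {us hs eA} => //= p s ih hs; split; first by apply: hs; rewrite mem_head.
by apply: ih => q qs; apply: hs; rewrite inE qs orbT.
Qed.

Section Full.
Hypothesis hD : forall a b, P (D a b).

Lemma full_components y0 y1 y2 y3 y4 y5 y6 y7 : P (Mx y0 y1 y2 y3 y4 y5 y6 y7) ->
  [/\ P (T1 y2), P (T2 y3) & P (T3 y4)] /\ [/\ P (R1 y5), P (R2 y6) & P (R3 y7)].
Proof.
move=> hA.
(* diag(1, 3, -4) is generic: its squared roots 49, 25, 4, 1, 9, 16 are distinct and nonzero. *)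
have [|||] := @diag_components 1 3 [:: (0, D y0 y1); (49, T1 y2); (25, T2 y3); (4, T3 y4); (1, R1 y5); (9, R2 y6); (16, R3 y7)] _ (hD 1 3) hA.
- by rewrite /= !inE !negb_or; neq_num.
- by eigen_tac.
- by sum_tac.
by move=> _ /= [? [? [? [? [? [? _]]]]]].
Qed.

Lemma full_T1 t k : t != 0 -> P (T1 t) -> P (T1 k).
Proof. by move=> t0 h; apply: P_eq (subspZ hP (k / t) h) _; rewrite Mx_scale; congr Mx; field. Qed.
Lemma full_T2 t k : t != 0 -> P (T2 t) -> P (T2 k).
Proof. by move=> t0 h; apply: P_eq (subspZ hP (k / t) h) _; rewrite Mx_scale; congr Mx; field. Qed.
Lemma full_T3 t k : t != 0 -> P (T3 t) -> P (T3 k).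
Proof. by move=> t0 h; apply: P_eq (subspZ hP (k / t) h) _; rewrite Mx_scale; congr Mx; field. Qed.
Lemma full_R1 t k : t != 0 -> P (R1 t) -> P (R1 k).
Proof. by move=> t0 h; apply: P_eq (subspZ hP (k / t) h) _; rewrite Mx_scale; congr Mx; field. Qed.
Lemma full_R2 t k : t != 0 -> P (R2 t) -> P (R2 k).
Proof. by move=> t0 h; apply: P_eq (subspZ hP (k / t) h) _; rewrite Mx_scale; congr Mx; field. Qed.
Lemma full_R3 t k : t != 0 -> P (R3 t) -> P (R3 k).
Proof. by move=> t0 h; apply: P_eq (subspZ hP (k / t) h) _; rewrite Mx_scale; congr Mx; field. Qed.

(** For y and z in two different short root spaces, [[x,y],z] has components in a long root space
    and in the third short one. The three pairs reach all three long roots; by the third short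
    component, two short root spaces already suffice in [full_two_short]. *)
Lemma full_short : P (R1 1) -> P (R2 1) -> P (R3 1) -> forall A, m4std A -> P A.
Proof.
move=> h1 h2 h3 A /m4std_Mx [a [b [t1 [t2 [t3 [r1 [r2 [r3 ->]]]]]]]].
have [[_ _ p3] _] := full_components (P_eq (hL (hD 1 1) h1 h2) (lie_diag_Mx _ _ _ _ _ _ _ _ _ _ _ _ _ _ _ _ _ _)).
have [[_ p2 _] _] := full_components (P_eq (hL (hD 1 1) h1 h3) (lie_diag_Mx _ _ _ _ _ _ _ _ _ _ _ _ _ _ _ _ _ _)).
have [[p1 _ _] _] := full_components (P_eq (hL (hD 1 1) h2 h3) (lie_diag_Mx _ _ _ _ _ _ _ _ _ _ _ _ _ _ _ _ _ _)).
have {}p1 := full_T1 t1 _ p1; have {}p2 := full_T2 t2 _ p2; have {}p3 := full_T3 t3 _ p3.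
have {}h1 := full_R1 r1 _ h1; have {}h2 := full_R2 r2 _ h2; have {}h3 := full_R3 r3 _ h3.
have -> : Mx a b t1 t2 t3 r1 r2 r3 = D a b + T1 t1 + T2 t2 + T3 t3 + R1 r1 + R2 r2 + R3 r3 by rewrite !Mx_add; congr Mx; ring.
have N x : x = - 3 -> x != 0 :> R by move=> ->; rewrite oppr_eq0 pnatr_eq0.
do !apply: (subspD hP) => //; [apply: p1|apply: p2|apply: p3|apply: h1|apply: h2|apply: h3]; rewrite ?oner_eq0 //; apply/eqP; lra.
Qed.

Definition lie_diag_full a b y0 y1 y2 y3 y4 y5 y6 y7 z0 z1 z2 z3 z4 z5 z6 z7
    (hy : P (Mx y0 y1 y2 y3 y4 y5 y6 y7)) (hz : P (Mx z0 z1 z2 z3 z4 z5 z6 z7)) :=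
  full_components (P_eq (hL (hD a b) hy hz) (lie_diag_Mx _ _ _ _ _ _ _ _ _ _ _ _ _ _ _ _ _ _)).

Ltac nz := apply/eqP; lra.

Lemma full_two_short : (P (R1 1) /\ P (R2 1)) \/ (P (R1 1) /\ P (R3 1)) \/ (P (R2 1) /\ P (R3 1)) ->
  forall A, m4std A -> P A.
Proof.
case=> [[h1 h2]|[[h1 h3]|[h2 h3]]]; apply: full_short => //.
- by have [_ [_ _]] := lie_diag_full 1 1 h1 h2; apply: full_R3; nz.
- by have [_ [_ + _]] := lie_diag_full 1 1 h1 h3; apply: full_R2; nz.
- by have [_ [+ _ _]] := lie_diag_full 1 1 h2 h3; apply: full_R1; nz.
Qed.

Lemma delta_dot (i : 'I_7) : dot (delta_mx 0 i) (delta_mx 0 i) = 1 :> R.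
Proof. by rewrite delta_v7 mxE !eqxx. Qed.

(** Two short root spaces would generate everything. With exactly one, a long root vector not
    orthogonal to it would produce another short one, so P involves one orthogonal pair of roots and
    stabilizes W. With none, only diagonal elements and long root vectors remain, and they kill
    e3. *)
Lemma full_in_maximal : (exists A, m4std A /\ ~ P A) -> in_maximal (@inV0 R) (@inVp0 R) (@m4std R) P.
Proof.
case=> A0 [hA0 nA0].
have no2 : ~ ((P (R1 1) /\ P (R2 1)) \/ (P (R1 1) /\ P (R3 1)) \/ (P (R2 1) /\ P (R3 1))).
  by move=> /full_two_short /(_ A0 hA0).
have w_in : inVp0 (delta_mx 0 'o_3 : 'rV[R]_7) by split; rewrite mxE.
have [h1|n1] := Classical_Prop.classic (P (R1 1)).
  have n2 : ~ P (R2 1) by move=> h; apply: no2; left.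
  have n3 : ~ P (R3 1) by move=> h; apply: no2; right; left.
  constructor 4; exists (delta_mx 0 'o_0), (delta_mx 0 'o_3); rewrite !delta_dot.
  split=> //; first by split; rewrite mxE.
  move=> A hA; have [a [b [t1 [t2 [t3 [r1 [r2 [r3 eA]]]]]]]] := m4std_Mx (hM hA).
  rewrite eA in hA *; have [[_ q2 q3] [_ s2 s3]] := full_components hA.
  have -> : r2 = 0 by apply/eqP/negPn/negP => z; apply: n2; apply: full_R2 s2.
  have -> : r3 = 0 by apply/eqP/negPn/negP => z; apply: n3; apply: full_R3 s3.
  have -> : t2 = 0.
    apply/eqP/negPn/negP => z; have q := full_T2 1 z q2; apply: n3.
    by have [_ [_ _]] := lie_diag_full 1 1 h1 q; apply: full_R3; nz.
  have -> : t3 = 0.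
    apply/eqP/negPn/negP => z; have q := full_T3 1 z q3; apply: n2.
    by have [_ [_ + _]] := lie_diag_full 1 1 h1 q; apply: full_R2; nz.
  exact: preserves_perp1.
have [h2|n2] := Classical_Prop.classic (P (R2 1)).
  have n3 : ~ P (R3 1) by move=> h; apply: no2; right; right.
  constructor 4; exists (delta_mx 0 'o_2), (delta_mx 0 'o_3); rewrite !delta_dot.
  split=> //; first by split; rewrite mxE.
  move=> A hA; have [a [b [t1 [t2 [t3 [r1 [r2 [r3 eA]]]]]]]] := m4std_Mx (hM hA).
  rewrite eA in hA *; have [[q1 _ q3] [s1 _ s3]] := full_components hA.
  have -> : r1 = 0 by apply/eqP/negPn/negP => z; apply: n1; apply: full_R1 s1.
  have -> : r3 = 0 by apply/eqP/negPn/negP => z; apply: n3; apply: full_R3 s3.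
  have -> : t1 = 0.
    apply/eqP/negPn/negP => z; have q := full_T1 1 z q1; apply: n3.
    by have [_ [_ _]] := lie_diag_full 1 1 h2 q; apply: full_R3; nz.
  have -> : t3 = 0.
    apply/eqP/negPn/negP => z; have q := full_T3 1 z q3; apply: n1.
    by have [_ [+ _ _]] := lie_diag_full 1 1 h2 q; apply: full_R1; nz.
  exact: preserves_perp2.
have [h3|n3] := Classical_Prop.classic (P (R3 1)).
  constructor 4; exists (delta_mx 0 'o_6), (delta_mx 0 'o_3); rewrite !delta_dot.
  split=> //; first by split; rewrite mxE.
  move=> A hA; have [a [b [t1 [t2 [t3 [r1 [r2 [r3 eA]]]]]]]] := m4std_Mx (hM hA).
  rewrite eA in hA *; have [[q1 q2 _] [s1 s2 _]] := full_components hA.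
  have -> : r1 = 0 by apply/eqP/negPn/negP => z; apply: n1; apply: full_R1 s1.
  have -> : r2 = 0 by apply/eqP/negPn/negP => z; apply: n2; apply: full_R2 s2.
  have -> : t1 = 0.
    apply/eqP/negPn/negP => z; have q := full_T1 1 z q1; apply: n2.
    by have [_ [_ + _]] := lie_diag_full 1 1 h3 q; apply: full_R2; nz.
  have -> : t2 = 0.
    apply/eqP/negPn/negP => z; have q := full_T2 1 z q2; apply: n1.
    by have [_ [+ _ _]] := lie_diag_full 1 1 h3 q; apply: full_R1; nz.
  exact: preserves_perp3.
constructor 2; exists (delta_mx 0 'o_3); split=> //.
  by apply/eqP => /(congr1 (fun z : 'rV[R]_7 => z 0 'o_3)); rewrite !mxE /= => /eqP; rewrite oner_eq0.
move=> A hA; have [a [b [t1 [t2 [t3 [r1 [r2 [r3 eA]]]]]]]] := m4std_Mx (hM hA).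
rewrite eA in hA *; have [_ [s1 s2 s3]] := full_components hA.
have -> : r1 = 0 by apply/eqP/negPn/negP => z; apply: n1; apply: full_R1 s1.
have -> : r2 = 0 by apply/eqP/negPn/negP => z; apply: n2; apply: full_R2 s2.
have -> : r3 = 0 by apply/eqP/negPn/negP => z; apply: n3; apply: full_R3 s3.
by rewrite delta_v7E app_Mx; apply: row7P; rewrite !mxE /=; ring.
Qed.
End Full.
End Core.

Section Core2.
Variables (R : realType) (P : 'M[R]_7 -> Prop).
Hypotheses (hP : subsp P) (hL : lts P) (hM : forall A, P A -> m4std A).

Lemma plane_full a b a' b' : P (D a b) -> P (D a' b') -> a * b' != a' * b ->
  forall x y, P (D x y).
Proof.
move=> h h'; rewrite -subr_eq0 => d0 x y.
pose k := (x * b' - y * a') / (a * b' - a' * b); pose k' := (a * y - b * x) / (a * b' - a' * b).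
apply: P_eq (subspD hP (subspZ hP k h) (subspZ hP k' h')) _.
by rewrite !Mx_scale Mx_add /k /k'; congr Mx; field.
Qed.

(** The diagonal elements of P are proportional to diag(a, b, -a-b). Otherwise P contains all
    diagonal elements and [full_in_maximal] applies. *)
Definition noplane a b := forall a' b', P (D a' b') -> a * b' = a' * b.

Lemma noplane_or_full a b : P (D a b) -> noplane a b \/ forall x y, P (D x y).
Proof.
move=> h; have [[a' [b' [h' ne]]]|n] := Classical_Prop.classic (exists a' b', P (D a' b') /\ a * b' != a' * b).
  by right; apply: plane_full ne.
by left=> a' b' h'; apply/eqP/negPn/negP => ne; apply: n; exists a', b'.
Qed.

(** For y in a root space, [[x,y],y] is diagonal and has the direction of the coroot. Being
    proportional to x, it vanishes unless x is parallel to that coroot. For the root a+2b this means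
    a = 0, and for the root a it means a+2b = 0; hence the same product in [single_R1], and
    similarly for the other pairs. *)
Lemma single_T1 a b t : noplane a b -> P (D a b) -> P (T1 t) -> (a * (a + 2 * b)) * t ^+ 2 = 0.
Proof.
move=> np hD h; have := P_eq (hL hD h h) (lie_diag_Mx _ _ _ _ _ _ _ _ _ _ _ _ _ _ _ _ _ _).
rewrite !(mul0r, mulr0, add0r, addr0) => /np; nra.
Qed.

Lemma single_R1 a b t : noplane a b -> P (D a b) -> P (R1 t) -> (a * (a + 2 * b)) * t ^+ 2 = 0.
Proof.
move=> np hD h; have := P_eq (hL hD h h) (lie_diag_Mx _ _ _ _ _ _ _ _ _ _ _ _ _ _ _ _ _ _).
rewrite !(mul0r, mulr0, add0r, addr0) => /np; nra.
Qed.

Lemma single_T2 a b t : noplane a b -> P (D a b) -> P (T2 t) -> (b * (2 * a + b)) * t ^+ 2 = 0.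
Proof.
move=> np hD h; have := P_eq (hL hD h h) (lie_diag_Mx _ _ _ _ _ _ _ _ _ _ _ _ _ _ _ _ _ _).
rewrite !(mul0r, mulr0, add0r, addr0) => /np; nra.
Qed.

Lemma single_R2 a b t : noplane a b -> P (D a b) -> P (R2 t) -> (b * (2 * a + b)) * t ^+ 2 = 0.
Proof.
move=> np hD h; have := P_eq (hL hD h h) (lie_diag_Mx _ _ _ _ _ _ _ _ _ _ _ _ _ _ _ _ _ _).
rewrite !(mul0r, mulr0, add0r, addr0) => /np; nra.
Qed.

Lemma single_R3 a b t : noplane a b -> P (D a b) -> P (R3 t) -> ((a - b) * (a + b)) * t ^+ 2 = 0.
Proof.
move=> np hD h; have := P_eq (hL hD h h) (lie_diag_Mx _ _ _ _ _ _ _ _ _ _ _ _ _ _ _ _ _ _).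
rewrite !(mul0r, mulr0, add0r, addr0) => /np; nra.
Qed.

(** The first six conditions say that no root vanishes at (a, b). Two squared roots coincide only if
    one of these six forms or one of the six others is zero. *)
Definition generic (a b : R) := [/\ [/\ a <> 0, b <> 0 & a + b <> 0],
  [/\ a - b <> 0, a + 2 * b <> 0 & 2 * a + b <> 0],
  [/\ b - 2 * a <> 0, a - 2 * b <> 0 & 3 * a + b <> 0] &
  [/\ 3 * a + 2 * b <> 0, 2 * a + 3 * b <> 0 & a + 3 * b <> 0]].

Lemma sq_eq0 (k t : R) : k <> 0 -> k * t ^+ 2 = 0 -> t = 0.
Proof. by move=> /eqP k0 /eqP; rewrite mulf_eq0 (negPf k0) sqrf_eq0 => /eqP. Qed.

Lemma kills_w A : (exists a b t1 t2 t3, A = Mx a b t1 t2 t3 0 0 0) -> app A (delta_mx 0 'o_3) = 0 :> 'rV[R]_7.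
Proof.
move=> [a [b [t1 [t2 [t3 ->]]]]].
by rewrite delta_v7E app_Mx; apply: row7P; rewrite !mxE /=; ring.
Qed.

Lemma in_maximal_kills_w : (forall A, P A -> app A (delta_mx 0 'o_3) = 0) ->
  in_maximal (@inV0 R) (@inVp0 R) (@m4std R) P.
Proof.
move=> h; constructor 2; exists (delta_mx 0 'o_3); split => //; last by split; rewrite mxE.
by apply/eqP => /(congr1 (fun z : 'rV[R]_7 => z 0 'o_3)); rewrite !mxE /= => /eqP; rewrite oner_eq0.
Qed.

Hypothesis hproper : exists A, m4std A /\ ~ P A.

(** All eigenspaces outside the diagonal are single root spaces, so the [single] lemmas remove the
    short roots; what remains kills e3. *)
Lemma generic_in_maximal a b : generic a b -> P (D a b) ->
  in_maximal (@inV0 R) (@inVp0 R) (@m4std R) P.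
Proof.
move=> [[g1 g2 g3] [g4 g5 g6] [g7 g8 g9] [g10 g11 g12]] h.
have [np|hf] := noplane_or_full h; last exact: full_in_maximal.
apply: in_maximal_kills_w => A hA.
have [a1 [b1 [t1 [t2 [t3 [r1 [r2 [r3 eA]]]]]]]] := m4std_Mx (hM hA).
rewrite eA in hA *.
have [|||] := diag_components hP hL (s := [:: (0, D a1 b1); ((a + 2 * b) ^+ 2, T1 t1); ((2 * a + b) ^+ 2, T2 t2); ((a - b) ^+ 2, T3 t3);
   (a ^+ 2, R1 r1); (b ^+ 2, R2 r2); ((a + b) ^+ 2, R3 r3)]) h hA.
- rewrite /= !inE !negb_or; repeat (apply/andP; split); try by [];
    rewrite 1?[0 == _]eq_sym ?sqrf_eq0 ?eqf_sqr ?negb_or ?[0 == _]eq_sym ?sqrf_eq0; repeat (apply/andP; split);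
    apply/eqP => e; first [ apply: g1; clear - hP hL hM e; lra | apply: g2; clear - hP hL hM e; lra | apply: g3; clear - hP hL hM e; lra
      | apply: g4; clear - hP hL hM e; lra | apply: g5; clear - hP hL hM e; lra | apply: g6; clear - hP hL hM e; lra
      | apply: g7; clear - hP hL hM e; lra | apply: g8; clear - hP hL hM e; lra | apply: g9; clear - hP hL hM e; lra
      | apply: g10; clear - hP hL hM e; lra | apply: g11; clear - hP hL hM e; lra | apply: g12; clear - hP hL hM e; lra ].
- by eigen_tac.
- by sum_tac.
move=> _ /= [_ [_ [_ [s1 [s2 [s3 _]]]]]].
apply: kills_w; exists a1, b1, t1, t2, t3; congr Mx.
- by apply: (sq_eq0 _ (single_R1 np h s1)); apply/eqP; rewrite mulf_neq0 //; apply/eqP.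
- by apply: (sq_eq0 _ (single_R2 np h s2)); apply/eqP; rewrite mulf_neq0 //; apply/eqP.
- by apply: (sq_eq0 _ (single_R3 np h s3)); apply/eqP; rewrite mulf_neq0 //; apply/eqP.
Qed.
End Core2.

Ltac decomp hM A := let hA := fresh "hA" in let eA := fresh "eA" in
  move=> hA; have [a1 [b1 [t1 [t2 [t3 [r1 [r2 [r3 eA]]]]]]]] := m4std_Mx (hM _ hA); rewrite eA in hA *; clear eA.

Section Core3.
Variables (R : realType) (P : 'M[R]_7 -> Prop).
Hypotheses (hP : subsp P) (hL : lts P) (hM : forall A, P A -> m4std A).

Hypothesis hproper : exists A, m4std A /\ ~ P A.

Local Notation Goal := (in_maximal (@inV0 R) (@inVp0 R) (@m4std R) P).

(** At diag(1,2,-3) the short root a and the long root a-b have the same square 1 and the other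
    squares differ, so only R1 and T3 can mix. Principality of the resulting pair is assumed here;
    it is a fact about the complexification, proved in [principal_pair_nilpotent]. *)
Lemma principal_in_maximal :
  (forall t r : R, t != 0 -> r != 0 ->
     principal_nilpotent (complexify (Mx 0 0 0 0 t r 0 0) (lie (D 1 2) (Mx 0 0 0 0 t r 0 0)))) ->
  P (D 1 2) -> Goal.
Proof.
move=> hprin h; have [np|hf] := noplane_or_full hP h; last exact: full_in_maximal.
(* [[x,y],y] has first entries 2t^2 - 4r^2 and 2r^2 - 2t^2, and these are in ratio 1 : 2 exactly
   when 5r^2 = 3t^2. A subspace of such y has dimension at most one. *)
have E t r : P (Mx 0 0 0 0 t r 0 0) -> 5 * r ^+ 2 = 3 * t ^+ 2.
  move=> hy; have hyy := P_eq (hL (hL h hy hy) h h) (erefl _).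
  have := P_eq (hL h hy hy) (lie_diag_Mx _ _ _ _ _ _ _ _ _ _ _ _ _ _ _ _ _ _).
  set q := Mx _ _ _ _ _ _ _ _; have -> : q = D (2 * t ^+ 2 - 4 * r ^+ 2) (2 * r ^+ 2 - 2 * t ^+ 2).
    by rewrite /q; congr Mx; ring.
  by move=> /np; lra.
have C A : P A -> exists k t r, A = k *: D 1 2 + Mx 0 0 0 0 t r 0 0 /\ P (Mx 0 0 0 0 t r 0 0).
  decomp hM A.
  have [|||] := diag_components hP hL (s := [:: (0, D a1 b1); (1, Mx 0 0 0 0 t3 r1 0 0); (4, R2 r2); (9, R3 r3); (16, T2 t2); (25, T1 t1)]) h hA.
  - by rewrite /= !inE !negb_or; neq_num.
  - by eigen_tac.
  - by sum_tac.
  move=> /= s0 [s1 [s2 [s3 [s4 [s5 _]]]]].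
  exists a1, t3, r1; split=> //.
  have e0 := np _ _ s0.
  have e2 := single_R2 hL np h s2; have e3 := single_R3 hL np h s3.
  have e4 := single_T2 hL np h s4; have e5 := single_T1 hL np h s5.
  have -> : r2 = 0 by apply: (@sq_eq0 _ 1) => //; [exact/eqP/oner_neq0 | lra].
  have -> : r3 = 0 by apply: (@sq_eq0 _ 1) => //; [exact/eqP/oner_neq0 | lra].
  have -> : t2 = 0 by apply: (@sq_eq0 _ 1) => //; [exact/eqP/oner_neq0 | lra].
  have -> : t1 = 0 by apply: (@sq_eq0 _ 1) => //; [exact/eqP/oner_neq0 | lra].
  by rewrite Mx_lin; congr Mx; lra.
have [[t [r [hy t0]]]|n] := Classical_Prop.classic (exists t r, P (Mx 0 0 0 0 t r 0 0) /\ t <> 0); last first.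
  apply: in_maximal_kills_w => A /C [k [t [r [-> hy]]]].
  have t0 : t = 0 by apply/eqP/negPn/negP => /eqP z; apply: n; exists t, r.
  have r0 : r = 0 by apply: (@sq_eq0 _ 5); [apply/eqP; rewrite pnatr_eq0 | rewrite (E _ _ hy) t0; ring].
  rewrite Mx_lin t0 r0; apply: kills_w; exists k, (k * 2), 0, 0, 0; congr Mx; ring.
have /eqP tn0 := t0.
(* The values c^2 = 5/2 and d^2 = 3/2 satisfy this relation and normalize [[x,y],y] to -x. *)
pose c := Num.sqrt (5 / 2) : R; have c2 : c ^+ 2 = 5 / 2 by rewrite sqr_sqrtr // divr_ge0 ?ler0n.
have c0 : c != 0 by apply/eqP => z; move: c2; rewrite z; lra.
pose k := c / t; have k0 : k != 0 by rewrite mulf_neq0 ?invr_eq0.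
have hy' : P (Mx 0 0 0 0 c (k * r) 0 0).
  by apply: P_eq (subspZ hP k hy) _; rewrite Mx_scale /k; congr Mx; field.
have d2 : (k * r) ^+ 2 = 3 / 2 by have := E _ _ hy'; rewrite c2; lra.
have d0 : k * r != 0 by apply/eqP => z; move: d2; rewrite z; lra.
move: (k * r) hy' d2 d0 => d hy' d2 d0.
constructor 1; exists (D 1 2), (Mx 0 0 0 0 c d 0 0); split; [exact: Mx_m4std|exact: Mx_m4std| |].
- split; last exact: hprin.
    by rewrite lie_diag2; congr Mx; ring.
  rewrite lie_diag_Mx -scaleN1r Mx_scale; congr Mx; try ring.
    by rewrite !(mul0r, mulr0, add0r, addr0) -!expr2 c2 d2; field.
  by rewrite !(mul0r, mulr0, add0r, addr0) -!expr2 c2 d2; field.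
- move=> A /C [l [t' [r' [-> hy'']]]]; exists l, (t' / c); congr (_ + _).
  have hz : P (Mx 0 0 0 0 0 (r' - t' / c * d) 0 0).
    apply: P_eq (subspD hP hy'' (subspZ hP (- (t' / c)) hy')) _.
    by rewrite Mx_scale Mx_add; congr Mx; field.
  have z : r' - t' / c * d = 0.
    by apply: (@sq_eq0 _ 5); [apply/eqP; rewrite pnatr_eq0 | rewrite (E _ _ hz); ring].
  rewrite Mx_scale; congr Mx; rewrite ?mulr0 ?divfK //; lra.
Qed.
End Core3.

Section Core4.
Variables (R : realType) (P : 'M[R]_7 -> Prop).
Hypotheses (hP : subsp P) (hL : lts P) (hM : forall A, P A -> m4std A).

Local Notation Goal := (in_maximal (@inV0 R) (@inVp0 R) (@m4std R) P).

Lemma sum_sq0 (x y : R) : x * y = 0 -> x ^+ 2 = y ^+ 2 -> x = 0.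
Proof.
move=> /eqP; rewrite mulf_eq0 => /orP [/eqP // | /eqP ->].
by rewrite expr0n => /eqP; rewrite sqrf_eq0 => /eqP.
Qed.

(** At diag(-2,1,1) the long root a+2b vanishes, so T1 commutes with x. If P has a second commuting
    element, it is left to the caller, who can diagonalize it together with x. If not, [[x,y],y] is
    a multiple of x, which excludes every y in the two mixed eigenspaces; only x and R1 remain. *)
Lemma short_coroot_in_maximal : P (D (- 2) 1) ->
  (exists s t, (s <> 0 \/ t <> 0) /\ P (Mx 0 s t 0 0 0 0 0)) \/ Goal.
Proof.
move=> h; have [alt|n] := Classical_Prop.classic (exists s t, (s <> 0 \/ t <> 0) /\ P (Mx 0 s t 0 0 0 0 0)); [by left | right].
have E0 a b t : P (Mx a b t 0 0 0 0 0) -> t = 0 /\ a + 2 * b = 0.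
  move=> hy; have hz : P (Mx 0 (b + a / 2) t 0 0 0 0 0).
    by apply: P_eq (subspD hP hy (subspZ hP (a / 2) h)) _; rewrite Mx_scale Mx_add; congr Mx; field.
  split; apply/eqP/negPn/negP => /eqP z; apply: n; first by exists (b + a / 2), t; split; [right|].
  exists (b + a / 2), t; split=> //; left; lra.
have quad1 y3 y4 : P (Mx 0 0 0 y3 y4 0 0 0) -> y3 * y4 = 0 /\ y3 ^+ 2 = y4 ^+ 2.
  move=> hy; have := P_eq (hL h hy hy) (lie_diag_Mx _ _ _ _ _ _ _ _ _ _ _ _ _ _ _ _ _ _).
  set q := Mx _ _ _ _ _ _ _ _; have -> : q = Mx (6 * y3 ^+ 2 + 6 * y4 ^+ 2)
      (- 6 * y4 ^+ 2) (- 6 * (y3 * y4)) 0 0 0 0 0 by rewrite /q; congr Mx; ring.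
  by move=> /E0 [? ?]; split; lra.
have quad2 y6 y7 : P (Mx 0 0 0 0 0 0 y6 y7) -> y6 * y7 = 0 /\ y6 ^+ 2 = y7 ^+ 2.
  move=> hy; have := P_eq (hL h hy hy) (lie_diag_Mx _ _ _ _ _ _ _ _ _ _ _ _ _ _ _ _ _ _).
  set q := Mx _ _ _ _ _ _ _ _; have -> : q = Mx (2 * y6 ^+ 2 + 2 * y7 ^+ 2)
      (- 4 * y6 ^+ 2 + 2 * y7 ^+ 2) (- 6 * (y6 * y7)) 0 0 0 0 0 by rewrite /q; congr Mx; ring.
  by move=> /E0 [? ?]; split; lra.
constructor 4; exists (delta_mx 0 'o_0), (delta_mx 0 'o_3); rewrite !delta_dot.
split=> //; [by split; rewrite mxE | by split; rewrite mxE |].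
move=> A; decomp hM A.
have [|||] := diag_components hP hL (s := [:: (0, Mx a1 b1 t1 0 0 0 0 0); (9, Mx 0 0 0 t2 t3 0 0 0); (4, R1 r1); (1, Mx 0 0 0 0 0 0 r2 r3)]) h hA.
- by rewrite /= !inE !negb_or; neq_num.
- by eigen_tac.
- by sum_tac.
move=> /= s0 [s1 [s2 [s3 _]]].
have [e1 e2] := quad1 _ _ s1; have [e3 e4] := quad2 _ _ s3.
have [-> _] := E0 _ _ _ s0.
have -> : t2 = 0 by apply: (sum_sq0 e1 e2).
have -> : t3 = 0 by apply: (@sum_sq0 _ t2); rewrite 1?mulrC.
have -> : r2 = 0 by apply: (sum_sq0 e3 e4).
have -> : r3 = 0 by apply: (@sum_sq0 _ r2); rewrite 1?mulrC.
exact: preserves_perp1.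
Qed.

(** If a+b or r is nonzero, the killed vector has no e6 component. On <e0, e2> the two relevant
    coordinates of the image have determinant -(ab + r^2). *)
Lemma singular_short (a b r : R) (v : 'rV[R]_7) : a + b <> 0 \/ r <> 0 ->
  v != 0 -> inV0 v -> app (Mx a b 0 0 0 0 0 r) v = 0 -> a * b + r ^+ 2 = 0.
Proof.
move=> abr v0 [x1 x3 x4 x5]; rewrite [in app _ v](v7_eta v) x1 x3 x4 x5 app_Mx => e.
have e1 := congr1 (fun z : 'rV[R]_7 => z 0 'o_1) e; have e3 := congr1 (fun z : 'rV[R]_7 => z 0 'o_3) e.
have e4 := congr1 (fun z : 'rV[R]_7 => z 0 'o_4) e; have e5 := congr1 (fun z : 'rV[R]_7 => z 0 'o_5) e.
rewrite !mxE /= !(mul0r, mulr0, add0r, addr0, oppr0, sub0r) in e1 e3 e4 e5; clear e.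
have x6 : v 0 'o_6 = 0.
  case: abr => /eqP z; apply: (mulfI z); rewrite mulr0; lra.
apply/eqP/negPn/negP => d.
rewrite ?x6 in e1 e5.
have f1 : a * v 0 'o_0 + - r * v 0 'o_2 = 0 by rewrite -[RHS]e1; ring.
have f5 : - r * v 0 'o_0 + - b * v 0 'o_2 = 0 by rewrite -[RHS]e5; ring.
have x0 : v 0 'o_0 = 0.
  apply: (mulfI d); rewrite mulr0.
  have -> : (a * b + r ^+ 2) * v 0 'o_0 = b * (a * v 0 'o_0 + - r * v 0 'o_2) - r * (- r * v 0 'o_0 + - b * v 0 'o_2) by ring.
  by rewrite f1 f5; ring.
have x2 : v 0 'o_2 = 0.
  apply: (mulfI d); rewrite mulr0.
  have -> : (a * b + r ^+ 2) * v 0 'o_2 = - r * (a * v 0 'o_0 + - r * v 0 'o_2) - a * (- r * v 0 'o_0 + - b * v 0 'o_2) by ring.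
  by rewrite f1 f5; ring.
by case/negP: v0; apply/eqP; apply: row7P; rewrite mxE.
Qed.

(* Coordinates on the eigenspace of [ad x ^ 2] in which the condition [[x,y],y] in R x is bilinear. *)
Local Notation F al be p q := (Mx 0 0 ((p - al) / 2) ((q + be) / 2) 0 ((p + al) / 2) ((be - q) / 2) 0).

(** At diag(1,-1,0) the short root a+b vanishes, so R3 commutes with x, and T1, T2, R1, R2 share the
    square 1. Singularity reduces the zero eigenspace of P to the line of x, and [[x,y],y] then
    gives two quadratic equations for y. Either al = be = 0 throughout and e6 is killed, or the y
    form a line and a vector of <e3, e4> is killed. *)
Lemma singular_in_maximal : P (D 1 (- 1)) ->
  (forall A, P A -> exists v : 'rV[R]_7, [/\ v != 0, inV0 v & app A v = 0]) -> Goal.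
Proof.
move=> h hsing.
have E0 a b r : P (Mx a b 0 0 0 0 0 r) -> r = 0 /\ a + b = 0.
  move=> hy; apply: Classical_Prop.NNPP => n.
  have abr : a + b <> 0 \/ r <> 0.
    by apply: Classical_Prop.NNPP => n'; apply: n; split; apply: Classical_Prop.NNPP => z; apply: n'; [right|left].
  pose s := (a + b) / 2.
  (* Singularity of x plus k times the deviation of the given element from the line of x amounts to
     k^2 (s^2 + r^2) = 1; the values k = 1 and k = 2 contradict each other. *)
  have K k : k != 0 -> k ^+ 2 * (s ^+ 2 + r ^+ 2) = 1.
    move=> k0; have hz : P (Mx (1 + k * s) (- 1 + k * s) 0 0 0 0 0 (k * r)).
      apply: P_eq (subspD hP (subspZ hP (1 - k * (a - b) / 2) h) (subspZ hP k hy)) _.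
      by rewrite !Mx_scale Mx_add /s; congr Mx; field.
    have [v [v0 vV e]] := hsing _ hz.
    have : (1 + k * s) * (- 1 + k * s) + (k * r) ^+ 2 = 0.
      apply: singular_short v0 vV e; case: abr => z; [left|right] => e; apply: z.
        have : k * (a + b) = 0 by move: e; rewrite /s => e; lra.
        by move/eqP; rewrite mulf_eq0 (negPf k0) => /eqP.
      by move/eqP: e; rewrite mulf_eq0 (negPf k0) => /eqP.
    by move=> e'; lra.
  have := K 1 (oner_neq0 _); have := K 2; rewrite pnatr_eq0 => /(_ isT); lra.
have Q (al be p q : R) : P (F al be p q) -> p * al + q * be = 0 /\ p * be - q * al + 2 * al * be = 0.
  move=> hy; have := P_eq (hL h hy hy) (lie_diag_Mx _ _ _ _ _ _ _ _ _ _ _ _ _ _ _ _ _ _).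
  set w := Mx _ _ _ _ _ _ _ _; have -> : w = Mx (- 2 * ((q + be) / 2) ^+ 2 - 4 * ((p + al) / 2) ^+ 2 - 2 * ((be - q) / 2) ^+ 2)
      (2 * ((p - al) / 2) ^+ 2 + 2 * ((p + al) / 2) ^+ 2 + 4 * ((be - q) / 2) ^+ 2) 0 0 0 0 0
      (p * be - q * al + 2 * al * be).
    by rewrite /w; congr Mx; field.
  by move=> /E0 [e1 e2]; split; lra.
have Flin (k k' al be p q al' be' p' q' : R) : P (F al be p q) -> P (F al' be' p' q') ->
    P (F (k * al + k' * al') (k * be + k' * be') (k * p + k' * p') (k * q + k' * q')).
  move=> hy hy'; apply: P_eq (subspD hP (subspZ hP k hy) (subspZ hP k' hy')) _.
  by rewrite !Mx_scale Mx_add; congr Mx; field.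
have C A : P A -> exists a t3 al be p q : R, A = D a (- a) + T3 t3 + F al be p q /\ P (F al be p q).
  decomp hM A.
  have [|||] := diag_components hP hL (s := [:: (0, Mx a1 b1 0 0 0 0 0 r3); (1, Mx 0 0 t1 t2 0 r1 r2 0); (4, T3 t3)]) h hA.
  - by rewrite /= !inE !negb_or; neq_num.
  - by eigen_tac.
  - by sum_tac.
  move=> /= s0 [s1 [s2 _]]; have [-> e] := E0 _ _ _ s0.
  exists a1, t3, (r1 - t1), (r2 + t2), (t1 + r1), (t2 - r2); split; last by apply: P_eq s1 _; congr Mx; field.
  rewrite !Mx_add; congr Mx; try field; lra.
have [[al [be [p [q [hy N0]]]]]|n] := Classical_Prop.classic (exists al be p q : R, P (F al be p q) /\ al ^+ 2 + be ^+ 2 <> 0); last first.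
  constructor 3; exists (delta_mx 0 'o_6); split.
  - by apply/eqP => /(congr1 (fun z : 'rV[R]_7 => z 0 'o_6)); rewrite !mxE /= => /eqP; rewrite oner_eq0.
  - by split; rewrite mxE.
  - move=> A /C [a [t3 [al [be [p [q [-> hy]]]]]]].
    have e : al ^+ 2 + be ^+ 2 = 0.
      by apply/eqP/negPn/negP => /eqP e; apply: n; exists al, be, p, q.
    have [-> ->] : al = 0 /\ be = 0.
      have := sqr_ge0 al; have := sqr_ge0 be => p1 p2.
      by split; apply/eqP; rewrite -sqrf_eq0; apply/eqP; lra.
    by rewrite !Mx_add delta_v7E app_Mx; apply: row7P; rewrite !mxE /=; field.
have [q1 q2] := Q _ _ _ _ hy; move/eqP: N0 => N0.
(* A combination of y and y' with al = be = 0 vanishes, by the equations for its sum with y. If (al,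
   be) and (al', be') were independent, combinations with be = 0 and with al = 0 would violate the
   equations for their sum. *)
have U (al' be' p' q' : R) : P (F al' be' p' q') -> exists c : R, [/\ al' = c * al, be' = c * be, p' = c * p & q' = c * q].
  move=> hy'; have [d0|d0] := eqVneq (al * be' - al' * be) 0; last first.
    have h1 := Flin be' (- be) _ _ _ _ _ _ _ _ hy hy'; have h2 := Flin (- al') al _ _ _ _ _ _ _ _ hy hy'.
    have [a1 a2] := Q _ _ _ _ h1; have [b1 b2] := Q _ _ _ _ h2.
    have [_ c2] := Q _ _ _ _ (Flin 1 1 _ _ _ _ _ _ _ _ h1 h2).
    have z1 : be' * p + - be * p' = 0 by apply: (mulIf d0); rewrite mul0r -[RHS]a1; ring.
    have z2 : be' * q + - be * q' = 0 by apply: (mulIf d0); rewrite mul0r -[RHS]oppr0 -[in RHS]a2 z1; ring.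
    have z3 : - al' * q + al * q' = 0 by apply: (mulIf d0); rewrite mul0r -[RHS]b1; ring.
    have z4 : - al' * p + al * p' = 0 by apply: (mulIf d0); rewrite mul0r -[RHS]b2 z3; ring.
    case/negP: d0; rewrite -sqrf_eq0; apply/eqP.
    have e1 : (1 * (be' * p + - be * p') + 1 * (- al' * p + al * p')) = 0 by rewrite z1 z4; ring.
    have e2 : (1 * (be' * q + - be * q') + 1 * (- al' * q + al * q')) = 0 by rewrite z2 z3; ring.
    move: c2; rewrite e1 e2 => c2.
    apply: (mulfI (_ : 2 != 0)); first by rewrite pnatr_eq0.
    by rewrite mulr0 -[RHS]c2; ring.
  have h3 := Flin (- (al * al' + be * be')) (al ^+ 2 + be ^+ 2) _ _ _ _ _ _ _ _ hy hy'.
  have za : - (al * al' + be * be') * al + (al ^+ 2 + be ^+ 2) * al' = 0.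
    by rewrite -[RHS](mulr0 (- be)) -d0; ring.
  have zb : - (al * al' + be * be') * be + (al ^+ 2 + be ^+ 2) * be' = 0.
    by rewrite -[RHS](mulr0 al) -d0; ring.
  move: h3; rewrite za zb; set p3 := (X in F _ _ X _); set q3 := (X in F _ _ _ X) => h3.
  have [] := Q _ _ _ _ (Flin 1 1 _ _ _ _ _ _ _ _ hy h3); rewrite !mul1r !addr0 => c1 c2.
  have k1 : p3 * al + q3 * be = 0 by lra.
  have k2 : p3 * be - q3 * al = 0 by lra.
  have zp : p3 = 0.
    apply: (mulIf N0); rewrite mul0r.
    have -> : p3 * (al ^+ 2 + be ^+ 2) = al * (p3 * al + q3 * be) + be * (p3 * be - q3 * al) by ring.
    by rewrite k1 k2; ring.
  have zq : q3 = 0.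
    apply: (mulIf N0); rewrite mul0r.
    have -> : q3 * (al ^+ 2 + be ^+ 2) = be * (p3 * al + q3 * be) - al * (p3 * be - q3 * al) by ring.
    by rewrite k1 k2; ring.
  exists ((al * al' + be * be') / (al ^+ 2 + be ^+ 2)).
  split; apply: (mulIf N0); rewrite mulrAC divfK //.
  - by move: za => ?; lra.
  - by move: zb => ?; lra.
  - by move: zp; rewrite /p3 => ?; lra.
  - by move: zq; rewrite /q3 => ?; lra.
(* The condition that y kills a vector of <e3, e4> is a 2 by 2 system with this determinant; its
   product with al^2 + be^2 is a combination of the two quadratic expressions. *)
have det0 : (p + al) * p - (be - q) * q = 0.
  apply: (mulIf N0); rewrite mul0r.
  have -> : ((p + al) * p - (be - q) * q) * (al ^+ 2 + be ^+ 2) =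
    (p * al + q * be) ^+ 2 + (p * be - q * al + 2 * al * be) * (p * be - q * al - 2 * al * be)
     + (p * al + q * be) * (al ^+ 2 - be ^+ 2) + (p * be - q * al + 2 * al * be) * (2 * al * be) by ring.
  by rewrite q1 q2; ring.
have [l [m [lm el1 el2]]] : exists l m : R, [/\ (l != 0) || (m != 0),
    (p + al) * l + q * m = 0 & (be - q) * l + p * m = 0].
  have [lm|] := boolP ((p != 0) || (q - be != 0)).
    by exists p, (q - be); split => //; [rewrite -[RHS]det0; ring | ring].
  rewrite negb_or !negbK => /andP [/eqP p0 /eqP qb].
  exists q, (- (p + al)); split; [|ring|rewrite -[RHS]oppr0 -[in RHS]det0; ring].
  rewrite -negb_and; apply: contra N0 => /andP [/eqP z1 /eqP z2].
  have -> : al = 0 by lra.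
  have -> : be = 0 by lra.
  by rewrite expr0n addr0.
constructor 2; exists (v7 0 0 0 l m 0 0); split.
- apply/eqP => e; have e1 := congr1 (fun z : 'rV[R]_7 => z 0 'o_3) e; have e2 := congr1 (fun z : 'rV[R]_7 => z 0 'o_4) e.
  by move: lm; rewrite !mxE /= in e1 e2; rewrite e1 e2 eqxx.
- by split; rewrite mxE.
- move=> A /C [a [t3 [al' [be' [p' [q' [-> /U [c [-> -> -> ->]]]]]]]]].
  rewrite !Mx_add app_Mx; apply: row7P; rewrite !mxE /=; try by field.
    by transitivity (c * ((p + al) * l + q * m)); [field | rewrite el1 mulr0].
  by transitivity (c * ((be - q) * l + p * m)); [field | rewrite el2 mulr0].
Qed.
End Core4.

(** * Complexification *)

Section MapCross.
Variables (S T : comNzRingType) (f : {rmorphism S -> T}).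
Local Notation "A ^f" := (map_mx f A) : ring_scope.
Implicit Types (d g : 'M[S]_7) (x y : 'rV[S]_7).

Lemma map_app d x : (app d x)^f = app d^f x^f.
Proof. by rewrite /app map_mxM map_trmx. Qed.

Lemma map_cross x y : (cross x y)^f = cross x^f y^f.
Proof.
rewrite (v7_eta x) (v7_eta y) cross_v7 (v7_eta (map_mx _ (v7 _ _ _ _ _ _ _)))
  (v7_eta (map_mx _ (v7 (x 0 _) _ _ _ _ _ _))) (v7_eta (map_mx _ (v7 (y 0 _) _ _ _ _ _ _))).
rewrite cross_v7; congr v7; by rewrite !mxE /= !(rmorphD, rmorphB, rmorphN, rmorphM).
Qed.

Lemma map_lie (A B : 'M[S]_7) : (lie A B)^f = lie A^f B^f.
Proof. by rewrite /lie map_mxB !map_mxM. Qed.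

Ltac vec_ring :=
  repeat match goal with |- context [cross ?a ?b] => move: (cross a b) => ? end;
  by apply/rowP => j; rewrite !mxE; ring.

(** A complex vector is a combination of two real ones, so by bilinearity multiplicativity on real
    vectors is enough. *)
Lemma map_aut_comb g (I : T) x1 x2 y1 y2 :
  (forall x y, app g (cross x y) = cross (app g x) (app g y)) ->
  app g^f (cross (x1^f + I *: x2^f) (y1^f + I *: y2^f)) =
  cross (app g^f (x1^f + I *: x2^f)) (app g^f (y1^f + I *: y2^f)).
Proof.
move=> h; have H x y : app g^f (cross x^f y^f) = cross (app g^f x^f) (app g^f y^f).
  by rewrite -map_cross -!map_app h !map_cross.
rewrite !cross_lin !app_lin !H; move: (x1^f) (x2^f) (y1^f) (y2^f) => a b a' b'.
rewrite !cross_lin; vec_ring.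
Qed.
End MapCross.

Section Complexify.
Variable R : realType.
Local Notation C := (complex R).
Local Notation mc := (map_mx (real_complex R)).
Implicit Types (A B d g : 'M[R]_7).

Lemma complexifyE A B : complexify A B = mc A + 'i%C *: mc B.
Proof. by apply/matrixP => i j; rewrite !mxE [LHS]complexE. Qed.

Lemma rowC_decomp (z : 'rV[C]_7) : exists x y : 'rV[R]_7, z = mc x + 'i%C *: mc y.
Proof.
exists (map_mx (@complex.Re R) z), (map_mx (@complex.Im R) z); apply/rowP => j.
by rewrite !mxE [LHS]complexE.
Qed.

Lemma map_aut g : is_aut g -> is_aut (mc g).
Proof.
move=> [u h]; split; first by rewrite map_unitmx.
move=> z t; have [x1 [x2 ->]] := rowC_decomp z; have [y1 [y2 ->]] := rowC_decomp t.
exact: map_aut_comb.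
Qed.
End Complexify.

Section AutC.
Variable T : comUnitRingType.
Implicit Types (g h d e : 'M[T]_7) (x y : 'rV[T]_7).

Lemma app_inv g x : g \in unitmx -> app g (app (invmx g) x) = x.
Proof. by move=> u; rewrite -app_mulmx mulmxV // app_1mx. Qed.
Lemma app_invK g x : g \in unitmx -> app (invmx g) (app g x) = x.
Proof. by move=> u; rewrite -app_mulmx mulVmx // app_1mx. Qed.

Lemma aut_inv g : is_aut g -> is_aut (invmx g).
Proof.
move=> [u h]; split; first by rewrite unitmx_inv.
by move=> x y; rewrite -{1}(app_inv x u) -{1}(app_inv y u) -h app_invK.
Qed.

Lemma aut_mul g h : is_aut g -> is_aut h -> is_aut (g *m h).
Proof.
move=> [u a] [v b]; split; first by rewrite unitmx_mul u.
by move=> x y; rewrite !app_mulmx b a.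
Qed.

Lemma aut_der g d : is_aut g -> is_der d -> is_der (g *m d *m invmx g).
Proof.
move=> [u a] hd x y; rewrite !app_mulmx.
have [_ b] := aut_inv (conj u a).
by rewrite b hd appD !a !app_inv.
Qed.

Lemma invmx_mulE g h : g \in unitmx -> h \in unitmx -> invmx (g *m h) = invmx h *m invmx g.
Proof.
move=> u v; apply: (can_inj (mulmxK (_ : g *m h \in unitmx))); rewrite ?unitmx_mul ?u // mulVmx ?unitmx_mul ?u //.
by rewrite -!mulmxA (mulmxA (invmx g)) mulVmx // mul1mx mulVmx.
Qed.

Lemma lie_conj g d e : g \in unitmx -> 
  lie (g *m d *m invmx g) (g *m e *m invmx g) = g *m lie d e *m invmx g.
Proof.
move=> u; rewrite /lie mulmxBr mulmxBl; congr (_ - _);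
  by rewrite !mulmxA; congr (_ *m _); rewrite -!mulmxA (mulmxA (invmx g)) mulVmx // mul1mx.
Qed.

Lemma conj_invmx g d : g \in unitmx -> g *m (invmx g *m d *m g) *m invmx g = d.
Proof. by move=> u; rewrite !mulmxA mulmxV // mul1mx mulmxK. Qed.

Lemma iter_lie_conj g d e n : g \in unitmx ->
  iter n (lie (g *m d *m invmx g)) (g *m e *m invmx g) = g *m iter n (lie d) e *m invmx g.
Proof. by move=> u; elim: n => //= n ->; rewrite lie_conj. Qed.

Lemma conj_mul g h e : g \in unitmx -> h \in unitmx ->
  h *m invmx g *m (g *m e *m invmx g) *m invmx (h *m invmx g) = h *m e *m invmx h.
Proof.
move=> u v; rewrite invmx_mulE ?unitmx_inv // invmxK.
by rewrite -!mulmxA mulKmx // mulKmx // !mulmxA.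
Qed.

Lemma aut_unit g : is_aut g -> g \in unitmx. Proof. by case. Qed.
End AutC.

Section Principal.
Variable R : realType.
Local Notation C := (complex R).
Implicit Types (e g X : 'M[C]_7).

Lemma nilvarC_conj g e : is_aut g -> nilvarC e -> nilvarC (g *m e *m invmx g).
Proof.
move=> ga [he [n hn]]; have u : g \in unitmx by case: ga.
split; first exact: aut_der.
exists n => Y hY.
have hY' : is_der (invmx g *m Y *m g) by have := aut_der (aut_inv ga) hY; rewrite invmxK.
by rewrite -(conj_invmx Y u) iter_lie_conj // hn // mulmx0 mul0mx.
Qed.

Lemma principal_nilpotent_conj g e : is_aut g -> principal_nilpotent e ->
  principal_nilpotent (g *m e *m invmx g).
Proof.
move=> ga [he hd]; split; first exact: nilvarC_conj.
move=> X hX eps e0; have [k [ka hk]] := hd X hX eps e0.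
exists (k *m invmx g); split; first exact: (aut_mul ka (aut_inv ga)).
by move=> i j; rewrite (conj_mul _ (aut_unit ga) (aut_unit ka)); apply: hk.
Qed.
End Principal.

(** * Classification of proper Lie triple subsystems *)

Section Classification.
Variable R : realType.
Implicit Types (x y u v w : 'rV[R]_7) (A d g : 'M[R]_7) (V : 'M[R]_7) (P : 'M[R]_7 -> Prop).

Lemma invmx_orth n (g : 'M[R]_n) : g *m g^T = 1%:M -> invmx g = g^T.
Proof. by move=> h; have [u _] := mulmx1_unit h; rewrite -[LHS]mulmx1 -h mulKmx. Qed.

Lemma complexify_cj g A B : g *m g^T = 1%:M ->
  complexify (cj g A) (cj g B) =
  map_mx (real_complex R) g *m complexify A B *m invmx (map_mx (real_complex R) g).
Proof.
move=> h; rewrite -map_invmx invmx_orth // !complexifyE /cj !map_mxM.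
by rewrite mulmxDr mulmxDl -scalemxAr -scalemxAl.
Qed.

Lemma in_maximal_conj g (inV inVp inV' inVp' : 'rV[R]_7 -> Prop) (mm mm' : 'M[R]_7 -> Prop) P :
  is_aut g -> g *m g^T = 1%:M -> (forall x, inV x -> inV' (app g x)) ->
  (forall x, inVp x -> inVp' (app g x)) -> (forall d, mm d -> mm' (cj g d)) ->
  in_maximal inV inVp mm (fun d => P (cj g d)) -> in_maximal inV' inVp' mm' P.
Proof.
move=> ga go gV gVp gm.
have neq0 x : x != 0 -> app g x != 0.
  by apply: contra_neq => e; rewrite -(app_Ktr x go) e app0.
have gD x y : dot (app g x) (app g y) = dot x y.
  by rewrite -[g in app g x]trmxK dot_app_tr app_Ktr.
have ker x A : app (cj g^T A) x = 0 -> app A (app g x) = 0.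
  by rewrite -{2}(cjVK A go) (app_cj g) app_Ktr // => ->; rewrite app0.
case.
- case=> x [y [hx hy [e1 e2 pn] hP]]; constructor 1; exists (cj g x), (cj g y); split.
  + exact: gm.
  + exact: gm.
  + have cN z : cj g (- z) = - cj g z by rewrite /cj mulmxN mulNmx.
    split; [by rewrite -!cj_lie // e1 | by rewrite -!cj_lie // e2 cN |].
    rewrite -(cj_lie _ _ go) (complexify_cj _ _ go).
    exact: (principal_nilpotent_conj (map_aut ga) pn).
  + move=> A; rewrite -(cjVK A go) => /hP [a [b ->]]; exists a, b.
    by rewrite cj_lin; congr (_ + _); rewrite -[b *: y]addr0 cj_lin /cj mulmx0 mul0mx addr0.
- case=> l [l0 lV hP]; constructor 2; exists (app g l); split; [exact: neq0|exact: gVp|].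
  by move=> A hA; apply: ker; apply: hP; rewrite cjVK.
- case=> l [l0 lV hP]; constructor 3; exists (app g l); split; [exact: neq0|exact: gV|].
  by move=> A hA; apply: ker; apply: hP; rewrite cjVK.
- case=> v [w [vV wV vv ww hP]]; constructor 4; exists (app g v), (app g w); rewrite !gD.
  split; [exact: gV|exact: gVp|by []|by []|].
  move=> A hA z; rewrite -(aut_cross v w ga) -(app_trK z go) !gD => h1 h2 h3.
  have := hP (cj g^T A); rewrite cjVK // => /(_ hA _ h1 h2 h3).
  by rewrite app_cj trmxK !dot_app_tr.
Qed.

Lemma in_maximal_sub (inV inVp : 'rV[R]_7 -> Prop) mm P P' : (forall A, P' A -> P A) ->
  in_maximal inV inVp mm P -> in_maximal inV inVp mm P'.
Proof.
move=> hP; case=> [[x [y [h1 h2 h3 h]]]|[l [h1 h2 h]]|[u [h1 h2 h]]|[v [w [h1 h2 h3 h4 h]]]].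
- by constructor 1; exists x, y; split=> // A /hP; apply: h.
- by constructor 2; exists l; split=> // A /hP; apply: h.
- by constructor 3; exists u; split=> // A /hP; apply: h.
- by constructor 4; exists v, w; split=> // A /hP; apply: h.
Qed.

Lemma in_maximal_transport V g P : frame V g ->
  in_maximal (@inV0 R) (@inVp0 R) (@m4std R) (fun d => P (cj g d)) ->
  in_maximal (fun x => (x <= V)%MS) (inperp V) (m4 V) P.
Proof.
move=> hg; have [ga go gV gVp] := hg.
by apply: in_maximal_conj ga go _ _ _ => ?; [move/gV | move/gVp | move/(frame_m4 _ hg)].
Qed.

Lemma in_maximal_std V g P : frame V g ->
  in_maximal (fun x => (x <= V)%MS) (inperp V) (m4 V) P ->
  in_maximal (@inV0 R) (@inVp0 R) (@m4std R) (fun d => P (cj g d)).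
Proof.
move=> hg h; have [ga go gV gVp] := hg.
apply: (in_maximal_conj (is_aut_tr ga go) _ _ _ _ (in_maximal_sub _ h)).
- by rewrite trmxK orth_tr.
- by move=> x hx; apply/gV; rewrite app_trK.
- by move=> x hx; apply/gVp; rewrite app_trK.
- by move=> d hd; apply/(frame_m4 _ hg); rewrite cjVK.
- by move=> A; rewrite cjVK.
Qed.

Section Conjugate.
Variables (V g : 'M[R]_7) (P : 'M[R]_7 -> Prop).
Hypotheses (hg : frame V g) (hP : subsp P) (hL : lts P) (hM : forall A, P A -> m4 V A).
Hypothesis hproper : exists A, m4 V A /\ ~ P A.
Let Pg d := P (cj g d).

Lemma cj0 : cj g 0 = 0. Proof. by rewrite /cj mulmx0 mul0mx. Qed.

Lemma subsp_conj : subsp Pg.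
Proof.
split; rewrite /Pg; first by rewrite cj0; case: hP.
by move=> k A B hA hB; rewrite cj_lin; case: hP => _; apply.
Qed.

Lemma lts_conj : lts Pg.
Proof. by case: hg => _ go _ _; move=> A B C hA hB hC; rewrite /Pg !cj_lie //; apply: hL. Qed.

Lemma m4_conj A : Pg A -> m4std A. Proof. by move=> /hM /(frame_m4 _ hg). Qed.

Lemma proper_conj : exists A, m4std A /\ ~ Pg A.
Proof.
case: hproper => A [hA nA]; have [_ go _ _] := hg; exists (cj g^T A); split.
  by apply/(frame_m4 _ hg); rewrite cjVK.
by rewrite /Pg cjVK.
Qed.
End Conjugate.

Lemma diag_in_cj V g d a b u v w : frame V g -> m4 V d ->
  app g (delta_mx 0 'o_0) = u -> app g (delta_mx 0 'o_2) = v -> app g (delta_mx 0 'o_3) = - w ->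
  diag_in V d a b u v w -> cj g^T d = Mx a b 0 0 0 0 0 0.
Proof.
move=> hg hd g0 g2 g3 [_ _ du dv]; have [ga go _ _] := hg.
have w3 : w = app g (- delta_mx 0 'o_3) by rewrite appN g3 opprK.
apply: m4std_ext; [by apply/(frame_m4 _ hg); rewrite cjVK | exact: Mx_m4std | |].
- rewrite app_cj trmxK g0 du w3 -g0 -aut_cross // appZ app_Ktr //.
  by rewrite !delta_v7E app_Mx !v7E; congr v7; ring.
- rewrite app_cj trmxK g2 dv w3 -g2 -aut_cross // appZ app_Ktr //.
  by rewrite !delta_v7E app_Mx !v7E; congr v7; ring.
Qed.

Lemma diag_in_scale V d a b u v w k : diag_in V d a b u v w ->
  diag_in V (k *: d) (k * a) (k * b) u v w.
Proof. by case=> h1 h2 du dv; split=> //; rewrite app_scalemx ?du ?dv scalerA. Qed.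

Lemma diag_in_eq V d a b a' b' u v w : a = a' -> b = b' ->
  diag_in V d a b u v w -> diag_in V d a' b' u v w.
Proof. by move=> -> ->. Qed.

(** If (a, b) is not generic, one of the twelve forms vanishes. Permuting the eigenvalues by
    [diag_in_swap] and [diag_in_next] and rescaling takes that line to one of the three models. In
    the last type k is recorded as nonzero because the kernel of d itself is read off later. *)
Lemma diag_types V d a b u v w : inMS V -> m4 V d -> d != 0 -> diag_in V d a b u v w ->
  generic a b \/ exists k u' v', [\/ diag_in V (k *: d) 1 2 u' v' w,
     diag_in V (k *: d) (- 2) 1 u' v' w | k != 0 /\ diag_in V (k *: d) 1 (- 1) u' v' w].
Proof.
move=> hV hd d0 h.
have ab : a <> 0 \/ b <> 0.
  apply: Classical_Prop.NNPP => n; case/negP: d0; apply/eqP.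
  have [[uV vV wV] [uu vv ww uv] du dv] := h.
  have a0 : a = 0 by apply: Classical_Prop.NNPP => z; apply: n; left.
  have b0 : b = 0 by apply: Classical_Prop.NNPP => z; apply: n; right.
  by apply: (m4_eq0 hV hd uV vV) => //; rewrite ?du ?dv ?a0 ?b0 scale0r.
have h' := diag_in_swap h; have n := diag_in_next hV hd h; have n' := diag_in_next hV hd h'.
have s := diag_in_swap n; have s' := diag_in_swap n'.
have [?|g] := Classical_Prop.classic (generic a b); [by left | right].
have inv (x : R) : x <> 0 -> x^-1 * x = 1 by move=> /eqP x0; rewrite mulVf.
have F (x y x0 y0 : R) u0 v0 : diag_in V d x y u0 v0 w -> forall z, z <> 0 -> x = x0 * z -> y = y0 * z ->
    diag_in V (z^-1 *: d) x0 y0 u0 v0 w.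
  move=> hd' z /eqP z0 e1 e2; apply: diag_in_eq (diag_in_scale z^-1 hd'); rewrite ?e1 ?e2; by field.
have Z (z : R) : z <> 0 -> z^-1 != 0 by move=> /eqP; rewrite invr_eq0.
have za : a <> 0 \/ a = 0 by case: (eqVneq a 0) => [|/eqP]; [right|left].
have zb : b <> 0 \/ b = 0 by case: (eqVneq b 0) => [|/eqP]; [right|left].
have E (x : R) : x <> 0 \/ x = 0 by case: (eqVneq x 0) => [|/eqP]; [right|left].
case: (E a) => [g1|e]; last first.
  have z : b <> 0 by case: ab.
  exists b^-1, v, (cross v u); constructor 3; split; first exact: Z.
  by apply: (F _ _ _ _ _ _ n') => //; clear - e; lra.
case: (E b) => [g2|e]; last first.
  by exists a^-1, u, (cross u v); constructor 3; split; [exact: Z | apply: (F _ _ _ _ _ _ n) => //; clear - e; lra].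
case: (E (a + b)) => [g3|e]; last first.
  by exists a^-1, u, v; constructor 3; split; [exact: Z | apply: (F _ _ _ _ _ _ h) => //; clear - e; lra].
case: (E (a - b)) => [g4|e]; last first.
  by exists a^-1, (cross u v), u; constructor 2; apply: (F _ _ _ _ _ _ s) => //; clear - e; lra.
case: (E (a + 2 * b)) => [g5|e]; last first.
  by exists b^-1, u, v; constructor 2; apply: (F _ _ _ _ _ _ h) => //; clear - e; lra.
case: (E (2 * a + b)) => [g6|e]; last first.
  by exists a^-1, v, u; constructor 2; apply: (F _ _ _ _ _ _ h') => //; clear - e; lra.
case: (E (b - 2 * a)) => [g7|e]; last first.
  by exists a^-1, u, v; constructor 1; apply: (F _ _ _ _ _ _ h) => //; clear - e; lra.
case: (E (a - 2 * b)) => [g8|e]; last first.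
  by exists b^-1, v, u; constructor 1; apply: (F _ _ _ _ _ _ h') => //; clear - e; lra.
case: (E (3 * a + b)) => [g9|e]; last first.
  by exists a^-1, u, (cross u v); constructor 1; apply: (F _ _ _ _ _ _ n) => //; clear - e; lra.
have c0 : - a - b <> 0 by move=> ?; apply: g3; lra.
case: (E (3 * a + 2 * b)) => [g10|e]; last first.
  by exists (- a - b)^-1, (cross u v), u; constructor 1; apply: (F _ _ _ _ _ _ s) => //; clear - e; lra.
case: (E (2 * a + 3 * b)) => [g11|e]; last first.
  by exists (- a - b)^-1, (cross v u), v; constructor 1; apply: (F _ _ _ _ _ _ s') => //; clear - e; lra.
case: (E (a + 3 * b)) => [g12|e]; last first.
  by exists b^-1, v, (cross v u); constructor 1; apply: (F _ _ _ _ _ _ n') => //; clear - e; lra.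
by case: g; split; split.
Qed.
End Classification.

Section Main.
Variable R : realType.
Implicit Types (x y u v w : 'rV[R]_7) (A d g : 'M[R]_7).

Hypothesis hprin : forall t r : R, t != 0 -> r != 0 ->
  principal_nilpotent (complexify (Mx 0 0 0 0 t r 0 0) (lie (Mx 1 2 0 0 0 0 0 0) (Mx 0 0 0 0 t r 0 0))).

Lemma lts_classification (V : 'M[R]_7) (P : 'M[R]_7 -> Prop) : inMS V ->
  subsp P -> lts P -> (forall A, P A -> m4 V A) -> (exists A, m4 V A /\ ~ P A) ->
  in_maximal (fun x => (x <= V)%MS) (inperp V) (m4 V) P.
Proof.
move=> hV hP hL hM hproper.
have inframe g A a b : frame V g -> P A -> cj g^T A = Mx a b 0 0 0 0 0 0 -> P (cj g (Mx a b 0 0 0 0 0 0)).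
  by case=> _ go _ _ hA <-; rewrite cjVK.
have core g : frame V g ->
    (subsp (fun d => P (cj g d)) -> lts (fun d => P (cj g d)) ->
     (forall A, P (cj g A) -> m4std A) -> (exists A, m4std A /\ ~ P (cj g A)) ->
     in_maximal (@inV0 R) (@inVp0 R) (@m4std R) (fun d => P (cj g d))) ->
    in_maximal (fun x => (x <= V)%MS) (inperp V) (m4 V) P.
  move=> hg h; apply: (in_maximal_transport hg); apply: h.
  - exact: subsp_conj.
  - exact: (lts_conj hg).
  - exact: (m4_conj hg).
  - exact: (proper_conj hg).
have [[A [hA [a [b [u [v [w [hd hgen]]]]]]]]|no1] := Classical_Prop.classic
    (exists A, P A /\ exists a b u v w, diag_in V A a b u v w /\ generic a b).
  have [g [hg _ _ _ /(inframe _ _ _ _ hg hA) hAg]] := diag_in_frame hV (hM A hA) hd.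
  by apply: (core g hg) => h1 h2 h3 h4; exact: (generic_in_maximal h1 h2 h3 h4 hgen hAg).
have [[A [hA [u [v [w hd]]]]]|no2] := Classical_Prop.classic (exists A, P A /\ exists u v w, diag_in V A 1 2 u v w).
  have [g [hg _ _ _ /(inframe _ _ _ _ hg hA) hAg]] := diag_in_frame hV (hM A hA) hd.
  by apply: (core g hg) => h1 h2 h3 h4; exact: (principal_in_maximal h1 h2 h3 h4 hprin hAg).
have [[A [hA [u [v [w hd]]]]]|no3] := Classical_Prop.classic (exists A, P A /\ exists u v w, diag_in V A (- 2) 1 u v w).
  have [g [hg g0 g2 g3 eg]] := diag_in_frame hV (hM A hA) hd.
  have hAg := inframe _ _ _ _ hg hA eg.
  have [] := short_coroot_in_maximal (subsp_conj g hP) (lts_conj hg hL) (m4_conj hg hM) hAg; last exact: (in_maximal_transport hg).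
  move=> [s [t [st hB]]]; pose B := cj g (Mx 0 s t 0 0 0 0 0).
  have [ga go gV _] := hg.
  have [[uV vV wV] [uu vv ww uv] du dv] := hd.
  have w3 : w = app g (- delta_mx 0 'o_3) by rewrite appN g3 opprK.
  have BE x : app B (app g x) = app g (app (Mx 0 s t 0 0 0 0 0) x) by rewrite /B app_cj app_Ktr.
  (* B kills u and acts on v, u × v by a traceless symmetric block, which a rotation of v
     diagonalizes. *)
  have [m [v' hB']] : exists m v', diag_in V B 0 m u v' w.
    apply: (@rotate_diag_in _ _ _ _ s t (- s) _ v) => //; first exact: hM.
    - by rewrite -g0 BE !delta_v7E app_Mx scale0r -[RHS](app0 g); congr app; apply: row7P; rewrite !mxE /=; ring.
    - rewrite -g0 -g2 w3 -!aut_cross // BE -!appZ -appD; congr app.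
      by rewrite !delta_v7E app_Mx !v7E; congr v7; ring.
    - rewrite -g0 -g2 w3 -!aut_cross // BE -!appZ -appD; congr app.
      by rewrite !delta_v7E cross_v7 app_Mx !v7E; congr v7; ring.
  have [[_ v'V _] [_ v'v' _ uv'] Bu Bv'] := hB'.
  (* A has the same eigenvalue 1 on v and on u × v, so it stays diagonal after the rotation. *)
  have hA' : diag_in V A (- 2) 1 u v' w.
    split=> //; have [_ _ _] := diag_in_next hV (hM A hA) hd.
    have [p [q [r e]]] := inMS_span hV uV vV v'V uu vv uv.
    have p0 : p = 0.
      by move: uv'; rewrite e !dot_lin uv uu dot_crossl !mulr0 mulr1 !addr0.
    rewrite e p0 scale0r add0r !app_lin dv => ->.
    rewrite !cross_lin !scale1r; congr (_ + _ *: _).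
    by rewrite (_ : - - 2 - 1 = 1) ?scale1r //; lra.
  have [g' [hg' h0 h2 h3 eg']] := diag_in_frame hV (hM A hA) hA'.
  have hBg' := inframe _ _ _ _ hg' hB (diag_in_cj hg' (hM _ hB) h0 h2 h3 hB').
  have hAg' := inframe _ _ _ _ hg' hA eg'.
  have m0 : m != 0.
    apply/eqP => m0; have B0 : B = 0 by apply: (m4_eq0 hV (hM _ hB) uV v'V) => //; rewrite ?Bu ?Bv' ?m0 scale0r.
    have e2 : app (Mx 0 s t 0 0 0 0 0) (delta_mx 0 'o_2) = 0.
      by rewrite -[LHS](app_Ktr _ go) -BE B0 app_0mx app0.
    rewrite delta_v7E app_Mx in e2.
    have e5 := congr1 (fun z : 'rV[R]_7 => z 0 'o_5) e2; have e4 := congr1 (fun z : 'rV[R]_7 => z 0 'o_4) e2.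
    rewrite !mxE /= in e4 e5; clear e2.
    case: st; apply; lra.
  apply: (core g' hg') => k1 k2 k3 k4; apply: full_in_maximal => //.
  by apply: (plane_full k1 hAg' hBg'); rewrite mul0r mulf_neq0 //; apply/eqP; lra.
have [[A [hA A0]]|no4] := Classical_Prop.classic (exists A, P A /\ A <> 0); last first.
  have [_ [w [_ _ wV ww]]] := inMS_nonzero hV; constructor 2; exists w; split => //.
    by apply/eqP => e; move: ww; rewrite e dot0l => /eqP; rewrite eq_sym oner_eq0.
  move=> A hA; have -> : A = 0 by apply: Classical_Prop.NNPP => ?; apply: no4; exists A.
  exact: app_0mx.
have typ B : P B -> B <> 0 -> exists k u v w, k != 0 /\ diag_in V (k *: B) 1 (- 1) u v w.
  move=> hB /eqP B0; have [a [b [u [v [w h]]]]] := diagonalize hV (hM B hB) B0.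
  have [hgen|[k [u' [v' []]]]] := diag_types hV (hM B hB) B0 h.
  - by case: no1; exists B; split=> //; exists a, b, u, v, w.
  - by move=> h'; case: no2; exists (k *: B); split; [apply: subspZ | exists u', v', w].
  - by move=> h'; case: no3; exists (k *: B); split; [apply: subspZ | exists u', v', w].
  - by case=> k0 h'; exists k, u', v', w.
have [k [u [v [w [k0 hd]]]]] := typ A hA A0.
have hkA : P (k *: A) by apply: subspZ.
have [g [hg _ _ _ /(inframe _ _ _ _ hg hkA) hAg]] := diag_in_frame hV (hM _ hkA) hd.
apply: (core g hg) => h1 h2 h3 h4; apply: (singular_in_maximal h1 h2 h3 hAg).
have [ga go gV _] := hg.
have nz (x : 'rV[R]_7) : dot x x = 1 -> x != 0.
  by move=> e; apply/eqP => e'; move: e; rewrite e' dot0l => /eqP; rewrite eq_sym oner_eq0.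
move=> B hB; have [->|/eqP B0] := eqVneq B 0.
  by exists (delta_mx 0 'o_0); rewrite app_0mx nz ?delta_dot //; split => //; split; rewrite mxE.
have B0' : cj g B <> 0.
  by move=> e; apply: B0; rewrite -(cjK B go) e /cj mulmx0 mul0mx.
have [k' [u' [v' [w' [k'0 h']]]]] := typ _ hB B0'.
have hkB : P (k' *: cj g B) by apply: subspZ.
(* The vector u' × v' carries the third eigenvalue -1 - (-1) = 0: it is the vector of V killed by
   the element. *)
have [[_ qV _] [_ qq _ _] _ e] := diag_in_next hV (hM _ hkB) h'.
exists (app g^T (cross u' v')); split.
- apply: contraTneq isT => e'; have := nz _ qq.
  by rewrite -(app_trK (cross u' v') go) e' app0 eqxx.
- by apply/gV; rewrite app_trK.
- have : app (cj g B) (cross u' v') = 0.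
    move: e; rewrite app_scalemx opprK addNr scale0r => /eqP.
    by rewrite scaler_eq0 (negPf k'0) => /eqP.
  rewrite app_cj => e'; rewrite -[LHS](app_Ktr _ go) e' app0 //.
Qed.
End Main.

(** * Nilpotent derivations in null frames *)

Section Null.
Variable T : numFieldType.
Variable I : T.
Hypothesis sqrI : I * I = - 1.

(** The columns are common eigenvectors of all diag(a, b, -a-b), with eigenvalues I(a+b), I b, I a,
    0, -I a, -I b, -I(a+b). At diag(1,2,-3) this is I times the principal grading 3, 2, 1, 0, -1,
    -2, -3. *)
Definition null_mx : 'M[T]_7 := mxcols [::
  v7 0 0 0 0 (- I) 0 1; v7 0 0 1 0 0 I 0; v7 1 (- I) 0 0 0 0 0; v7 0 0 0 I 0 0 0;
  v7 1 I 0 0 0 0 0; v7 0 0 1 0 0 (- I) 0; v7 0 0 0 0 I 0 1].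

Lemma app_null_mx x0 x1 x2 x3 x4 x5 x6 : app null_mx (v7 x0 x1 x2 x3 x4 x5 x6) =
  v7 (x2 + x4) (I * (x4 - x2)) (x1 + x5) (I * x3) (I * (x6 - x0)) (I * (x1 - x5)) (x0 + x6).
Proof. rewrite app_mxcols /= !mxE /= !v7E; congr v7; ring. Qed.

Definition null_inv (x : 'rV[T]_7) : 'rV[T]_7 :=
  v7 ((x 0 'o_6 + I * x 0 'o_4) / 2) ((x 0 'o_2 - I * x 0 'o_5) / 2) ((x 0 'o_0 + I * x 0 'o_1) / 2)
     (- I * x 0 'o_3) ((x 0 'o_0 - I * x 0 'o_1) / 2) ((x 0 'o_2 + I * x 0 'o_5) / 2)
     ((x 0 'o_6 - I * x 0 'o_4) / 2).

Lemma null_invK x : app null_mx (null_inv x) = x.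
Proof.
rewrite /null_inv app_null_mx; apply: row7P; rewrite !mxE /=; try by field.
- have -> : I * ((x 0 'o_0 - I * x 0 'o_1) / 2 - (x 0 'o_0 + I * x 0 'o_1) / 2) = - (I * I) * x 0 'o_1 by field.
  by rewrite sqrI opprK mul1r.
- have -> : I * (- I * x 0 'o_3) = - (I * I) * x 0 'o_3 by ring.
  by rewrite sqrI opprK mul1r.
- have -> : I * ((x 0 'o_6 - I * x 0 'o_4) / 2 - (x 0 'o_6 + I * x 0 'o_4) / 2) = - (I * I) * x 0 'o_4 by field.
  by rewrite sqrI opprK mul1r.
- have -> : I * ((x 0 'o_2 - I * x 0 'o_5) / 2 - (x 0 'o_2 + I * x 0 'o_5) / 2) = - (I * I) * x 0 'o_5 by field.
  by rewrite sqrI opprK mul1r.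
Qed.

Lemma null_unit : null_mx \in unitmx.
Proof.
rewrite -unitmx_tr -row_full_unit; apply/row_fullP.
exists (\matrix_i null_inv (row i 1%:M)); apply/row_matrixP => i.
by rewrite row_mul rowK; apply: null_invK.
Qed.

(* [cross] in the basis [null_mx]. *)
Definition crossN (x y : 'rV[T]_7) : 'rV[T]_7 := v7
  (- x 0 'o_0 * y 0 'o_3 - 2 * x 0 'o_1 * y 0 'o_2 + 2 * x 0 'o_2 * y 0 'o_1 + x 0 'o_3 * y 0 'o_0)
  (2 * x 0 'o_0 * y 0 'o_4 + x 0 'o_1 * y 0 'o_3 - x 0 'o_3 * y 0 'o_1 - 2 * x 0 'o_4 * y 0 'o_0)
  (- 2 * x 0 'o_0 * y 0 'o_5 + x 0 'o_2 * y 0 'o_3 - x 0 'o_3 * y 0 'o_2 + 2 * x 0 'o_5 * y 0 'o_0)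
  (- 2 * x 0 'o_0 * y 0 'o_6 + 2 * x 0 'o_1 * y 0 'o_5 + 2 * x 0 'o_2 * y 0 'o_4 - 2 * x 0 'o_4 * y 0 'o_2 - 2 * x 0 'o_5 * y 0 'o_1 + 2 * x 0 'o_6 * y 0 'o_0)
  (2 * x 0 'o_1 * y 0 'o_6 + x 0 'o_3 * y 0 'o_4 - x 0 'o_4 * y 0 'o_3 - 2 * x 0 'o_6 * y 0 'o_1)
  (- 2 * x 0 'o_2 * y 0 'o_6 + x 0 'o_3 * y 0 'o_5 - x 0 'o_5 * y 0 'o_3 + 2 * x 0 'o_6 * y 0 'o_2)
  (- x 0 'o_3 * y 0 'o_6 + 2 * x 0 'o_4 * y 0 'o_5 - 2 * x 0 'o_5 * y 0 'o_4 + x 0 'o_6 * y 0 'o_3).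

Lemma crossN_v7 (x0 x1 x2 x3 x4 x5 x6 y0 y1 y2 y3 y4 y5 y6 : T) : crossN (v7 x0 x1 x2 x3 x4 x5 x6) (v7 y0 y1 y2 y3 y4 y5 y6) = v7
  (- x0 * y3 - 2 * x1 * y2 + 2 * x2 * y1 + x3 * y0)
  (2 * x0 * y4 + x1 * y3 - x3 * y1 - 2 * x4 * y0)
  (- 2 * x0 * y5 + x2 * y3 - x3 * y2 + 2 * x5 * y0)
  (- 2 * x0 * y6 + 2 * x1 * y5 + 2 * x2 * y4 - 2 * x4 * y2 - 2 * x5 * y1 + 2 * x6 * y0)
  (2 * x1 * y6 + x3 * y4 - x4 * y3 - 2 * x6 * y1)
  (- 2 * x2 * y6 + x3 * y5 - x5 * y3 + 2 * x6 * y2)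
  (- x3 * y6 + 2 * x4 * y5 - 2 * x5 * y4 + x6 * y3).
Proof. by rewrite /crossN !mxE. Qed.

(* In the basis [null_mx]: a1, a2 are the coefficients on the two simple root vectors. *)
Definition nilmx (a1 a2 c4 c3 c2 c1 : T) : 'M[T]_7 := mxcols [::
  v7 0 0 0 0 0 0 0;
  v7 (- a1) 0 0 0 0 0 0;
  v7 (- c4) (- a2) 0 0 0 0 0;
  v7 (c3) (- c4) (a1) 0 0 0 0;
  v7 (- c2) (c3) 0 (2 * a1) 0 0 0;
  v7 (- c1) 0 (- c3) (- 2 * c4) (a2) 0 0;
  v7 0 (c1) (c2) (2 * c3) (c4) (a1) 0].

Lemma app_nilmx (a1 a2 c4 c3 c2 c1 x0 x1 x2 x3 x4 x5 x6 : T) : app (nilmx a1 a2 c4 c3 c2 c1) (v7 x0 x1 x2 x3 x4 x5 x6) =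
  v7 (- a1 * x1 - c1 * x5 - c2 * x4 + c3 * x3 - c4 * x2) (- a2 * x2 + c1 * x6 + c3 * x4 - c4 * x3) (a1 * x3 + c2 * x6 - c3 * x5) (2 * a1 * x4 + 2 * c3 * x6 - 2 * c4 * x5) (a2 * x5 + c4 * x6) (a1 * x6) (0).
Proof. rewrite app_mxcols /= !mxE /= !v7E; congr v7; ring. Qed.

Definition unip1 (t : T) : 'M[T]_7 := mxcols [::
  v7 1 0 0 0 0 0 0;
  v7 (- t) 1 0 0 0 0 0;
  v7 0 0 1 0 0 0 0;
  v7 0 0 (t) 1 0 0 0;
  v7 0 0 (t ^+ 2) (2 * t) 1 0 0;
  v7 0 0 0 0 0 1 0;
  v7 0 0 0 0 0 (t) 1].

Lemma app_unip1 (t x0 x1 x2 x3 x4 x5 x6 : T) : app (unip1 t) (v7 x0 x1 x2 x3 x4 x5 x6) =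
  v7 (- t * x1 + x0) (x1) (t * x3 + t ^+ 2 * x4 + x2) (2 * t * x4 + x3) (x4) (t * x6 + x5) (x6).
Proof. rewrite app_mxcols /= !mxE /= !v7E; congr v7; ring. Qed.

Definition unip2 (t : T) : 'M[T]_7 := mxcols [::
  v7 1 0 0 0 0 0 0;
  v7 0 1 0 0 0 0 0;
  v7 (- t) 0 1 0 0 0 0;
  v7 0 (- t) 0 1 0 0 0;
  v7 0 0 0 0 1 0 0;
  v7 0 (t ^+ 2) 0 (- 2 * t) 0 1 0;
  v7 0 0 0 0 (t) 0 1].

Lemma app_unip2 (t x0 x1 x2 x3 x4 x5 x6 : T) : app (unip2 t) (v7 x0 x1 x2 x3 x4 x5 x6) =
  v7 (- t * x2 + x0) (- t * x3 + t ^+ 2 * x5 + x1) (x2) (- 2 * t * x5 + x3) (t * x6 + x4) (x5) (x6).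
Proof. rewrite app_mxcols /= !mxE /= !v7E; congr v7; ring. Qed.

Definition unip3 (t : T) : 'M[T]_7 := mxcols [::
  v7 1 0 0 0 0 0 0;
  v7 0 1 0 0 0 0 0;
  v7 0 0 1 0 0 0 0;
  v7 (t) 0 0 1 0 0 0;
  v7 0 (t) 0 0 1 0 0;
  v7 0 0 (- t) 0 0 1 0;
  v7 (t ^+ 2) 0 0 (2 * t) 0 0 1].

Lemma app_unip3 (t x0 x1 x2 x3 x4 x5 x6 : T) : app (unip3 t) (v7 x0 x1 x2 x3 x4 x5 x6) =
  v7 (t * x3 + t ^+ 2 * x6 + x0) (t * x4 + x1) (- t * x5 + x2) (2 * t * x6 + x3) (x4) (x5) (x6).
Proof. rewrite app_mxcols /= !mxE /= !v7E; congr v7; ring. Qed.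

Definition unip4 (t : T) : 'M[T]_7 := mxcols [::
  v7 1 0 0 0 0 0 0;
  v7 0 1 0 0 0 0 0;
  v7 0 0 1 0 0 0 0;
  v7 0 0 0 1 0 0 0;
  v7 (- t) 0 0 0 1 0 0;
  v7 0 0 0 0 0 1 0;
  v7 0 0 (t) 0 0 0 1].

Lemma app_unip4 (t x0 x1 x2 x3 x4 x5 x6 : T) : app (unip4 t) (v7 x0 x1 x2 x3 x4 x5 x6) =
  v7 (- t * x4 + x0) (x1) (t * x6 + x2) (x3) (x4) (x5) (x6).
Proof. rewrite app_mxcols /= !mxE /= !v7E; congr v7; ring. Qed.

Lemma cross_null x y : cross (app null_mx x) (app null_mx y) = app null_mx (crossN x y).
Proof.
coords x; coords y; rewrite crossN_v7 !app_null_mx cross_v7; congr v7; ring: sqrI.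
Qed.

Definition autN (G : 'M[T]_7) :=
  G \in unitmx /\ forall x y, app G (crossN x y) = crossN (app G x) (app G y).

Lemma autN_mul G H : autN G -> autN H -> autN (G *m H).
Proof.
move=> [u a] [v b]; split; first by rewrite unitmx_mul u.
by move=> x y; rewrite !app_mulmx b a.
Qed.

Lemma unip1_aut t : autN (unip1 t).
Proof.
split.
  suff /mulmx1_unit [] : unip1 t *m unip1 (- t) = 1%:M by [].
  by apply: app_inj => x; coords x; rewrite app_mulmx !app_unip1 app_1mx; congr v7; ring.
by move=> x y; coords x; coords y; rewrite crossN_v7 !app_unip1 crossN_v7; congr v7; ring.
Qed.

Lemma unip2_aut t : autN (unip2 t).
Proof.
split.
  suff /mulmx1_unit [] : unip2 t *m unip2 (- t) = 1%:M by [].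
  by apply: app_inj => x; coords x; rewrite app_mulmx !app_unip2 app_1mx; congr v7; ring.
by move=> x y; coords x; coords y; rewrite crossN_v7 !app_unip2 crossN_v7; congr v7; ring.
Qed.

Lemma unip3_aut t : autN (unip3 t).
Proof.
split.
  suff /mulmx1_unit [] : unip3 t *m unip3 (- t) = 1%:M by [].
  by apply: app_inj => x; coords x; rewrite app_mulmx !app_unip3 app_1mx; congr v7; ring.
by move=> x y; coords x; coords y; rewrite crossN_v7 !app_unip3 crossN_v7; congr v7; ring.
Qed.

Lemma unip4_aut t : autN (unip4 t).
Proof.
split.
  suff /mulmx1_unit [] : unip4 t *m unip4 (- t) = 1%:M by [].
  by apply: app_inj => x; coords x; rewrite app_mulmx !app_unip4 app_1mx; congr v7; ring.
by move=> x y; coords x; coords y; rewrite crossN_v7 !app_unip4 crossN_v7; congr v7; ring.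
Qed.

Lemma unip1_conj t a1 a2 c4 c3 c2 c1 : unip1 t *m nilmx a1 a2 c4 c3 c2 c1 = nilmx a1 a2 (- a2 * t + c4) (- a2 * t ^+ 2 + c3 + 2 * c4 * t) (- a2 * t ^+ 3 + c2 + 3 * c3 * t + 3 * c4 * t ^+ 2) c1 *m unip1 t.
Proof.
by apply: app_inj => x; coords x; rewrite !app_mulmx !(app_unip1, app_nilmx); congr v7; ring.
Qed.

Lemma unip2_conj t a1 a2 c3 c2 c1 : unip2 t *m nilmx a1 a2 0 c3 c2 c1 = nilmx a1 a2 0 (- 2 * a1 * t + c3) c2 (3 * a1 * t ^+ 2 + c1 - 3 * c3 * t) *m unip2 t.
Proof.
by apply: app_inj => x; coords x; rewrite !app_mulmx !(app_unip2, app_nilmx); congr v7; ring.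
Qed.

Lemma unip3_conj t a1 a2 c2 c1 : unip3 t *m nilmx a1 a2 0 0 c2 c1 = nilmx a1 a2 0 0 (- 3 * a1 * t + c2) c1 *m unip3 t.
Proof.
by apply: app_inj => x; coords x; rewrite !app_mulmx !(app_unip3, app_nilmx); congr v7; ring.
Qed.

Lemma unip4_conj t a1 a2 c1 : unip4 t *m nilmx a1 a2 0 0 0 c1 = nilmx a1 a2 0 0 0 (a2 * t + c1) *m unip4 t.
Proof.
by apply: app_inj => x; coords x; rewrite !app_mulmx !(app_unip4, app_nilmx); congr v7; ring.
Qed.

Definition torus_mx (s t : T) : 'M[T]_7 := mxcols [::
  v7 (s * t)^-1 0 0 0 0 0 0; v7 0 t^-1 0 0 0 0 0; v7 0 0 s^-1 0 0 0 0; v7 0 0 0 1 0 0 0;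
  v7 0 0 0 0 s 0 0; v7 0 0 0 0 0 t 0; v7 0 0 0 0 0 0 (s * t)].

Lemma app_torus_mx s t x0 x1 x2 x3 x4 x5 x6 : app (torus_mx s t) (v7 x0 x1 x2 x3 x4 x5 x6) =
  v7 ((s * t)^-1 * x0) (t^-1 * x1) (s^-1 * x2) x3 (s * x4) (t * x5) (s * t * x6).
Proof. rewrite app_mxcols /= !mxE /= !v7E; congr v7; ring. Qed.

Lemma torus_aut s t : s != 0 -> t != 0 -> autN (torus_mx s t).
Proof.
move=> s0 t0; split.
  suff /mulmx1_unit [] : torus_mx s t *m torus_mx s^-1 t^-1 = 1%:M by [].
  apply: app_inj => x; coords x; rewrite app_mulmx !app_torus_mx app_1mx; congr v7;
    by field; rewrite ?s0 ?t0.
move=> x y; coords x; coords y; rewrite crossN_v7 !app_torus_mx crossN_v7; congr v7;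
  by field; rewrite ?s0 ?t0.
Qed.

Lemma torus_conj a1 a2 : a1 != 0 -> a2 != 0 ->
  torus_mx a1 (a1 * a2) *m nilmx a1 a2 0 0 0 0 = nilmx 1 1 0 0 0 0 *m torus_mx a1 (a1 * a2).
Proof.
move=> a10 a20; apply: app_inj => x; coords x; rewrite !app_mulmx !(app_torus_mx, app_nilmx); congr v7;
  by field; rewrite ?a10 ?a20.
Qed.

(** The coefficients c4, c3, c2, c1 are removed by increasing height. The root of each is the root
    of the unipotent used plus a simple root, whose coefficient is nonzero, so the parameter can be
    solved for. The torus then normalizes a1 and a2 to 1. *)
Lemma nilmx_conj a1 a2 c4 c3 c2 c1 : a1 != 0 -> a2 != 0 ->
  exists G, autN G /\ G *m nilmx a1 a2 c4 c3 c2 c1 = nilmx 1 1 0 0 0 0 *m G.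
Proof.
move=> a10 a20.
pose sim X Y := exists G, autN G /\ G *m X = Y *m G.
have tr X Y Z : sim X Y -> sim Y Z -> sim X Z.
  move=> [G [aG hG]] [H [aH hH]]; exists (H *m G); split; first exact: autN_mul.
  by rewrite -mulmxA hG mulmxA hH mulmxA.
have n20 : 2 != 0 :> T by rewrite pnatr_eq0.
have n30 : 3 != 0 :> T by rewrite pnatr_eq0.
apply: (tr _ (nilmx a1 a2 0 (- a2 * (c4 / a2) ^+ 2 + c3 + 2 * c4 * (c4 / a2))
   (- a2 * (c4 / a2) ^+ 3 + c2 + 3 * c3 * (c4 / a2) + 3 * c4 * (c4 / a2) ^+ 2) c1)).
  exists (unip1 (c4 / a2)); split; first exact: unip1_aut.
  by rewrite unip1_conj; congr (nilmx _ _ _ _ _ _ *m _); field.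
move: (_ + 2 * c4 * _) (_ + 3 * c4 * _) => d3 d2.
apply: (tr _ (nilmx a1 a2 0 0 d2 (3 * a1 * (d3 / (2 * a1)) ^+ 2 + c1 - 3 * d3 * (d3 / (2 * a1))))).
  exists (unip2 (d3 / (2 * a1))); split; first exact: unip2_aut.
  by rewrite unip2_conj; congr (nilmx _ _ _ _ _ _ *m _); field.
move: (_ - 3 * d3 * _) => d1.
apply: (tr _ (nilmx a1 a2 0 0 0 d1)).
  exists (unip3 (d2 / (3 * a1))); split; first exact: unip3_aut.
  by rewrite unip3_conj; congr (nilmx _ _ _ _ _ _ *m _); field.
apply: (tr _ (nilmx a1 a2 0 0 0 0)).
  exists (unip4 (- d1 / a2)); split; first exact: unip4_aut.
  by rewrite unip4_conj; congr (nilmx _ _ _ _ _ _ *m _); field.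
exists (torus_mx a1 (a1 * a2)); split; last exact: torus_conj.
by apply: torus_aut; rewrite ?mulf_neq0.
Qed.
End Null.

(** * Completion of a null pair to a null frame *)

Section NullFrame.
Variable T : numFieldType.
Variable I : T.
Hypothesis sqrI : I * I = - 1.
Implicit Types (v w s t x y : 'rV[T]_7) (d g : 'M[T]_7).

Lemma dot_dual v : v != 0 -> exists s, dot v s = 1.
Proof.
move=> v0; have [j vj] : exists j, v 0 j != 0.
  apply/existsP; apply: contraNT v0; rewrite negb_exists => /forallP h.
  by apply/eqP/rowP => j; rewrite mxE; apply/eqP; move: (h j); rewrite negbK.
by exists ((v 0 j)^-1 *: delta_mx 0 j); rewrite dotZr delta_v7 mulVf.
Qed.

Lemma dot_dual2 v w : v != 0 -> (forall k, w != k *: v) -> exists s, dot v s = 1 /\ dot w s = 0.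
Proof.
move=> v0 vw; have w0 : w != 0 by have := vw 0; rewrite scale0r.
have [e we] := dot_dual w0.
pose u := v - dot v e *: w.
have u0 : u != 0.
  apply/eqP => /eqP; rewrite subr_eq0 => /eqP e'.
  have k0 : dot v e != 0 by apply: contraNneq v0 => k0; rewrite e' k0 scale0r.
  by move: (vw (dot v e)^-1); rewrite {2}e' scalerA mulVf // scale1r eqxx.
have [x ux] := dot_dual u0.
exists (x - dot w x *: e); rewrite !dot_lin we mulr1 subrr; split=> //.
by rewrite -ux /u !dot_lin mulrC.
Qed.

(** The double product rule gives <v,w> v = <v,v> w, and independence makes both coefficients
    vanish. *)
Lemma null_perp v w : (forall k, w != k *: v) -> v != 0 -> cross v w = 0 ->
  [/\ dot v v = 0, dot v w = 0 & dot w w = 0].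
Proof.
move=> vw v0 cvw; have [s [vs ws]] := dot_dual2 v0 vw.
have h := cross_crossx v w; rewrite cvw cross0r in h.
have h' := cross_crossx w v; rewrite (crossC w v) cvw oppr0 cross0r in h'.
have e1 := congr1 (fun x => dot x s) h; have e2 := congr1 (fun x => dot x s) h'.
rewrite !dot_lin vs ws ?(mulr0, mulr1, subr0, sub0r) in e1 e2.
have vw0 : dot v w = 0 by rewrite -e1.
split=> //; last by apply/eqP; rewrite -oppr_eq0 -e2.
move: h; rewrite vw0 scale0r sub0r => /eqP; rewrite eq_sym oppr_eq0 scaler_eq0.
by have := vw 0; rewrite scale0r => /negPf ->; rewrite orbF => /eqP.
Qed.

(* [v] is completed to a null pair [v, s] with [dot v s = 1], and [w] to a unit vector [c] whose
   isotropic part in the eigenspace of the cross product by [o] is [w / 2]. *)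
Lemma null_triple v w : v != 0 -> (forall k, w != k *: v) -> cross v w = 0 ->
  exists a b c, [/\ [/\ dot a a = 1, dot b b = 1 & dot c c = 1],
    [/\ dot a b = 0, dot a c = 0, dot b c = 0 & dot c (cross a b) = 0],
    v = a + I *: b & w = c + I *: cross c (cross a b)].
Proof.
move=> v0 vw cvw; have [vv vw0 ww] := null_perp vw v0 cvw.
have [s0 [vs0 ws0]] := dot_dual2 v0 vw.
(* Makes s isotropic; the products with v and w do not change, because v is isotropic and orthogonal
   to w. *)
pose s := s0 - (dot s0 s0 / 2) *: v.
have vs : dot v s = 1 by rewrite /s !dot_lin vv vs0 mulr0 subr0.
have ws : dot w s = 0 by rewrite /s !dot_lin ws0 dotC vw0 mulr0 subr0.
have ss : dot s s = 0.
  by rewrite /s !dot_lin (dotC s0 v) vs0 vv; field.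
move: s vs ws ss => s vs ws ss; clear s0 vs0 ws0.
have sv : dot s v = 1 by rewrite dotC.
have wv : dot w v = 0 by rewrite dotC.
have sw : dot s w = 0 by rewrite dotC.
pose a := 2^-1 *: v + s; pose b := - I *: (2^-1 *: v - s).
have h2 : 2^-1 + 2^-1 = 1 :> T by field.
have aa : dot a a = 1 by rewrite /a !dot_lin vv vs sv ss; field.
have bb : dot b b = 1.
  rewrite /b !dot_lin vv vs sv ss.
  by transitivity (- (I * I)); [field | rewrite sqrI opprK].
have ab : dot a b = 0 by rewrite /a /b !dot_lin vv vs sv ss; field.
have vab : v = a + I *: b.
  rewrite /a /b scalerA mulrN sqrI opprK scale1r addrACA -scalerDl h2 scale1r.
  by rewrite [s - s]subrr addr0.
pose o := cross a b.
have oE : o = I *: cross v s.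
  rewrite /o /a /b !cross_lin !crossxx (crossC s v).
  by apply/rowP => j; move: (cross v s) => u; rewrite !mxE; field.
have oo : dot o o = 1 by rewrite dot_cross2 aa bb ab mulr0 subr0 mulr1.
have vo : dot v o = 0 by rewrite oE dotZr dot_crossl mulr0.
have so : dot s o = 0 by rewrite oE dotZr dot_crossr mulr0.
have wo : dot w o = 0 by rewrite oE dotZr -dot_cross (crossC w v) cvw oppr0 dot0l mulr0.
have ov : dot o v = 0 by rewrite dotC.
have os : dot o s = 0 by rewrite dotC.
have ow : dot o w = 0 by rewrite dotC.
have wxo : I *: cross w o = w.
  have h := cross_cross s v w; rewrite cvw cross0r sv sw vw0 !scale0r !add0r mulr1 in h.
  have k := cross_cross w v s; rewrite wv ws vs mulr0 !scale0r scale1r add0r subr0 in k.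
  rewrite (crossC s w) crossNr in h.
  have {}h : cross v (cross w s) = 2 *: w.
    by apply: oppr_inj; rewrite h.
  rewrite h in k; have {}k : cross w (cross v s) = w - 2 *: w by apply: (addIr (2 *: w)); rewrite k subrK.
  rewrite oE crossZr scalerA sqrI k scaleN1r opprB.
  by rewrite scaler_nat mulr2n addrK.
have w0 : w != 0 by have := vw 0; rewrite scale0r.
have [t0 wt0] := dot_dual w0.
pose t := t0 - dot s t0 *: v - dot v t0 *: s - dot o t0 *: o.
have tv : dot t v = 0 by rewrite /t !dot_lin vv sv ov (dotC t0); ring.
have ts : dot t s = 0 by rewrite /t !dot_lin vs ss os (dotC t0); ring.
have to : dot t o = 0 by rewrite /t !dot_lin vo so oo (dotC t0); ring.
have tw : dot t w = 1 by rewrite /t !dot_lin vw0 sw ow (dotC t0) wt0; ring.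
move: t tv ts to tw => t tv ts to tw; clear t0 wt0.
have ota : dot t a = 0 by rewrite /a !dot_lin tv ts; ring.
have otb : dot t b = 0 by rewrite /b !dot_lin tv ts; ring.
have [ob oa _ _ _] := line_cyc aa bb ab (erefl o).
have ccb : cross (cross t o) o = - t.
  by rewrite crossC (crossC t o) crossNr opprK cross_crossx (dotC o t) to oo scale0r scale1r sub0r.
(* Projection of t to the eigenspace of the product with o opposite to that of w. Thus w and y are
   dual isotropic vectors, and c = w/2 + y has norm 1. *)
pose y := 2^-1 *: (t - I *: cross t o).
have yo : I *: cross y o = - y.
  rewrite /y !cross_lin ccb; move: (cross t o) => u; apply/rowP => j; rewrite !mxE.
  by transitivity (2^-1 * (t 0 j * (I * I) + I * u 0 j)); [field | rewrite sqrI; field].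
have wto : dot w (cross t o) = I.
  have <- : dot t (- cross w o) = dot w (cross t o).
    by rewrite -[RHS]dot_cross (crossC w t) dotNl dot_cross dotNr.
  have -> : cross w o = - I *: w by rewrite -{2}wxo scalerA mulNr sqrI opprK scale1r.
  by rewrite scaleNr opprK dotZr tw mulr1.
have wy : dot w y = 1.
  by rewrite /y !dot_lin (dotC w) tw wto sqrI; field.
have yy : dot y y = 0.
  have e1 : dot (cross t o) (cross t o) = dot t t by rewrite dot_cross2 oo to; ring.
  rewrite /y !dot_lin (dotC (cross t o) t) dot_crossl e1.
  by transitivity (2^-1 * 2^-1 * (dot t t + I * I * dot t t)); [field | rewrite sqrI; ring].
have wa : dot w a = 0 by rewrite /a !dot_lin wv ws; ring.
have wb : dot w b = 0 by rewrite /b !dot_lin wv ws; ring.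
have ya : dot y a = 0 by rewrite /y dotZl dotDl dotNl dotZl ota dot_cross oa otb; ring.
have yb : dot y b = 0 by rewrite /y dotZl dotDl dotNl dotZl otb dot_cross (crossC o) ob dotNr ota; ring.
have yo' : dot y o = 0 by rewrite /y dotZl dotDl dotNl dotZl to (dotC _ o) dot_crossr; ring.
clearbody y. exists a; exists b; exists (2^-1 *: w + y); split; [|split|exact: vab|].
- by split=> //; rewrite !dot_lin ww wy yy (dotC y) wy; field.
- exact: ab.
- by rewrite dotC dotDl dotZl wa ya mulr0 addr0.
- by rewrite dotC dotDl dotZl wb yb mulr0 addr0.
- by rewrite -/o dotDl dotZl wo yo' mulr0 addr0.
- rewrite -/o crossDl crossZl scalerDr yo scalerA (mulrC I) -scalerA wxo.
  by rewrite addrACA subrr addr0 -scalerDl h2 scale1r.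
Qed.

(** Both the model pair and (v, w) have the form a + I b, c + I (c × (a × b)) for basic triples, so
    the automorphism of one triple composed with the inverse of the other moves the model pair to
    (v, w). *)
Lemma null_frame v w : v != 0 -> (forall k, w != k *: v) -> cross v w = 0 ->
  exists g, [/\ is_aut g, g *m g^T = 1%:M, app g (app (null_mx I) (delta_mx 0 'o_0)) = v
    & app g (app (null_mx I) (delta_mx 0 'o_1)) = w].
Proof.
move=> v0 vw cvw.
have [a [b [c [[aa bb cc] [ab ac bc abc] ve we]]]] := null_triple v0 vw cvw.
(* Chosen because e0 + I e1 and e2 + I (e2 × (e0 × e1)) are the first two columns of [null_mx]. *)
pose e0 : 'rV[T]_7 := v7 0 0 0 0 0 0 1; pose e1 : 'rV[T]_7 := v7 0 0 0 0 (- 1) 0 0.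
pose e2 : 'rV[T]_7 := v7 0 0 1 0 0 0 0.
have E00 : dot e0 e0 = 1 by rewrite dot_v7; ring.
have E11 : dot e1 e1 = 1 by rewrite dot_v7; ring.
have E22 : dot e2 e2 = 1 by rewrite dot_v7; ring.
have E01 : dot e0 e1 = 0 by rewrite dot_v7; ring.
have E02 : dot e0 e2 = 0 by rewrite dot_v7; ring.
have E12 : dot e1 e2 = 0 by rewrite dot_v7; ring.
have E2 : dot e2 (cross e0 e1) = 0 by rewrite cross_v7 dot_v7; ring.
have ka := triple_mx_aut E00 E11 E22 E01 E02 E12 E2.
have ko := triple_mx_orth E00 E11 E22 E01 E02 E12 E2.
have k0 : app (triple_mx e0 e1 e2) (v7 1 I 0 0 0 0 0) = app (null_mx I) (delta_mx 0 'o_0).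
  rewrite app_triple delta_v7E app_null_mx /e0 /e1 /e2 !cross_v7 !mxE /= !v7E; congr v7; ring.
have k1 : app (triple_mx e0 e1 e2) (v7 0 0 1 0 0 I 0) = app (null_mx I) (delta_mx 0 'o_1).
  rewrite app_triple delta_v7E app_null_mx /e0 /e1 /e2 !cross_v7 !mxE /= !v7E; congr v7; ring.
have ga := triple_mx_aut aa bb cc ab ac bc abc.
have go := triple_mx_orth aa bb cc ab ac bc abc.
have g0 : app (triple_mx a b c) (v7 1 I 0 0 0 0 0) = v.
  by rewrite app_triple !mxE /= !scale0r !addr0 scale1r -ve.
have g1 : app (triple_mx a b c) (v7 0 0 1 0 0 I 0) = w.
  by rewrite app_triple !mxE /= !scale0r !addr0 !add0r scale1r -we.
move: (triple_mx a b c) (triple_mx e0 e1 e2) ga go g0 g1 ka ko k0 k1 => g k ga go g0 g1 ka ko k0 k1.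
have kt x : app k^T (app k x) = x by rewrite -app_mulmx (mulmx1C ko) app_1mx.
exists (g *m k^T); split.
- split; first by rewrite unitmx_mul unitmx_tr; case: ga => -> _; case: ka => -> _.
  have kk x : app k (app k^T x) = x by rewrite -app_mulmx ko app_1mx.
  move=> x y; rewrite !app_mulmx -{1}(kk x) -{1}(kk y); case: ka => _ <-; rewrite kt.
  by case: ga => _ ->.
- by rewrite trmx_mul trmxK -mulmxA (mulmxA k^T) (mulmx1C ko) mul1mx.
- by rewrite app_mulmx -k0 kt.
- by rewrite app_mulmx -k1 kt.
Qed.
End NullFrame.

(** * Derivations stabilizing a null flag *)

Section NullDer.
Variable T : numFieldType.
Implicit Types (x y : 'rV[T]_7) (d g Q D : 'M[T]_7).

Definition derN D := forall x y, app D (crossN x y) = crossN (app D x) y + crossN x (app D y).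

Lemma nilmx_derN a1 a2 c4 c3 c2 c1 : derN (nilmx a1 a2 c4 c3 c2 c1).
Proof.
move=> x y; coords x; coords y; rewrite crossN_v7 !app_nilmx !crossN_v7 add_v7; congr v7; ring.
Qed.

Local Notation e0 := (v7 1 0 0 0 0 0 0). Local Notation e1 := (v7 0 1 0 0 0 0 0).
Local Notation e2 := (v7 0 0 1 0 0 0 0). Local Notation e3 := (v7 0 0 0 1 0 0 0).
Local Notation e4 := (v7 0 0 0 0 1 0 0). Local Notation e5 := (v7 0 0 0 0 0 1 0).
Local Notation e6 := (v7 0 0 0 0 0 0 1).

Lemma crossN_basis :
  [/\ [/\ crossN e0 e4 = 2 *: e1 :> 'rV[T]_7, crossN e1 e6 = 2 *: e4 :> 'rV[T]_7 & crossN e0 e6 = (- 2) *: e3 :> 'rV[T]_7],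
      [/\ crossN e3 e6 = - 1 *: e6 :> 'rV[T]_7, crossN e0 e5 = (- 2) *: e2 :> 'rV[T]_7 & crossN e1 e5 = 2 *: e3 :> 'rV[T]_7],
      crossN e2 e6 = (- 2) *: e5 :> 'rV[T]_7 & crossN e1 e2 = (- 2) *: e0 :> 'rV[T]_7].
Proof. by do !split; rewrite crossN_v7 scale_v7; congr v7; ring. Qed.

Lemma v7_inj (a0 a1 a2 a3 a4 a5 a6 b0 b1 b2 b3 b4 b5 b6 : T) :
  v7 a0 a1 a2 a3 a4 a5 a6 = v7 b0 b1 b2 b3 b4 b5 b6 ->
  [/\ [/\ a0 = b0, a1 = b1, a2 = b2 & a3 = b3], a4 = b4, a5 = b5 & a6 = b6].
Proof.
move=> /rowP h; have h0 := h 'o_0; have h1 := h 'o_1; have h2 := h 'o_2; have h3 := h 'o_3.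
have h4 := h 'o_4; have h5 := h 'o_5; have h6 := h 'o_6.
by move: h0 h1 h2 h3 h4 h5 h6; rewrite !mxE.
Qed.

Ltac slv n2 e :=
  apply: (mulfI n2); apply/eqP; rewrite -subr_eq0; apply/eqP;
  match type of e with ?L = ?M =>
    have {}e : L - M = 0; [by apply/eqP; rewrite subr_eq0; apply/eqP |
    first [ by transitivity (L - M); [field | exact: e]
          | by transitivity (- 1 * (L - M)); [field | rewrite e mulr0]
          | by transitivity (2 * (L - M)); [field | rewrite e mulr0]
          | by transitivity (- 2 * (L - M)); [field | rewrite e mulr0] ] ]
  end.

(* A derivation stabilizing the flag [e0, e1] with zero eigenvalue on [e0] is strictly triangular:
   all its entries are determined by the images of [e5] and [e6]. *)
Lemma derN_nilmx D mu : derN D -> app D e0 = 0 -> app D e1 = mu *: e0 ->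
  exists a1 a2 c4 c3 c2 c1, D = nilmx a1 a2 c4 c3 c2 c1.
Proof.
move=> hD D0 D1; have [[b04 b16 b06] [b36 b05 b15] b26 b12] := crossN_basis.
have n2 : 2 != 0 :> T by rewrite pnatr_eq0.
have Z0 : 0 = v7 0 0 0 0 0 0 0 :> 'rV[T]_7 by apply: row7P; rewrite !mxE.
have E04 := hD e0 e4; have E16 := hD e1 e6; have E06 := hD e0 e6; have E36 := hD e3 e6.
have E05 := hD e0 e5; have E15 := hD e1 e5; have E26 := hD e2 e6.
rewrite b04 b16 b06 b36 b05 b15 b26 !appZ D0 D1 in E04 E16 E06 E36 E05 E15 E26.
have D2 := v7_eta (app D e2); have D3 := v7_eta (app D e3); have D4 := v7_eta (app D e4).
have D5 := v7_eta (app D e5); have D6 := v7_eta (app D e6).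
move: D2 D3 D4 D5 D6.
move: (app D e2 0 'o_0) (app D e2 0 'o_1) (app D e2 0 'o_2) (app D e2 0 'o_3) (app D e2 0 'o_4) (app D e2 0 'o_5) (app D e2 0 'o_6) => p0 p1 p2 p3 p4 p5 p6.
move: (app D e3 0 'o_0) (app D e3 0 'o_1) (app D e3 0 'o_2) (app D e3 0 'o_3) (app D e3 0 'o_4) (app D e3 0 'o_5) (app D e3 0 'o_6) => q0 q1 q2 q3 q4 q5 q6.
move: (app D e4 0 'o_0) (app D e4 0 'o_1) (app D e4 0 'o_2) (app D e4 0 'o_3) (app D e4 0 'o_4) (app D e4 0 'o_5) (app D e4 0 'o_6) => y0 y1 y2 y3 y4 y5 y6.
move: (app D e5 0 'o_0) (app D e5 0 'o_1) (app D e5 0 'o_2) (app D e5 0 'o_3) (app D e5 0 'o_4) (app D e5 0 'o_5) (app D e5 0 'o_6) => v0 v1 v2 v3 v4 v5 v6.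
move: (app D e6 0 'o_0) (app D e6 0 'o_1) (app D e6 0 'o_2) (app D e6 0 'o_3) (app D e6 0 'o_4) (app D e6 0 'o_5) (app D e6 0 'o_6) => z0 z1 z2 z3 z4 z5 z6.
move=> D2 D3 D4 D5 D6; rewrite ?D2 ?D3 ?D4 ?D5 ?D6 Z0 !scale_v7 !crossN_v7 !add_v7 in E04 E16 E06 E36 E05 E15 E26.
have [[a040 a041 a042 a043] a044 a045 a046] := v7_inj E04.
have [[a160 a161 a162 a163] a164 a165 a166] := v7_inj E16.
have [[a060 a061 a062 a063] a064 a065 a066] := v7_inj E06.
have [[a360 a361 a362 a363] a364 a365 a366] := v7_inj E36.
have [[a050 a051 a052 a053] a054 a055 a056] := v7_inj E05.
have [[a150 a151 a152 a153] a154 a155 a156] := v7_inj E15.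
have [[a260 a261 a262 a263] a264 a265 a266] := v7_inj E26.
rewrite !(mulr0, mul0r, mulr1, mul1r, addr0, add0r, subr0, sub0r, oppr0) in a040 a041 a042 a043 a044 a045 a046 a160 a161 a162 a163 a164 a165 a166 a060 a061 a062 a063 a064 a065 a066 a360 a361 a362 a363 a364 a365 a366 a050 a051 a052 a053 a054 a055 a056 a150 a151 a152 a153 a154 a155 a156 a260 a261 a262 a263 a264 a265 a266.
clear E04 E16 E06 E36 E05 E15 E26.
(* The coordinates are eliminated by successive substitution; z1, ..., z5 and v4 stay free and
   become the six coefficients. *)
have Xz0 : z0 = 0 by slv n2 a360.
subst z0.
have Xq3 : q3 = 0 by slv n2 a366.
subst q3.
have Xz6 : z6 = 0 by slv n2 a063.
subst z6.
have Xy4 : y4 = 0 by slv n2 a041.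
subst y4.
have Xy5 : y5 = 0 by slv n2 a042.
subst y5.
have Xy6 : y6 = 0 by slv n2 a043.
subst y6.
have Xy3 : y3 = - 2 * mu by slv n2 a040.
subst y3.
have Xmu : mu = - z5 by slv n2 a163.
subst mu.
have Xy0 : y0 = - z2 by slv n2 a160.
subst y0.
have Xy1 : y1 = z3 / 2 by slv n2 a161.
subst y1.
have Xy2 : y2 = 0 by slv n2 a162.
subst y2.
have Xq0 : q0 = z3 / 2 by slv n2 a060.
subst q0.
have Xq1 : q1 = - z4 by slv n2 a061.
subst q1.
have Xq2 : q2 = z5 by slv n2 a062.
subst q2.
have Xq4 : q4 = 0 by slv n2 a064.
subst q4.
have Xq5 : q5 = 0 by slv n2 a065.
subst q5.
have Xq6 : q6 = 0 by slv n2 a066.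
subst q6.
have Xp4 : p4 = 0 by slv n2 a054.
subst p4.
have Xp5 : p5 = 0 by slv n2 a055.
subst p5.
have Xp6 : p6 = 0 by slv n2 a056.
subst p6.
have Xv5 : v5 = 0 by slv n2 a153.
subst v5.
have Xv6 : v6 = 0 by slv n2 a154.
subst v6.
have Xp2 : p2 = 0 by slv n2 a052.
subst p2.
have Xp3 : p3 = 0 by slv n2 a053.
subst p3.
have Xv3 : v3 = - 2 * z4 by slv n2 a151.
subst v3.
have Xp0 : p0 = - z4 by slv n2 a050.
subst p0.
have Xp1 : p1 = - v4 by slv n2 a051.
subst p1.
have Xv2 : v2 = - (z3 / 2) by slv n2 a262.
subst v2.
have Xv0 : v0 = - z1 by slv n2 a260.
subst v0.
have Xv1 : v1 = 0 by slv n2 a261.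
subst v1.

exists z5, v4, z4, (z3 / 2), z2, z1; apply: app_inj => x.
rewrite app_delta_v7 !delta_v7E D0 D1 D2 D3 D4 D5 D6 [in RHS](v7_eta x) app_nilmx.
by rewrite !v7E; apply: row7P; rewrite !mxE /=; field.
Qed.

End NullDer.

(** All roots of the characteristic polynomial vanish, so it is a power of X, and Cayley-Hamilton
    applies. *)
Lemma nilpotent_eigenvalue0 (F : closedFieldType) n (A : 'M[F]_n.+1) :
  (forall a, eigenvalue A a -> a = 0) -> A ^+ n.+1 = 0.
Proof.
move=> h; have [r] := closed_field_poly_normal (char_poly A).
rewrite (monicP (char_poly_monic A)) scale1r => e.
have r0 z : z \in r -> z = 0.
  by move=> zr; apply: h; rewrite eigenvalue_root_char e root_prod_XsubC.
have sr : size r = n.+1.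
  by apply: succn_inj; rewrite -(size_char_poly A) e size_prod_XsubC.
have e' : char_poly A = 'X^(n.+1).
  rewrite e big_seq (eq_bigr (fun=> 'X)) => [|z /r0 ->]; last by rewrite subr0.
  by rewrite -big_seq big_const_seq count_predT sr iter_mulr_1.
by have := Cayley_Hamilton A; rewrite e' rmorphXn /= horner_mx_X.
Qed.

(** * Normal form of nilpotent derivations; ad-nilpotent derivations are nilpotent *)

Section Nilpotent.
Variable T : numClosedFieldType.
Variable I : T.
Hypothesis sqrI : I * I = - 1.
Implicit Types (v w s t x y z : 'rV[T]_7) (d g Q D X Y : 'M[T]_7).

Definition nullframe Q :=
  Q \in unitmx /\ forall x y, cross (app Q x) (app Q y) = app Q (crossN x y).

Lemma nullframe_aut_mul g Q : is_aut g -> nullframe Q -> nullframe (g *m Q).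
Proof.
move=> [u a] [v b]; split; first by rewrite unitmx_mul u.
by move=> x y; rewrite !app_mulmx -a b.
Qed.

Lemma nullframe_null : nullframe (null_mx I).
Proof. by split; [apply: null_unit | apply: cross_null]. Qed.

Lemma nullframe_autN Q G : nullframe Q -> autN G -> nullframe (Q *m G).
Proof.
move=> [u a] [v b]; split; first by rewrite unitmx_mul u.
by move=> x y; rewrite !app_mulmx a b.
Qed.

Lemma nullframe_inv Q x y : nullframe Q ->
  app (invmx Q) (cross x y) = crossN (app (invmx Q) x) (app (invmx Q) y).
Proof.
by move=> [u a]; rewrite -{1}(app_inv x u) -{1}(app_inv y u) a app_invK.
Qed.

Lemma nullframe_aut Q Q' : nullframe Q -> nullframe Q' -> is_aut (Q' *m invmx Q).
Proof.
move=> h [u a]; have [u' _] := h; split; first by rewrite unitmx_mul u unitmx_inv.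
by move=> x y; rewrite !app_mulmx nullframe_inv // a.
Qed.

Lemma nullframe_derN Q d : nullframe Q -> is_der d -> derN (invmx Q *m d *m Q).
Proof.
move=> h hd x y; have [u a] := h.
by rewrite !app_mulmx -a hd appD !nullframe_inv // !app_invK.
Qed.

Lemma nullframe_der Q D : nullframe Q -> derN D -> is_der (Q *m D *m invmx Q).
Proof.
move=> h hD x y; have [u a] := h.
by rewrite !app_mulmx nullframe_inv // hD appD -!a !app_inv.
Qed.

(** Take t orthogonal to v, to a dual vector s and to v × s. Either v × t = 0 and t itself is a
    partner, or v × t is one, since v × (v × t) = 0. Both are orthogonal to s while v is not, which
    gives independence. *)
Lemma null_partner v : v != 0 -> dot v v = 0 -> exists w, (forall k, w != k *: v) /\ cross v w = 0.
Proof.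
move=> v0 vv; have [s vs] := dot_dual v0; pose o := cross v s.
pose A := row_mx (row_mx v^T s^T) o^T.
have : kermx A != 0.
  rewrite kermx_eq0 /row_free neq_ltn; apply/orP; left.
  exact: leq_ltn_trans (rank_leq_col A) _.
case/rowV0Pn => t /sub_kermxP; rewrite !mul_mx_row => /eqP; rewrite row_mx_eq0 row_mx_eq0.
move=> /andP [/andP [/eqP tv /eqP ts] /eqP to] t0.
have {}tv : dot t v = 0 by rewrite /dot tv mxE.
have {}ts : dot t s = 0 by rewrite /dot ts mxE.
have {}to : dot t o = 0 by rewrite /dot to mxE.
have key w : w != 0 -> dot w s = 0 -> forall k, w != k *: v.
  move=> w0 ws k; apply: contraNneq w0 => e; move: ws; rewrite e dotZl vs mulr1 => ->.
  by rewrite scale0r.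
have [vt|vt] := eqVneq (cross v t) 0; first by exists t; split=> //; apply: key.
exists (cross v t); split; last by rewrite cross_crossx vv dotC tv !scale0r subrr.
by apply: key => //; rewrite dot_cross (crossC t) dotNr -dot_cross dotC to oppr0.
Qed.

Lemma app_delta0 D : app D (v7 1 0 0 0 0 0 0) = app D (delta_mx 0 'o_0). Proof. by rewrite delta_v7E. Qed.

(** Let v be the last nonzero iterate of a vector that X does not kill: X kills v, and v is
    isotropic because it is also an image. The annihilator of v is stable under X; iterating a
    vector of it until the step before it falls into the line of v gives w with X w proportional to
    v. The null frame of (v, w) makes X triangular. *)
Lemma nilpotent_der_normal_form X : is_der X -> (exists n, forall x, iter n (app X) x = 0) ->
  exists Q a1 a2 c4 c3 c2 c1, nullframe Q /\ X = Q *m nilmx a1 a2 c4 c3 c2 c1 *m invmx Q.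
Proof.
move=> hX [n hn]; have [X0|X0] := eqVneq X 0.
  exists (null_mx I), 0, 0, 0, 0, 0, 0; split; first exact: nullframe_null.
  have -> : nilmx 0 0 0 0 0 0 = 0 :> 'M[T]_7.
    by apply: app_inj => x; coords x; rewrite app_nilmx app_0mx; apply: row7P; rewrite !mxE /=; ring.
  by rewrite mulmx0 mul0mx.
have [x Xx] : exists x, app X x != 0.
  apply: Classical_Prop.NNPP => h; case/negP: X0; apply/eqP; apply: app_inj => x; rewrite app_0mx.
  by apply/eqP/negPn/negP => hx; apply: h; exists x.
have ex1 : exists k, iter k (app X) x == 0 by exists n; rewrite hn.
have [k /eqP k0 kmin] := ex_minnP ex1.
case: k k0 kmin => [|[|k]] /= k0 kmin.
- by move: Xx; rewrite k0 app0 eqxx.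
- by rewrite k0 eqxx in Xx.
set v := app X (iter k (app X) x).
have v0 : v != 0 by apply/negP => h; have := kmin k.+1 h; rewrite ltnn.
have Xv : app X v = 0 by [].
have vv : dot v v = 0 by rewrite {1}/v der_dot_skew // Xv dot0r oppr0.
have [w0 [w0v cw0]] := null_partner v0 vv.
have ex2 : exists m, (iter m (app X) w0 <= v)%MS by exists n; rewrite hn sub0mx.
have [m mv mmin] := ex_minnP ex2.
case: m mv mmin => [|m] /= mv mmin.
  by case/sub_rVP: mv => l e; move: (w0v l); rewrite e eqxx.
set w := iter m (app X) w0 in mv.
have wv l : w != l *: v.
  apply/negP => /eqP e; have : (iter m (app X) w0 <= v)%MS by apply/sub_rVP; exists l.
  by move=> /mmin; rewrite ltnn.
have cw : cross v w = 0.
  rewrite /w; elim: (m) => //= l ih; have := hX v (iter l (app X) w0).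
  by rewrite ih app0 Xv cross0l add0r.
have [mu Xw] := sub_rVP mv.
have [g [ga go g0 g1]] := null_frame sqrI v0 wv cw.
have hQ := nullframe_aut_mul ga nullframe_null.
have [u _] := hQ; set Q := g *m null_mx I in hQ u.
have Q0 : app Q (v7 1 0 0 0 0 0 0) = v by rewrite app_delta0 app_mulmx.
have Q1 : app Q (v7 0 1 0 0 0 0 0) = w by rewrite -g1 delta_v7E app_mulmx.
clearbody Q.
have [||a1 [a2 [c4 [c3 [c2 [c1 e]]]]]] := derN_nilmx (mu := mu) (nullframe_derN hQ hX).
- by rewrite !app_mulmx Q0 Xv app0.
- by rewrite !app_mulmx Q1 Xw appZ -Q0 app_invK.
exists Q, a1, a2, c4, c3, c2, c1; split=> //; rewrite -e.
by rewrite !mulmxA mulmxV // mul1mx mulmxK.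
Qed.

(** The skew operator v ∧ z. For v the first vector of a null frame and z in the span of the next
    two it is a combination of two long root vectors ([Yop_null]), hence a derivation. *)
Definition Yop v z : 'M[T]_7 := z^T *m v - v^T *m z.

Lemma app_Yop v z t : app (Yop v z) t = dot v t *: z - dot z t *: v.
Proof.
rewrite /app /Yop linearB /= !trmx_mul !trmxK mulmxBr !mulmxA.
by congr (_ - _); rewrite [_ *m _^T]mx11_scalar mul_scalar_mx (dotC _ t) /dot.
Qed.

Lemma lie_Yop X v z : is_der X -> lie X (Yop v z) = Yop (app X v) z + Yop v (app X z).
Proof.
move=> hX; apply: app_inj => t; rewrite app_lie !app_Yop app_addmx !app_Yop !app_lin.
have e1 : dot v (app X t) = - dot (app X v) t by rewrite der_dot_skew // opprK.
have e2 : dot z (app X t) = - dot (app X z) t by rewrite der_dot_skew // opprK.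
rewrite e1 e2; move: (app X v) (app X z) => v' z'.
move: (dot _ _) (dot _ _) (dot _ _) (dot _ _) => p q p' q'.
by apply/rowP => j; rewrite !mxE; ring.
Qed.

Lemma Yop_lin v z z' k l : Yop v (k *: z + l *: z') = k *: Yop v z + l *: Yop v z'.
Proof.
apply: app_inj => t; rewrite app_Yop app_addmx !app_scalemx !app_Yop !dot_lin.
by apply/rowP => j; rewrite !mxE; ring.
Qed.

Lemma Yop_scalel v z k : Yop (k *: v) z = k *: Yop v z.
Proof.
apply: app_inj => t; rewrite app_Yop app_scalemx !app_Yop !dot_lin.
by apply/rowP => j; rewrite !mxE; ring.
Qed.

Lemma Yopvv v : Yop v v = 0.
Proof. by apply: app_inj => t; rewrite app_Yop app_0mx subrr. Qed.

Lemma Yop_null (al be : T) :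
  Yop (app (null_mx I) (v7 1 0 0 0 0 0 0)) (app (null_mx I) (v7 0 al be 0 0 0 0)) *m null_mx I
  = null_mx I *m nilmx 0 0 0 0 (2 * be) (2 * al).
Proof.
apply: app_inj => x; coords x; rewrite !app_mulmx app_nilmx !app_null_mx app_Yop !v7E.
by congr v7; ring: sqrI.
Qed.

Lemma Yop_der g al be : is_aut g -> g *m g^T = 1%:M ->
  is_der (Yop (app (g *m null_mx I) (v7 1 0 0 0 0 0 0)) (app (g *m null_mx I) (v7 0 al be 0 0 0 0))).
Proof.
move=> ga go; have hQ := nullframe_aut_mul ga nullframe_null.
have := nullframe_der hQ (nilmx_derN 0 0 0 0 (2 * be) (2 * al)); have [u _] := hQ.
set Y := Yop _ _; suff <- : Y *m (g *m null_mx I) = g *m null_mx I *m nilmx 0 0 0 0 (2 * be) (2 * al).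
  by rewrite mulmxK.
rewrite -[RHS]mulmxA -Yop_null; apply: app_inj => x.
rewrite (app_mulmx Y) (app_mulmx g (Yop _ _ *m _)) (app_mulmx (Yop _ _)) !app_Yop !(app_mulmx g) !app_lin.
move: (app (null_mx I) x) (app _ (v7 _ _ _ _ _ _ _)) (app _ (v7 _ _ _ _ _ _ _)) => t a b.
have gD p q : dot (app g p) (app g q) = dot p q.
  by rewrite -{1}(trmxK g) dot_app_tr -app_mulmx (mulmx1C go) app_1mx.
by rewrite !gD.
Qed.

(** The eigenvalues of the matrix sum to la. If one of them is -la, the other is 2 la, and la + 2 la
    is nonzero. *)
Lemma eigen2 (p q p' q' la : T) : la != 0 -> p + q' = la ->
  exists al be mu, [/\ (al != 0) || (be != 0), la + mu != 0,
    al * p + be * p' = mu * al & al * q + be * q' = mu * be].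
Proof.
move=> la0 tr.
have [mu [mu0 chi]] : exists mu, la + mu != 0 /\ (mu - p) * (mu - q') = p' * q.
  pose s := sqrtC ((p - q') ^+ 2 + 4 * (p' * q)).
  have s2 : s * s = (p - q') ^+ 2 + 4 * (p' * q) by rewrite -expr2 sqrtCK.
  have chi e : e * e = 1 -> ((la + e * s) / 2 - p) * ((la + e * s) / 2 - q') = p' * q.
    move=> ee; rewrite -tr.
    transitivity ((e * e * (s * s) - (p - q') ^+ 2) / 4); first by field.
    by rewrite ee s2; field.
  have [h|h] := eqVneq (la + (la + 1 * s) / 2) 0; last first.
    by exists ((la + 1 * s) / 2); split=> //; apply: chi; rewrite mulr1.
  exists ((la + - 1 * s) / 2); split; last by apply: chi; rewrite mulrNN mulr1.
  have sE : s = - 3 * la.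
    apply/eqP; rewrite -subr_eq0; apply/eqP; transitivity (2 * (la + (la + 1 * s) / 2)); first by field.
    by rewrite h mulr0.
  have -> : la + (la + -1 * s) / 2 = 3 * la by rewrite sE; field.
  by rewrite mulf_neq0 // pnatr_eq0.
have [h1|h1] := boolP ((p' != 0) || (mu - p != 0)).
  exists p', (mu - p), mu; split=> //; first by ring.
  apply/eqP; rewrite -subr_eq0; apply/eqP.
  by transitivity (p' * q - (mu - p) * (mu - q')); [ring | rewrite chi subrr].
have [h2|h2] := boolP ((mu - q' != 0) || (q != 0)).
  exists (mu - q'), q, mu; split=> //; last by ring.
  apply/eqP; rewrite -subr_eq0; apply/eqP.
  by transitivity (p' * q - (mu - p) * (mu - q')); [ring | rewrite chi subrr].
exists 1, 0, mu; split=> //; first by rewrite oner_neq0.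
- move: h1; rewrite negb_or !negbK => /andP [_ /eqP h].
  by apply/eqP; rewrite -subr_eq0; apply/eqP; transitivity (- (mu - p)); [ring | rewrite h oppr0].
- by move: h2; rewrite negb_or !negbK => /andP [_ /eqP ->]; ring.
Qed.

(* If [v] were an eigenvector for [la <> 0], it would be null, and [ad X] would act on the operators
   [Yop v z], for [z] in the annihilator of [v], with trace [3 * la]. *)
Lemma adnilpotent_eigenvalue0 X la v : is_der X ->
  (exists n, forall Y, is_der Y -> iter n (lie X) Y = 0) ->
  v != 0 -> app X v = la *: v -> la = 0.
Proof.
move=> hX [n hn] v0 Xv; apply/eqP/negPn/negP => la0.
have vv : dot v v = 0.
  have := der_dotxx v hX; rewrite Xv dotZr => /eqP.
  by rewrite mulf_eq0 (negPf la0) => /eqP.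
have [w [wv cw]] := null_partner v0 vv.
have [g [ga go g0 g1]] := null_frame sqrI v0 wv cw.
have hQ := nullframe_aut_mul ga nullframe_null; have hY := Yop_der _ _ ga go.
move: hQ hY (app_mulmx g (null_mx I) (v7 1 0 0 0 0 0 0)); rewrite -delta_v7E g0.
move: (g *m null_mx I) => Q hQ hY Q0; rewrite delta_v7E in Q0.
have [u a] := hQ; have hD := nullframe_derN hQ hX.
set D := invmx Q *m X *m Q in hD.
have QD x : app X (app Q x) = app Q (app D x) by rewrite /D !app_mulmx app_inv.
have D0 : app D (v7 1 0 0 0 0 0 0) = la *: v7 1 0 0 0 0 0 0.
  by rewrite /D !app_mulmx Q0 Xv appZ -Q0 app_invK.
clearbody D.
have F (y0 y1 y2 y3 y4 y5 y6 : T) : crossN (v7 1 0 0 0 0 0 0) (v7 y0 y1 y2 y3 y4 y5 y6) = 0 ->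
    [/\ y3 = 0, y4 = 0, y5 = 0 & y6 = 0].
  have n2 : 2 != 0 :> T by rewrite pnatr_eq0.
  have -> : 0 = v7 0 0 0 0 0 0 0 :> 'rV[T]_7 by apply: row7P; rewrite !mxE.
  rewrite crossN_v7 => /v7_inj [[h0 h1 h2 h3] _ _ _].
  split; [| apply: (mulfI n2) | apply: (mulfI n2) | apply: (mulfI n2)]; rewrite ?mulr0.
  - by apply: oppr_inj; rewrite oppr0 -h0; ring.
  - by rewrite -h1; ring.
  - by apply: oppr_inj; rewrite oppr0 -h2; ring.
  - by apply: oppr_inj; rewrite oppr0 -h3; ring.
have Z1 : crossN (v7 1 0 0 0 0 0 0) (v7 0 1 0 0 0 0 0) = 0 :> 'rV[T]_7 by rewrite crossN_v7; apply: row7P; rewrite !mxE /=; ring.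
have Z2 : crossN (v7 1 0 0 0 0 0 0) (v7 0 0 1 0 0 0 0) = 0 :> 'rV[T]_7 by rewrite crossN_v7; apply: row7P; rewrite !mxE /=; ring.
have sc (k : T) : k *: v7 1 0 0 0 0 0 0 = v7 k 0 0 0 0 0 0 by rewrite scale_v7; congr v7; ring.
have cs (k : T) y : crossN (v7 k 0 0 0 0 0 0) y = k *: crossN (v7 1 0 0 0 0 0 0) y.
  by coords y; rewrite !crossN_v7 scale_v7; congr v7; ring.
(* In the null frame e0 × e1 = 0 and e0 × e2 = 0 make <e0, e1, e2> stable under D, and e1 × e2 = -2
   e0 shows that the trace on its quotient by e0 is la. *)
have E1 := hD (v7 1 0 0 0 0 0 0) (v7 0 1 0 0 0 0 0).
have E2 := hD (v7 1 0 0 0 0 0 0) (v7 0 0 1 0 0 0 0).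
have E3 := hD (v7 0 1 0 0 0 0 0) (v7 0 0 1 0 0 0 0).
have [_ _ _ b12] := crossN_basis T.
rewrite b12 appZ D0 sc in E3; rewrite Z1 app0 D0 sc cs Z1 scaler0 add0r in E1.
rewrite Z2 app0 D0 sc cs Z2 scaler0 add0r in E2.
move: E1 E2 E3 (v7_eta (app D (v7 0 1 0 0 0 0 0))) (v7_eta (app D (v7 0 0 1 0 0 0 0))).
move: (app D (v7 0 1 0 0 0 0 0) 0 _) (app D (v7 0 1 0 0 0 0 0) 0 _) (app D (v7 0 1 0 0 0 0 0) 0 _) (app D (v7 0 1 0 0 0 0 0) 0 _)
   (app D (v7 0 1 0 0 0 0 0) 0 _) (app D (v7 0 1 0 0 0 0 0) 0 _) (app D (v7 0 1 0 0 0 0 0) 0 _) => y6 y5 y4 y3 q p r.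
move: (app D (v7 0 0 1 0 0 0 0) 0 _) (app D (v7 0 0 1 0 0 0 0) 0 _) (app D (v7 0 0 1 0 0 0 0) 0 _) (app D (v7 0 0 1 0 0 0 0) 0 _)
   (app D (v7 0 0 1 0 0 0 0) 0 _) (app D (v7 0 0 1 0 0 0 0) 0 _) (app D (v7 0 0 1 0 0 0 0) 0 _) => z6 z5 z4 z3 q' p' r'.
move=> + + + D1 D2; rewrite D1 D2 => /esym /F [h3 h4 h5 h6] /esym /F [k3 k4 k5 k6].
subst y3 y4 y5 y6 z3 z4 z5 z6.
rewrite !crossN_v7 add_v7 scale_v7 => /v7_inj [[tr _ _ _] _ _ _].
have {}tr : p + q' = la.
  apply: (mulfI (_ : 2 != 0)); first by rewrite pnatr_eq0.
  by apply: oppr_inj; transitivity (- 2 * la); [rewrite tr; ring | ring].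
have [al [be [mu [ab mu0 e1 e2]]]] := eigen2 q p' la0 tr.
pose z := v7 0 al be 0 0 0 0; pose Y := Yop v (app Q z).
have Xz : app X (app Q z) = mu *: app Q z + (al * r + be * r') *: v.
  rewrite QD -Q0 -!appZ -appD; congr app.
  have -> : z = al *: v7 0 1 0 0 0 0 0 + be *: v7 0 0 1 0 0 0 0 by rewrite /z !v7E; congr v7; ring.
  by rewrite !app_lin D1 D2 !v7E; congr v7; rewrite ?e1 ?e2; ring.
have XY : lie X Y = (la + mu) *: Y.
  rewrite lie_Yop // Xv Xz Yop_scalel Yop_lin Yopvv scaler0 addr0 -scalerDl //.
have hY' : is_der Y by have := hY al be; rewrite -delta_v7E in Q0 *; rewrite Q0.
have iterY k : iter k (lie X) Y = (la + mu) ^+ k *: Y.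
  elim: k => [|k ih]; first by rewrite scale1r.
  by rewrite iterS ih lieZr XY scalerA exprSr.
have := hn Y hY'; rewrite iterY => /eqP; rewrite scaler_eq0 expf_eq0 (negPf mu0) andbF /= => /eqP Y0.
have [t vt] := dot_dual v0.
have := app_Yop v (app Q z) t; rewrite -/Y Y0 app_0mx vt scale1r => /esym/eqP.
rewrite subr_eq0 -[X in _ *: X]Q0 -appZ => /eqP /(congr1 (app (invmx Q))); rewrite !app_invK // /z scale_v7.
move/v7_inj => [[_ z1 z2 _] _ _ _].
by move: ab; rewrite z1 z2 !mulr0 eqxx.
Qed.

(** The nilpotent variety is defined through ad on g2 and the normal form through the action on
    vectors; the absence of nonzero eigenvalues connects the two. *)
Lemma adnilpotent_nilpotent X : is_der X ->
  (exists n, forall Y, is_der Y -> iter n (lie X) Y = 0) -> exists n, forall x, iter n (app X) x = 0.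
Proof.
move=> hX hn; exists 7%N => x.
have h : (X^T : 'M[T]_7) ^+ 7 = 0.
  apply: nilpotent_eigenvalue0 => la /eigenvalueP [v e v0].
  exact: (adnilpotent_eigenvalue0 hX hn v0 e).
have P k : iter k (app X) x = x *m (X^T : 'M[T]_7) ^+ k.
  elim: k => [|k ih]; first by rewrite expr0 mulmx1.
  by rewrite iterS ih /app exprSr mulmxA.
by rewrite P h mulmx0.
Qed.
End Nilpotent.

(** * Principal nilpotent elements *)

Section Abstract.
Variable T : numClosedFieldType.
Variable I : T.
Hypothesis sqrI : I * I = - 1.
Implicit Types (X Y Q G : 'M[T]_7).

Lemma autN_inv G : autN G -> autN (invmx G).
Proof.
move=> [u a]; split; first by rewrite unitmx_inv.
by move=> x y; rewrite -{1}(app_inv x u) -{1}(app_inv y u) -a app_invK.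
Qed.

Lemma nilmx_std Q a1 a2 c4 c3 c2 c1 : nullframe Q -> a1 != 0 -> a2 != 0 ->
  exists Q', nullframe Q' /\ Q *m nilmx a1 a2 c4 c3 c2 c1 *m invmx Q = Q' *m nilmx 1 1 0 0 0 0 *m invmx Q'.
Proof.
move=> hQ a10 a20; have [G [hG e]] := nilmx_conj c4 c3 c2 c1 a10 a20.
have [uG _] := hG; have [uQ _] := hQ.
exists (Q *m invmx G); split; first exact: nullframe_autN hQ (autN_inv hG).
rewrite invmx_mulE ?unitmx_inv // invmxK -!mulmxA; congr (_ *m _).
by rewrite (mulmxA _ G) -e -!mulmxA mulKmx.
Qed.

Lemma std_conj Q Q' Y : nullframe Q -> nullframe Q' ->
  exists g, is_aut g /\ g *m (Q *m Y *m invmx Q) *m invmx g = Q' *m Y *m invmx Q'.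
Proof.
move=> h h'; exists (Q' *m invmx Q); split; first exact: nullframe_aut.
by have [u _] := h; have [u' _] := h'; rewrite conj_mul.
Qed.

(** X^a (ad X)^n(Y) X^b vanishes once a + b + n reaches 2m, since each ad contributes one more
    factor X on the left or on the right. *)
Lemma adnilpotent_mx X m : X ^+ m = 0 -> forall Y, iter (m + m) (lie X) Y = 0.
Proof.
move=> h Y; have H a : (m <= a)%N -> X ^+ a = 0 by move=> /subnK <-; rewrite exprD h mulr0.
have P n a b : (m + m <= a + b + n)%N -> X ^+ a *m iter n (lie X) Y *m X ^+ b = 0.
  elim: n a b => [|n ih] a b hab.
    have [ha|hb] : (m <= a)%N \/ (m <= b)%N by case: (leqP m a) => ?; [left | right; lia].
      by rewrite H // mul0mx mul0mx.
    by rewrite (H b) // mulmx0.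
  have e1 : X ^+ a *m X *m iter n (lie X) Y *m X ^+ b = 0.
    by have := ih a.+1 b; rewrite exprSr; apply; lia.
  have e2 : X ^+ a *m iter n (lie X) Y *m (X *m X ^+ b) = 0.
    by have := ih a b.+1; rewrite exprS; apply; lia.
  rewrite iterS [lie X _]/(_ - _) mulmxBr mulmxBl !mulmxA e1 sub0r -!mulmxA.
  by rewrite !mulmxA in e2 *; rewrite e2 oppr0.
by have := P (m + m)%N 0%N 0%N; rewrite expr0 !(mul1mx, mulmx1); apply.
Qed.

Lemma nilmx_exp6 : exists i j, ((nilmx 1 1 0 0 0 0 : 'M[T]_7) ^+ 6) i j != 0.
Proof.
pose N : 'M[T]_7 := nilmx 1 1 0 0 0 0; exists 'o_0, 'o_6.
have -> : (N ^+ 6) 'o_0 'o_6 = app (N ^+ 6) (delta_mx 0 'o_6) 0 'o_0 by rewrite app_delta.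
rewrite !exprS expr0 -!mulmxE !app_mulmx app_1mx delta_v7E !app_nilmx mxE /=.
set z := (X in X != 0); have -> : z = 2 by rewrite /z; ring.
by rewrite pnatr_eq0.
Qed.

Lemma nilmx_exp7 a1 a2 c4 c3 c2 c1 : (nilmx a1 a2 c4 c3 c2 c1 : 'M[T]_7) ^+ 7 = 0.
Proof.
apply: app_inj => x; coords x; rewrite !exprS expr0 -!mulmxE !app_mulmx app_1mx !app_nilmx app_0mx.
apply: row7P; rewrite !mxE /=; ring.
Qed.

Lemma nilmx_diff Q b1 b2 a1 a2 c4 c3 c2 c1 :
  Q *m nilmx b1 b2 c4 c3 c2 c1 *m invmx Q - Q *m nilmx a1 a2 c4 c3 c2 c1 *m invmx Q
  = (b1 - a1) *: (Q *m nilmx 1 0 0 0 0 0 *m invmx Q) + (b2 - a2) *: (Q *m nilmx 0 1 0 0 0 0 *m invmx Q).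
Proof.
rewrite -mulmxBl -mulmxBr; have -> : nilmx b1 b2 c4 c3 c2 c1 - nilmx a1 a2 c4 c3 c2 c1
  = (b1 - a1) *: nilmx 1 0 0 0 0 0 + (b2 - a2) *: nilmx 0 1 0 0 0 0.
  by apply: app_inj => x; coords x; rewrite !app_addmx app_oppmx !app_scalemx !app_nilmx !v7E; congr v7; ring.
by rewrite mulmxDr mulmxDl -!scalemxAr -!scalemxAl.
Qed.

(** Under ad x, y splits into parts of eigenvalue I and -I; y - I [x,y] is twice the first part,
    which consists of the two simple root vectors. *)
Lemma principal_null_comb (t r : T) (u : 'rV[T]_7) :
  let x := Mx 1 2 0 0 0 0 0 0 in let y := Mx 0 0 0 0 t r 0 0 in let v := app (null_mx I) u in
  app y v - I *: (app x (app y v) - app y (app x v))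
  = app (null_mx I) (app (nilmx (2 * I * r) (- 2 * I * t) 0 0 0 0) u).
Proof.
move=> x y v; rewrite /x /y /v {x y v}; coords u; rewrite !(app_null_mx, app_Mx, app_nilmx, v7E); congr v7; ring: sqrI.
Qed.
(** Only a zero among a1, a2 is moved, by eps / M, where M exceeds the entries of both simple root
    matrices together; the summand 1 keeps M positive and the bound strict. *)
Lemma nilmx_perturb Q a1 a2 c4 c3 c2 c1 (eps : T) : 0 < eps ->
  exists b1 b2, [/\ b1 != 0, b2 != 0 & forall i j,
   `|(Q *m nilmx b1 b2 c4 c3 c2 c1 *m invmx Q - Q *m nilmx a1 a2 c4 c3 c2 c1 *m invmx Q) i j| < eps].
Proof.
move=> e0; pose N1 := Q *m nilmx 1 0 0 0 0 0 *m invmx Q; pose N2 := Q *m nilmx 0 1 0 0 0 0 *m invmx Q.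
pose M := 1 + \sum_i \sum_j (`|N1 i j| + `|N2 i j|).
have M0 : 0 < M.
  by rewrite ltr_wpDr // sumr_ge0 // => i _; rewrite sumr_ge0 // => j _; rewrite addr_ge0.
pose de := eps / M; have de0 : 0 < de by rewrite divr_gt0.
have pick (a : T) : exists b, b != 0 /\ `|b - a| <= de.
  have [->|a0] := eqVneq a 0; last by exists a; rewrite subrr normr0 ltW.
  by exists de; rewrite gt_eqF // subr0 gtr0_norm.
have [b1 [b10 h1]] := pick a1; have [b2 [b20 h2]] := pick a2.
exists b1, b2; split=> // i j.
rewrite nilmx_diff.
rewrite [X in `|X|]mxE [X in `|X + _|]mxE [X in `|_ + X|]mxE.
apply: (le_lt_trans (ler_normD _ _)); rewrite !normrM.
apply: (@le_lt_trans _ _ (de * (`|N1 i j| + `|N2 i j|))).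
  by rewrite mulrDr lerD // ler_wpM2r.
apply: (@lt_le_trans _ _ (de * M)); last by rewrite /de divfK // gt_eqF.
rewrite ltr_pM2l //; have h : `|N1 i j| + `|N2 i j| <= \sum_i \sum_j (`|N1 i j| + `|N2 i j|).
  rewrite (bigD1 i) //= (bigD1 j) //= -addrA lerDl addr_ge0 //.
    by rewrite sumr_ge0 // => l _; rewrite addr_ge0.
  by rewrite sumr_ge0 // => l _; rewrite sumr_ge0 // => l' _; rewrite addr_ge0.
by apply: (le_lt_trans h); rewrite /M ltrDr.
Qed.

End Abstract.

Section Density.
Variable R : realType.
Local Notation C := (complex R).
(** With this sign y - I [x,y] is the element y + i [x,y] of [principal_pair]. *)
Local Notation I := (- 'i%C : C).
Implicit Types (X Y Q A B : 'M[C]_7).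

Lemma sqrI : I * I = - 1.
Proof. by rewrite mulrNN -expr2 sqr_i. Qed.

Lemma nilvarC_normal_form X : nilvarC X ->
  exists Q a1 a2 c4 c3 c2 c1, nullframe Q /\ X = Q *m nilmx a1 a2 c4 c3 c2 c1 *m invmx Q.
Proof.
by move=> [hX hn]; apply: (nilpotent_der_normal_form sqrI hX); apply: (adnilpotent_nilpotent sqrI hX hn).
Qed.

Lemma nullframe_nilvarC Q a1 a2 c4 c3 c2 c1 : nullframe Q ->
  nilvarC (Q *m nilmx a1 a2 c4 c3 c2 c1 *m invmx Q).
Proof.
move=> hQ; have [u _] := hQ; split; first exact: (nullframe_der hQ (nilmx_derN _ _ _ _ _ _)).
exists (7 + 7)%N => Y _; rewrite -(conj_invmx Y u) iter_lie_conj //.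
by rewrite (adnilpotent_mx (nilmx_exp7 _ _ _ _ _ _)) mulmx0 mul0mx.
Qed.

Lemma nullframe_principal Q a1 a2 c4 c3 c2 c1 : nullframe Q -> a1 != 0 -> a2 != 0 ->
  principal_nilpotent (Q *m nilmx a1 a2 c4 c3 c2 c1 *m invmx Q).
Proof.
move=> hQ a10 a20; split; first exact: nullframe_nilvarC.
move=> X /nilvarC_normal_form [Q' [d1 [d2 [d4 [d3 [e2 [e1 [hQ' ->]]]]]]]] eps eps0.
have epsC : 0 < (eps%:C)%C :> C by rewrite ltcR.
have [b1 [b2 [b10 b20 hb]]] := nilmx_perturb Q' d1 d2 d4 d3 e2 e1 epsC.
have [P [hP eP]] := nilmx_std c4 c3 c2 c1 hQ a10 a20.
have [P' [hP' eP']] := nilmx_std d4 d3 e2 e1 hQ' b10 b20.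
have [g [ga eg]] := std_conj (nilmx 1 1 0 0 0 0) hP hP'.
exists g; split; first exact: ga.
move=> i j; rewrite eP eg -eP'; have := hb i j.
by rewrite [X in `|X|]mxE [X in `|_ + X|]mxE.
Qed.
End Density.

Lemma map_Mx (S T : comNzRingType) (f : {rmorphism S -> T}) (a b t1 t2 t3 r1 r2 r3 : S) :
  map_mx f (Mx a b t1 t2 t3 r1 r2 r3) = Mx (f a) (f b) (f t1) (f t2) (f t3) (f r1) (f r2) (f r3).
Proof.
apply/matrixP; elim/ord7_ind; elim/ord7_ind; do 3!rewrite ?mxE /=;
  by rewrite ?(rmorph0, rmorphD, rmorphN, rmorphM, rmorph1).
Qed.

Lemma principal_comb (T : numClosedFieldType) (I t r : T) : I * I = - 1 ->
  Mx 0 0 0 0 t r 0 0 - I *: lie (Mx 1 2 0 0 0 0 0 0) (Mx 0 0 0 0 t r 0 0)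
  = null_mx I *m nilmx (2 * I * r) (- 2 * I * t) 0 0 0 0 *m invmx (null_mx I).
Proof.
move=> hI; have [u _] := nullframe_null hI.
apply: app_inj => x; rewrite -(app_inv x u) !app_mulmx app_invK //.
rewrite -(principal_null_comb hI) -scaleNr app_addmx app_scalemx app_lie scaleNr //.
Qed.

Section PrincipalPair.
Variable R : realType.
Local Notation C := (complex R).
Local Notation rc := (real_complex R).

Lemma principal_pair_nilpotent (t r : R) : t != 0 -> r != 0 ->
  principal_nilpotent (complexify (Mx 0 0 0 0 t r 0 0) (lie (Mx 1 2 0 0 0 0 0 0) (Mx 0 0 0 0 t r 0 0))).
Proof.
move=> t0 r0; rewrite complexifyE map_lie !map_Mx !rmorph0 rmorph1 rmorph_nat.
rewrite -[X in _ + X *: _](opprK 'i%C) scaleNr (principal_comb _ _ (sqrI R)).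
have [t0' r0'] : rc t != 0 /\ rc r != 0 by rewrite !fmorph_eq0.
have hI := sqrI R; have hQ := nullframe_null hI; move: hI hQ; move: (- 'i%C) => I hI hQ.
have I0 : I != 0 by apply/eqP => h; move: hI; rewrite h mul0r => /eqP; rewrite eq_sym oppr_eq0 oner_eq0.
by apply: (nullframe_principal _ _ _ _ hQ); apply: mulf_neq0 => //; apply: mulf_neq0 => //; rewrite ?oppr_eq0 pnatr_eq0.
Qed.

End PrincipalPair.

(** * Continuity of matrix powers and the sixth power of a principal element *)

Section Bounded.
Variable T : numDomainType.
Implicit Types (A B : 'M[T]_7).

Definition entry_le A a := forall i j, `|A i j| <= a.

Lemma entry_le_mul A B a b : entry_le A a -> entry_le B b -> entry_le (A *m B) (7 * (a * b)).
Proof.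
move=> hA hB i j; rewrite mxE sum7.
have h k : `|A i k * B k j| <= a * b by rewrite normrM ler_pM.
have -> : 7 * (a * b) = a * b + a * b + a * b + a * b + a * b + a * b + a * b by ring.
by do 6!(apply: (le_trans (ler_normD _ _)); apply: lerD => //).
Qed.

Lemma entry_le_add A B a b : entry_le A a -> entry_le B b -> entry_le (A + B) (a + b).
Proof. by move=> hA hB i j; rewrite mxE (le_trans (ler_normD _ _)) // lerD. Qed.

Lemma entry_bound A : exists2 a, 0 <= a & entry_le A a.
Proof.
exists (\sum_i \sum_j `|A i j|); first by rewrite sumr_ge0 // => i _; rewrite sumr_ge0.
move=> i j; rewrite (bigD1 i) //= (bigD1 j) //= -addrA lerDl addr_ge0 //; first by rewrite sumr_ge0.
by rewrite sumr_ge0 // => l _; rewrite sumr_ge0.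
Qed.

(** Induction on A^(k+1) - B^(k+1) = A (A^k - B^k) + (A - B) B^k; the restriction eps <= 1 bounds
    the entries of A by those of B plus 1, so that K does not depend on A. *)
Lemma exp_lipschitz B k : exists2 K, 0 <= K &
  forall A eps, eps <= 1 -> entry_le (A - B) eps -> entry_le (A ^+ k - B ^+ k) (eps * K).
Proof.
have [M M0 hM] := entry_bound B.
elim: k => [|k [K K0 ih]].
  by exists 0 => // A eps *; rewrite !expr0 subrr mulr0 => i j; rewrite mxE normr0.
have [L L0 hL] := entry_bound (B ^+ k).
exists (7 * ((M + 1) * K) + 7 * L); first by rewrite addr_ge0 // !mulr_ge0 // addr_ge0.
move=> A eps e1 h.
have hA : entry_le A (M + 1).
  rewrite -[A](subrK B) addrC; apply: entry_le_add => // i j; exact: le_trans (h i j) e1.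
have -> : A ^+ k.+1 - B ^+ k.+1 = A *m (A ^+ k - B ^+ k) + (A - B) *m B ^+ k.
  by rewrite !exprS -!mulmxE mulmxBr mulmxBl addrA subrK.
have -> : eps * (7 * ((M + 1) * K) + 7 * L) = 7 * ((M + 1) * (eps * K)) + 7 * (eps * L) by ring.
by apply: entry_le_add; apply: entry_le_mul => //; apply: ih.
Qed.

Lemma conj_exp (g e : 'M[T]_7) h k : h *m g = 1%:M -> g *m h = 1%:M -> (g *m e *m h) ^+ k = g *m e ^+ k *m h.
Proof.
move=> u v; elim: k => [|k ih]; first by rewrite !expr0 mulmx1 v.
by rewrite !exprS ih -!mulmxE !mulmxA -(mulmxA _ h g) u mulmx1.
Qed.
End Bounded.

Lemma near_exp (T : numFieldType) (X : 'M[T]_7) k i j : (X ^+ k) i j != 0 ->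
  exists2 eps, 0 < eps & forall Y : 'M[T]_7, (forall i j, `|Y i j - X i j| < eps) -> Y ^+ k != 0.
Proof.
rewrite -normr_gt0 => r0; have [K K0 hK] := exp_lipschitz X k.
set r := `|_| in r0 *; have d0 : 0 < r + (K + 1) by rewrite addr_gt0 // ltr_wpDl.
(* This radius is at most 1, as [exp_lipschitz] requires, and its product with K stays below r. *)
exists (r / (r + (K + 1))); first by rewrite divr_gt0.
move=> Y hY; apply/eqP => Y0.
have : entry_le (Y ^+ k - X ^+ k) (r / (r + (K + 1)) * K).
  apply: hK => [|i' j']; last by rewrite !mxE ltW.
  by rewrite ler_pdivrMr // mul1r lerDl addr_ge0.
move/(_ i j); rewrite Y0 sub0r mxE normrN -/r; apply/negP.
rewrite -real_ltNge ?ger0_real ?mulr_ge0 ?divr_ge0 ?invr_ge0 ?(ltW r0) ?(ltW d0) //.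
rewrite mulrAC ltr_pdivrMr // ltr_pM2l // addrCA ltrDl addr_gt0 //.
Qed.

Lemma nullframe_exp6 (T : numClosedFieldType) (Q : 'M[T]_7) : nullframe Q ->
  exists i j, ((Q *m nilmx 1 1 0 0 0 0 *m invmx Q) ^+ 6) i j != 0.
Proof.
case=> u _; apply: Classical_Prop.NNPP => h.
have : (Q *m nilmx 1 1 0 0 0 0 *m invmx Q) ^+ 6 = 0.
  apply/matrixP => i j; rewrite [RHS]mxE.
  by apply/eqP; apply: Classical_Prop.NNPP => hij; apply: h; exists i, j; apply/negP.
rewrite conj_exp; [|exact: mulVmx|exact: mulmxV] => {}h.
have [i [j /eqP]] := nilmx_exp6 T; apply.
by rewrite -[_ ^+ 6](mulKmx u) -[_ *m _ ^+ 6](mulmxKV u) h mul0mx mulmx0 mxE.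
Qed.

Section PrincipalPower.
Variable R : realType.
Local Notation C := (complex R).

Lemma principal_exp6 (e : 'M[C]_7) : principal_nilpotent e -> e ^+ 6 != 0.
Proof.
case=> _ dense; apply/eqP => e6.
have hI := sqrI R; have hQ := nullframe_null hI.
have hX := nullframe_nilvarC 1 1 0 0 0 0 hQ.
have [i [j hij]] := nullframe_exp6 hQ; move: (_ *m _ *m _) hX hij => X hX hij.
have [eps eps0 hY] := near_exp hij.
(* A positive element of the complex numbers is real, so the radius can be used as tolerance in the
   density condition. *)
have [r er] : exists r : R, eps = (r%:C)%C.
  by move: (ltW eps0) => /ger0_Im; case: (eps) => a b /= ->; exists a.
have r0 : 0 < r by rewrite -ltcR -er.
have [g [[ug _] hg]] := dense X hX r r0; rewrite -er in hg.
have := hY _ hg.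
by rewrite conj_exp ?mulVmx ?mulmxV // e6 mulmx0 mul0mx eqxx.
Qed.
End PrincipalPower.

(** * Linear dependence, and matrices for subspaces given by predicates *)

Section Dependence.
Variable F : fieldType.

Lemma dependent_in_small_space m n (h : 'M[F]_(m, 7 * 7)) (A : 'I_n -> 'M[F]_7) :
  (\rank h < n)%N -> (forall i, (mxvec (A i) <= h)%MS) ->
  exists2 c : 'rV[F]_n, c != 0 & \sum_i c 0 i *: A i = 0.
Proof.
move=> hn hA; pose M := \matrix_(i < n) mxvec (A i).
have Mh : (M <= h)%MS by apply/row_subP => i; rewrite rowK.
have : kermx M != 0.
  rewrite kermx_eq0; apply: contraTneq hn => <-; rewrite -leqNgt; exact: mxrankS.
case/rowV0Pn => c /sub_kermxP cM c0; exists c => //.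
apply: (can_inj mxvecK); rewrite linear0 linear_sum -[RHS]cM mulmx_sum_row.
by apply: eq_bigr => i _; rewrite linearZ /= rowK.
Qed.

Lemma dependent_in_plane n (x y : 'M[F]_7) (A : 'I_n -> 'M[F]_7) : (2 < n)%N ->
  (forall i, exists a b, A i = a *: x + b *: y) ->
  exists2 c : 'rV[F]_n, c != 0 & \sum_i c 0 i *: A i = 0.
Proof.
move=> hn hA; apply: (@dependent_in_small_space _ _ (col_mx (mxvec x) (mxvec y))).
  by apply: leq_ltn_trans hn; apply: rank_leq_row.
move=> i; have [a [b ->]] := hA i.
rewrite linearD !linearZ -addsmxE addmx_sub_adds ?scalemx_sub ?submx_refl //.
Qed.

(** Among the matrices whose row space lies in P take one of maximal rank; an element of P outside
    its row space would raise the rank. *)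
Lemma subspace_mx (P : 'M[F]_7 -> Prop) : subsp P ->
  exists S : 'M[F]_(7 * 7), forall A, (mxvec A <= S)%MS <-> P A.
Proof.
move=> hP; pose ok (S : 'M[F]_(7 * 7)) := forall A, (mxvec A <= S)%MS -> P A.
pose Q r := exists S : 'M[F]_(7 * 7), ok S /\ (r <= \rank S)%N.
have [r [hr hr']] : exists r, Q r /\ ~ Q r.+1.
  apply: Classical_Prop.NNPP => h.
  have hQ r : Q r.
    elim: r => [|r ih]; last by apply: Classical_Prop.NNPP => hn; apply: h; exists r.
    exists 0; split=> // A; rewrite submx0 => /eqP e; have -> : A = 0; last by case: hP.
    by apply: (can_inj mxvecK); rewrite e linear0.
  have [S [_]] := hQ (7 * 7).+1; apply/negP; rewrite -ltnNge ltnS; exact: rank_leq_row.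
have [S [hS hrS]] := hr; exists S => A; split; first exact: hS.
move=> hA; apply/negPn/negP => nA; apply: hr'; exists (S + mxvec A)%MS; split.
  move=> B /sub_addsmxP [[u v] /= e].
  have -> : B = vec_mx (u *m S) + v 0 0 *: A.
    apply: (can_inj mxvecK); rewrite e linearD linearZ /= vec_mxK; congr (_ + _).
    by rewrite {1}[v]mx11_scalar mul_scalar_mx.
  rewrite addrC; case: (hP) => _; apply=> //; apply: hS; rewrite vec_mxK; exact: submxMl.
apply: leq_ltn_trans hrS _; rewrite (ltn_leqif (mxrank_leqif_sup (addsmxSl S (mxvec A)))).
by apply: contra nA; apply: submx_trans; apply: addsmxSr.
Qed.
End Dependence.

(** * Comparison of the listed subsystems *)

Section StdContainment.
Variable R : realType.
Implicit Types (x y u v w l : 'rV[R]_7) (A d : 'M[R]_7) (P : 'M[R]_7 -> Prop).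

Lemma Mx_inj0 (a b t1 t2 t3 r1 r2 r3 : R) : Mx a b t1 t2 t3 r1 r2 r3 = 0 ->
  [/\ a = 0, b = 0, t1 = 0, t2 = 0 & [/\ t3 = 0, r1 = 0, r2 = 0 & r3 = 0]].
Proof.
move=> h; have e (k : 'I_7) (i : 'I_7) : app (Mx a b t1 t2 t3 r1 r2 r3) (delta_mx 0 i) 0 k = 0.
  by rewrite h app_0mx mxE.
have {h} := (e 'o_1 'o_0, e 'o_3 'o_0, e 'o_4 'o_0, e 'o_5 'o_0, e 'o_1 'o_2, e 'o_3 'o_2, e 'o_4 'o_2, e 'o_5 'o_2, e 'o_3 'o_6).
rewrite !delta_v7E !app_Mx !mxE /= => -[[[[[[[[]]]]]]]] *.
by split; last split; lra.
Qed.

Lemma small_not_in_plane P (x y A B E : 'M[R]_7) : (forall d, P d -> exists a b, d = a *: x + b *: y) ->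
  P A -> P B -> P E -> exists a b c, (a <> 0 \/ b <> 0 \/ c <> 0) /\ a *: A + b *: B + c *: E = 0.
Proof.
move=> h hA hB hE; pose F (i : 'I_3) := nth 0 [:: A; B; E] i.
have [|c c0] := @dependent_in_plane _ 3 x y F isT.
  by move=> i; apply: h; rewrite /F; case: i => [[|[|[|//]]] hi].
rewrite !big_ord_recl big_ord0 /F /= addr0 addrA => e.
exists (c 0 0), (c 0 (lift ord0 ord0)), (c 0 (lift ord0 (lift ord0 ord0))); split=> //.
apply: Classical_Prop.NNPP => n; case/negP: c0; apply/eqP/rowP => i; rewrite mxE.
apply: Classical_Prop.NNPP => ci; apply: n.
case: i ci => [[|[|[|//]]] hi] ci; [left|right; left|right; right] => e0; apply: ci; rewrite -e0; congr (c _ _); exact: val_inj.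
Qed.

Lemma orthonormal3_expand v w x : dot v v = 1 -> dot w w = 1 -> dot v w = 0 ->
  (forall z, dot z v = 0 -> dot z w = 0 -> dot z (cross v w) = 0 -> dot x z = 0) ->
  x = dot x v *: v + dot x w *: w + dot x (cross v w) *: cross v w.
Proof.
move=> vv ww vw hx; apply/eqP; rewrite -subr_eq0 -dot_eq0.
set c := cross v w in hx *; set y := x - _.
have cc : dot c c = 1 by rewrite dot_cross2 vv ww vw mulr1 mulr0 subr0.
have vc : dot v c = 0 by exact: dot_crossl.
have wc : dot w c = 0 by exact: dot_crossr.
have yv : dot y v = 0 by rewrite !dot_lin (dotC w) (dotC c) vv vw vc; ring.
have yw : dot y w = 0 by rewrite !dot_lin (dotC c) ww vw wc; ring.
have yc : dot y c = 0 by rewrite !dot_lin cc vc wc; ring.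
have xy : dot x y = 0 by apply: hx.
have ey : y = x - (dot x v *: v + dot x w *: w + dot x c *: c) by [].
clearbody y; rewrite {1}ey !dot_lin xy !(dotC _ y) yv yw yc !mulr0 !addr0 subrr //.
Qed.

Lemma preserves_perp_app d v w x : is_der d -> dot v v = 1 -> dot w w = 1 -> dot v w = 0 ->
  preserves_perp v w d ->
  (forall z, dot z v = 0 -> dot z w = 0 -> dot z (cross v w) = 0 -> dot x z = 0) ->
  app d x = dot (app d x) v *: v + dot (app d x) w *: w + dot (app d x) (cross v w) *: cross v w.
Proof.
move=> hd vv ww vw hp hx; apply: orthonormal3_expand => // z h1 h2 h3.
by rewrite der_dot_skew // hx ?oppr0 //; case: (hp z h1 h2 h3).
Qed.

Lemma inV0_dot v w : inV0 v -> inVp0 w -> dot v w = 0.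
Proof. by case=> h1 h2 h3 h4 [k1 k2 k3]; rewrite dotE h1 h2 h3 h4 k1 k2 k3; ring. Qed.

Lemma inV0_cross v w : inV0 v -> inVp0 w -> inVp0 (cross v w).
Proof.
case=> + + + + []; coords v; coords w; rewrite !mxE /= => -> -> -> -> -> -> ->.
by split; rewrite cross_v7 !mxE /=; ring.
Qed.

(* The part of [v, w, v x w] fixed by the swap of [V] and its orthogonal is the line of [v]. *)
Lemma preserves_perp_swap d v w x : m4std d -> inV0 v -> inVp0 w -> dot v v = 1 -> dot w w = 1 ->
  preserves_perp v w d -> inVp0 x ->
  (forall z, dot z v = 0 -> dot z w = 0 -> dot z (cross v w) = 0 -> dot x z = 0) ->
  exists k, app d x = k *: v.
Proof.
move=> [hd h1 h2] hv hw vv ww hp hx hxz; exists (dot (app d x) v).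
rewrite [LHS](preserves_perp_app hd vv ww (inV0_dot hv hw) hp hxz).
rewrite (inV0_dot (h2 _ hx) hw) (inV0_dot (h2 _ hx) (inV0_cross hv hw)) !scale0r !addr0 //.
Qed.

(** Elements of [m4std] exchange V and its complement, so d d' v and d w lie in W and in V, hence on
    the line of v. These eigenvector conditions determine v in the comparisons below. *)
Lemma preserves_perp_swap2 d d' v w : m4std d -> m4std d' -> inV0 v -> inVp0 w -> dot v v = 1 -> dot w w = 1 ->
  preserves_perp v w d -> preserves_perp v w d' ->
  (exists k, app d (app d' v) = k *: v) /\ (exists k, app d w = k *: v).
Proof.
move=> hd hd' hv hw vv ww hp hp'; have vw := inV0_dot hv hw; split; last first.
  by apply: (preserves_perp_swap hd hv hw vv ww hp hw) => z h1 h2 h3; rewrite dotC.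
have [hder hV _] := hd'.
apply: (preserves_perp_swap hd hv hw vv ww hp); first exact: hV.
move=> z h1 h2 h3; rewrite der_dot_skew //; have [e _ _] := hp' _ h1 h2 h3.
by rewrite dotC e oppr0.
Qed.

Lemma scaled_in_plane (k x0 x2 x6 y0 y2 y6 : R) :
  v7 y0 0 y2 0 0 0 y6 = k *: v7 x0 0 x2 0 0 0 x6 -> [/\ y0 * x2 = y2 * x0, y0 * x6 = y6 * x0 & y2 * x6 = y6 * x2].
Proof.
move=> h; have e (i : 'I_7) := congr1 (fun v : 'rV_7 => v 0 i) h.
have {e} := (e 'o_0, e 'o_2, e 'o_6); rewrite !mxE /= => -[[-> ->] ->].
by split; ring.
Qed.

Lemma V0_v7 v : inV0 v -> exists x0 x2 x6 : R, v = v7 x0 0 x2 0 0 0 x6.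
Proof. by case=> h1 h3 h4 h5; exists (v 0 'o_0), (v 0 'o_2), (v 0 'o_6); rewrite {1}(v7_eta v) h1 h3 h4 h5. Qed.
Lemma Vp0_v7 v : inVp0 v -> exists x1 x3 x4 x5 : R, v = v7 0 x1 0 x3 x4 x5 0.
Proof. by case=> h1 h3 h4; exists (v 0 'o_1), (v 0 'o_3), (v 0 'o_4), (v 0 'o_5); rewrite {1}(v7_eta v) h1 h3 h4. Qed.

(** The square of diag(1,2,-3) has the distinct eigenvalues -1, -4, -9 on V, so its eigenvectors
    there lie on the axes. *)
Lemma diag_eigenvector v k : inV0 v -> dot v v = 1 -> app (D 1 2) (app (D 1 2) v) = k *: v ->
  exists s : R, s * s = 1 /\ [\/ v = s *: delta_mx 0 'o_0, v = s *: delta_mx 0 'o_2 | v = s *: delta_mx 0 'o_6].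
Proof.
move=> /V0_v7 [x0 [x2 [x6 ->]]]; rewrite dot_v7 => n e.
have [h1 h2 h3] : [/\ x0 * x2 = 0, x0 * x6 = 0 & x2 * x6 = 0].
  have : v7 (- x0) 0 (- 4 * x2) 0 0 0 (- 9 * x6) = k *: v7 x0 0 x2 0 0 0 x6.
    by rewrite -e !app_Mx; congr v7; ring.
  by case/scaled_in_plane; clear => *; split; lra.
have [z0|z0] := eqVneq x0 0; last first.
  have z2 : x2 = 0 by apply/eqP; move/eqP: h1; rewrite mulf_eq0 (negPf z0).
  have z6 : x6 = 0 by apply/eqP; move/eqP: h2; rewrite mulf_eq0 (negPf z0).
  exists x0; split; first by rewrite -n z2 z6; ring.
  by constructor 1; rewrite delta_v7E v7E z2 z6; congr v7; ring.
have [z2|z2] := eqVneq x2 0; last first.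
  have z6 : x6 = 0 by apply/eqP; move/eqP: h3; rewrite mulf_eq0 (negPf z2).
  exists x2; split; first by rewrite -n z0 z6; ring.
  by constructor 2; rewrite delta_v7E v7E z0 z6; congr v7; ring.
exists x6; split; first by rewrite -n z0 z2; ring.
by constructor 3; rewrite delta_v7E v7E z0 z2; congr v7; ring.
Qed.
End StdContainment.

Section StdMaximal.
Variable R : realType.
Implicit Types (A d : 'M[R]_7) (P : 'M[R]_7 -> Prop).

Local Notation in_max P := (in_maximal (@inV0 R) (@inVp0 R) (@m4std R) P).

Lemma image_swap P d d' v w : (forall A, P A -> preserves_perp v w A) -> P d -> P d' -> m4std d -> m4std d' ->
  inV0 v -> inVp0 w -> dot v v = 1 -> dot w w = 1 ->
  (exists k, app d (app d' v) = k *: v) /\ (exists k, app d w = k *: v).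
Proof. by move=> h /h p /h p' m m' hv hw vv ww; apply: preserves_perp_swap2. Qed.

(** The product of T1 with the diagonal element exchanges the axes of e2 and e6, so v can only lie
    on the remaining one. *)
Lemma diag_T1_axis P v w : (forall A, P A -> preserves_perp v w A) -> P (D 1 2) -> P (T1 1) ->
  inV0 v -> inVp0 w -> dot v v = 1 -> dot w w = 1 -> exists s : R, s * s = 1 /\ v = s *: delta_mx 0 'o_0.
Proof.
move=> h hD hT hv hw vv ww.
have [[k e] _] := image_swap h hD hD (Mx_m4std _ _ _ _ _ _ _ _) (Mx_m4std _ _ _ _ _ _ _ _) hv hw vv ww.
have [[k' e'] _] := image_swap h hT hD (Mx_m4std _ _ _ _ _ _ _ _) (Mx_m4std _ _ _ _ _ _ _ _) hv hw vv ww.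
have [s [ss [-> | ev | ev]]] := diag_eigenvector hv vv e; first by exists s.
- exfalso; move: e'; rewrite ev delta_v7E v7E !app_Mx => e'.
  have := congr1 (fun v : 'rV_7 => v 0 'o_6) e'; rewrite !mxE /= => e6.
  have s0 : s = 0 by clear - e6; lra.
  by clear - s0 ss; move: ss; rewrite s0 mul0r; lra.
- exfalso; move: e'; rewrite ev delta_v7E v7E !app_Mx => e'.
  have := congr1 (fun v : 'rV_7 => v 0 'o_2) e'; rewrite !mxE /= => e6.
  have s0 : s = 0 by clear - e6; lra.
  by clear - s0 ss; move: ss; rewrite s0 mul0r; lra.
Qed.

(** The hypothesis says that P contains all elements of the model killing e3. They have no common
    plane by dimension. The element diag(1,2,-3) is injective on V and kills only the line of e3 in
    the complement. A stabilized W would need v on the axis of e0, from which T3 leads away. *)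
Lemma kills_perp_line_maximal P : (forall a b t1 t2 t3, P (Mx a b t1 t2 t3 0 0 0)) -> in_max P ->
  forall A, P A -> app A (delta_mx 0 'o_3) = 0.
Proof.
move=> h [[x [y [_ _ _ hxy]]]|[l [l0 lV hl]]|[u [u0 uV hu]]|[v [w [hv hw vv ww hvw]]]].
- have [a [b [c [n]]]] := small_not_in_plane hxy (h 1 0 0 0 0) (h 0 1 0 0 0) (h 0 0 1 0 0).
  by rewrite !Mx_scale !Mx_add => /Mx_inj0 [] e1 e2 e3 *; exfalso; clear - n e1 e2 e3; lra.
- have [l1 [l3 [l4 [l5 el]]]] := Vp0_v7 lV; have := hl _ (h 1 2 0 0 0).
  rewrite el app_Mx => e; have e' (i : 'I_7) := congr1 (fun v : 'rV_7 => v 0 i) e.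
  have {e'} := (e' 'o_0, e' 'o_2, e' 'o_6); rewrite !mxE /= => -[[e1 e2] e3].
  have [z1 z4 z5] : [/\ l1 = 0, l4 = 0 & l5 = 0] by clear - e1 e2 e3; split; lra.
  have el3 : l = l3 *: delta_mx 0 'o_3 by rewrite el delta_v7E v7E z1 z4 z5; congr v7; ring.
  have l30 : l3 != 0 by apply: contra_neq l0 => z; rewrite el3 z scale0r.
  move=> A /hl; rewrite el3 appZ => /eqP; rewrite scaler_eq0 (negPf l30) => /eqP //.
- exfalso; have [x0 [x2 [x6 ev]]] := V0_v7 uV; have := hu _ (h 1 2 0 0 0).
  rewrite ev app_Mx => e; have e' (i : 'I_7) := congr1 (fun v : 'rV_7 => v 0 i) e.
  have {e'} := (e' 'o_1, e' 'o_5, e' 'o_4); rewrite !mxE /= => -[[e1 e2] e3].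
  case/eqP: u0; rewrite ev; apply: row7P; rewrite !mxE //=; clear - e1 e2 e3; lra.
- exfalso; have [s [ss ev]] := diag_T1_axis hvw (h 1 2 0 0 0) (h 0 0 1 0 0) hv hw vv ww.
  have [[k e] _] := image_swap hvw (h 0 0 0 0 1) (h 1 2 0 0 0) (Mx_m4std _ _ _ _ _ _ _ _) (Mx_m4std _ _ _ _ _ _ _ _) hv hw vv ww.
  move: e; rewrite ev delta_v7E v7E !app_Mx => e'.
  have := congr1 (fun v : 'rV_7 => v 0 'o_2) e'; rewrite !mxE /= => e6.
  have s0 : s = 0 by clear - e6; lra.
  by clear - s0 ss; move: ss; rewrite s0 mul0r; lra.
Qed.

(** P contains the part of the orthogonal roots a+2b and a. It is too large for a plane and has no
    common kernel vector in V or in its complement; so only W itself is left to identify. *)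
Lemma preserves_plane_maximal P : (forall a b t r, P (Mx a b t 0 0 r 0 0)) -> in_max P ->
  forall A, P A -> preserves_perp (delta_mx 0 'o_0) (delta_mx 0 'o_3) A.
Proof.
move=> h [[x [y [_ _ _ hxy]]]|[l [l0 lV hl]]|[u [u0 uV hu]]|[v [w [hv hw vv ww hvw]]]].
- have [a [b [c [n]]]] := small_not_in_plane hxy (h 1 0 0 0) (h 0 1 0 0) (h 0 0 1 0).
  by rewrite !Mx_scale !Mx_add => /Mx_inj0 [] e1 e2 e3 *; exfalso; clear - n e1 e2 e3; lra.
- exfalso; have [l1 [l3 [l4 [l5 el]]]] := Vp0_v7 lV; have := hl _ (h 1 2 0 1).
  rewrite el app_Mx => e; have e' (i : 'I_7) := congr1 (fun v : 'rV_7 => v 0 i) e.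
  have := hl _ (h 1 2 0 0).
  rewrite el app_Mx => {}e; have e'' (i : 'I_7) := congr1 (fun v : 'rV_7 => v 0 i) e.
  have {e' e''} := (e' 'o_0, e' 'o_2, e' 'o_6, e'' 'o_0); rewrite !mxE /= => -[[[e1 e2] e3] e4].
  case/eqP: l0; rewrite el; apply: row7P; rewrite !mxE //=; clear - e1 e2 e3 e4; lra.
- exfalso; have [x0 [x2 [x6 ev]]] := V0_v7 uV; have := hu _ (h 1 2 0 0).
  rewrite ev app_Mx => e; have e' (i : 'I_7) := congr1 (fun v : 'rV_7 => v 0 i) e.
  have {e'} := (e' 'o_1, e' 'o_5, e' 'o_4); rewrite !mxE /= => -[[e1 e2] e3].
  case/eqP: u0; rewrite ev; apply: row7P; rewrite !mxE //=; clear - e1 e2 e3; lra.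
- have [s [ss ev]] := diag_T1_axis hvw (h 1 2 0 0) (h 0 0 1 0) hv hw vv ww.
  have [_ [k e]] := image_swap hvw (h 1 2 0 0) (h 1 2 0 0) (Mx_m4std _ _ _ _ _ _ _ _) (Mx_m4std _ _ _ _ _ _ _ _) hv hw vv ww.
  have [l1 [l3 [l4 [l5 el]]]] := Vp0_v7 hw.
  rewrite el ev delta_v7E v7E app_Mx in e.
  have e' (i : 'I_7) := congr1 (fun v : 'rV_7 => v 0 i) e.
  have {e'} := (e' 'o_2, e' 'o_6); rewrite !mxE /= => -[e1 e2].
  have [z4 z5] : l4 = 0 /\ l5 = 0 by clear - e1 e2; split; lra.
  move: ww; rewrite el z4 z5 dot_v7 => ww.
  have {}ww : l1 * l1 + l3 * l3 = 1 by rewrite -ww; ring.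
  (* Here v is e0 up to sign and w a unit vector of <e1, e3>, whose product with v is the other
     direction of that plane: <v, w, v × w> is <e0, e1, e3> whatever w is. *)
  have key (y : 'rV[R]_7) : (dot y v = 0 /\ dot y w = 0 /\ dot y (cross v w) = 0) <->
     (dot y (delta_mx 0 'o_0) = 0 /\ dot y (delta_mx 0 'o_3) = 0 /\
      dot y (cross (delta_mx 0 'o_0) (delta_mx 0 'o_3)) = 0).
    rewrite el ev z4 z5 !delta_v7E; rewrite (v7_eta y).
    move: (y 0 'o_0) (y 0 'o_1) (y 0 'o_2) (y 0 'o_3) (y 0 'o_4) (y 0 'o_5) (y 0 'o_6) => y0 y1 y2 y3 y4 y5 y6; rewrite !v7E.
    clear - ss ww; split=> -[h0 [h1 h2]].
      have q0 : y0 * s = 0 by rewrite -h0; ring.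
      have z0 : y0 = 0 by have -> : y0 = s * s * y0; [rewrite ss; ring | rewrite -mulrA (mulrC s y0) q0 mulr0].
      have q1 : l1 * y1 + l3 * y3 = 0 by rewrite -h1; ring.
      have q2 : l1 * y3 - l3 * y1 = 0.
        have -> : l1 * y3 - l3 * y1 = (s * s) * (l1 * y3 - l3 * y1) by rewrite ss; ring.
        by rewrite -(mulr0 s) -h2; ring.
      have z1 : y1 = (l1 * l1 + l3 * l3) * y1 by rewrite ww; ring.
      have z3 : y3 = (l1 * l1 + l3 * l3) * y3 by rewrite ww; ring.
      have {}z1 : y1 = 0.
        have -> : y1 = l1 * (l1 * y1 + l3 * y3) - l3 * (l1 * y3 - l3 * y1) by rewrite {1}z1; ring.
        by rewrite q1 q2; ring.
      have {}z3 : y3 = 0.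
        have -> : y3 = l3 * (l1 * y1 + l3 * y3) + l1 * (l1 * y3 - l3 * y1) by rewrite {1}z3; ring.
        by rewrite q1 q2; ring.
      by rewrite z0 z1 z3; split; last split; ring.
    have z0 : y0 = 0 by rewrite -h0; ring.
    have z3 : y3 = 0 by rewrite -h1; ring.
    have z1 : y1 = 0 by apply: oppr_inj; rewrite oppr0 -h2; ring.
    by rewrite z0 z1 z3; split; last split; ring.
  move=> A /hvw hA z h1 h2 h3.
  have [k1 [k2 k3]] := (key z).2 (conj h1 (conj h2 h3)).
  have [q1 q2 q3] := hA z k1 k2 k3.
  by have [? [? ?]] := (key (app A z)).1 (conj q1 (conj q2 q3)).
Qed.

(** The family is the full annihilator of e0 in the model: vanishing of the image of e0 means a = r1
    = 0, r2 = t2 and r3 = -t3. *)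
Lemma kills_vector_maximal P : (forall b t1 t2 t3, P (Mx 0 b t1 t2 t3 0 t2 (- t3))) -> in_max P ->
  forall A, P A -> app A (delta_mx 0 'o_0) = 0.
Proof.
move=> h hin.
have kill (l : 'rV[R]_7) : inVp0 l -> (forall b t1 t2 t3, app (Mx 0 b t1 t2 t3 0 t2 (- t3)) l 0 'o_2 = 0) -> l = 0.
  move=> /Vp0_v7 [l1 [l3 [l4 [l5 ->]]]] e.
  have {e} := (e 1 0 0 0, e 0 1 0 0, e 0 0 1 0, e 0 0 0 1); rewrite !app_Mx !mxE /= => -[[[e1 e2] e3] e4].
  apply: row7P; rewrite !mxE //=; clear - e1 e2 e3 e4; lra.
case: hin => [[x [y [_ _ _ hxy]]]|[l [l0 lV hl]]|[u [u0 uV hu]]|[v [w [hv hw vv ww hvw]]]].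
- have [a [b [c [n]]]] := small_not_in_plane hxy (h 1 0 0 0) (h 0 1 0 0) (h 0 0 1 0).
  by rewrite !Mx_scale !Mx_add => /Mx_inj0 [] e1 e2 e3 e4 *; exfalso; clear - n e1 e2 e3 e4; lra.
- by case/eqP: l0; apply: kill lV _ => b t1 t2 t3; rewrite hl ?mxE.
- have [x0 [x2 [x6 ev]]] := V0_v7 uV; have := hu _ (h 1 0 0 0).
  rewrite ev app_Mx => e; have e' (i : 'I_7) := congr1 (fun v : 'rV_7 => v 0 i) e.
  have {e'} := (e' 'o_5, e' 'o_4); rewrite !mxE /= => -[e2 e3].
  have [z2 z6] : x2 = 0 /\ x6 = 0 by clear - e2 e3; split; lra.
  have eu : u = x0 *: delta_mx 0 'o_0 by rewrite ev delta_v7E v7E z2 z6; congr v7; ring.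
  have x00 : x0 != 0 by apply: contra_neq u0 => z; rewrite eu z scale0r.
  move=> A /hu; rewrite eu appZ => /eqP; rewrite scaler_eq0 (negPf x00) => /eqP //.
- exfalso; have [x0 [x2 [x6 ev]]] := V0_v7 hv.
  have im := image_swap hvw (h _ _ _ _) (h _ _ _ _) (Mx_m4std _ _ _ _ _ _ _ _) (Mx_m4std _ _ _ _ _ _ _ _) hv hw vv ww.
  (* The images of the family are orthogonal to e0. If v has an e0 component, A w = k v forces k =
     0, so the whole family kills w. *)
  have [z0|z0] := eqVneq x0 0; last first.
    move: ww; rewrite (kill w) ?dot0l; last 1 first.
    + move=> b t1 t2 t3; have [_ [k]] := im b t1 t2 t3 b t1 t2 t3.
      have [l1 [l3 [l4 [l5 ->]]]] := Vp0_v7 hw; rewrite ev app_Mx => e.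
      have e0 := congr1 (fun v : 'rV_7 => v 0 'o_0) e; rewrite !mxE /= in e0; rewrite e !mxE /=.
      have /eqP : k * x0 = 0 by rewrite -e0; ring.
      rewrite mulf_eq0 (negPf z0) orbF => /eqP ->; exact: mul0r.
    + by move/eqP; rewrite eq_sym oner_eq0.
    + by [].
  (* Now v lies in <e2, e6>, where this product of two elements is a quarter turn, which has no real
     eigenvector. *)
  have [[k e] _] := im 0 1 0 0 1 0 0 0.
  move: vv e; rewrite ev z0 dot_v7 !app_Mx => vv.
  have -> : v7 0 0 x2 0 0 0 x6 = v7 0 0 x2 0 0 0 x6 by [].
  move=> e; have e' (i : 'I_7) := congr1 (fun v : 'rV_7 => v 0 i) e.
  have {e'} := (e' 'o_2, e' 'o_6); rewrite !mxE /= => -[e1 e2].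
  clear - vv e1 e2.
  have q1 : x6 = k * x2 by rewrite -e1; ring.
  have q2 : - x2 = k * x6 by rewrite -e2; ring.
  have x2E : - (k * x6) = x2 by rewrite -q2 opprK.
  have q : x2 * x2 + x6 * x6 = 0 by rewrite -{2}x2E {2}q1; ring.
  have : x2 * x2 + x6 * x6 = 1 by rewrite -vv; ring.
  by rewrite q => /eqP; rewrite eq_sym oner_eq0.
Qed.
End StdMaximal.

(** * Invariant subspaces of a principal element *)

(** The spaces U N^j decrease; if two consecutive ones coincide, nilpotency makes them zero. So the
    rank drops at each step until it vanishes, after at most rank U steps. *)
Lemma nilpotent_on_stable (F : fieldType) n m (N : 'M[F]_n.+1) (U : 'M[F]_(m, n.+1)) k :
  N ^+ k = 0 -> (U *m N <= U)%MS -> U *m N ^+ (\rank U) = 0.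
Proof.
move=> Nk sU; have step j : (U *m N ^+ j.+1 <= U *m N ^+ j)%MS.
  by rewrite exprS -mulmxE mulmxA; apply: submxMr.
have fix0 j : (U *m N ^+ j <= U *m N ^+ j.+1)%MS -> U *m N ^+ j = 0.
  move=> hj; have H i : (U *m N ^+ j <= U *m N ^+ (j + i))%MS.
    elim: i => [|i ih]; first by rewrite addn0.
    apply: submx_trans hj _; rewrite addnS !exprSr -!mulmxE !mulmxA; exact: submxMr.
  by apply/eqP; rewrite -submx0; apply: submx_trans (H k) _; rewrite addnC exprD Nk mul0r mulmx0 sub0mx.
have rk j : (\rank (U *m N ^+ j) <= \rank U - j)%N.
  elim: j => [|j ih]; first by rewrite expr0 mulmx1 subn0.
  have [hj|hj] := boolP (U *m N ^+ j <= U *m N ^+ j.+1)%MS.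
    have e := fix0 _ hj; apply: leq_trans (_ : 0 <= _)%N => //.
    by have := mxrankS (step j); rewrite e mxrank0.
  have : (\rank (U *m N ^+ j.+1) < \rank (U *m N ^+ j))%N by rewrite (ltn_leqif (mxrank_leqif_sup (step j))).
  by move=> h; rewrite subnS -ltnS; apply: leq_trans h (leq_trans ih _); apply: leqSpred.
by apply/eqP; rewrite -mxrank_eq0 -leqn0; apply: leq_trans (rk _) _; rewrite subnn.
Qed.

Section Invariant.
Variable R : realType.
Local Notation C := (complex R).
Local Notation mc := (map_mx (real_complex R)).

Lemma complex_stable_exp6 m (U : 'M[R]_(m, 7)) (A B : 'M[R]_7) :
  (\rank U < 7)%N -> complexify A B ^+ 7 = 0 -> (U *m A^T <= U)%MS -> (U *m B^T <= U)%MS ->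
  mc U *m (complexify A B ^+ 6)^T = 0.
Proof.
move=> rU e7 UA UB; rewrite complexifyE in e7 *; set e := _ + _ in e7 *.
have trX k : (e ^+ k)^T = e^T ^+ k.
  elim: k => [|k ih]; first by rewrite !expr0 trmx1.
  by rewrite exprS exprSr -mulmxE trmx_mul ih mulmxE.
have st : (mc U *m e^T <= mc U)%MS.
  rewrite /e linearD linearZ /= !map_trmx mulmxDr -scalemxAr -!map_mxM.
  by rewrite addmx_sub ?scalemx_sub // map_submx.
have h : mc U *m (e^T) ^+ (\rank U) = 0.
  by rewrite -(mxrank_map (real_complex R) U); apply: (nilpotent_on_stable (k := 7)) st; rewrite -trX e7 trmx0.
rewrite trX; have -> : e^T ^+ 6 = e^T ^+ (\rank U) *m e^T ^+ (6 - \rank U) by rewrite mulmxE -exprD subnKC.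
by rewrite mulmxA h mul0mx.
Qed.

Lemma principal_exp7 (e : 'M[C]_7) : principal_nilpotent e -> e ^+ 7 = 0.
Proof.
case=> /nilvarC_normal_form [Q [a1 [a2 [c4 [c3 [c2 [c1 [[u _] ->]]]]]]]] _.
by rewrite conj_exp ?mulVmx ?mulmxV // nilmx_exp7 mulmx0 mul0mx.
Qed.

(* On an invariant subspace of dimension k < 7 the sixth power of a nilpotent map vanishes; so it does on the orthogonal complement. *)
Lemma principal_no_invariant m (U : 'M[R]_(m, 7)) (A B : 'M[R]_7) :
  is_der A -> is_der B -> principal_nilpotent (complexify A B) ->
  (0 < \rank U < 7)%N -> (U *m A^T <= U)%MS -> (U *m B^T <= U)%MS -> False.
Proof.
move=> dA dB hp /andP [r0 r7] UA UB; have e7 := principal_exp7 hp.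
pose K := kermx U^T.
have rK : \rank K = (7 - \rank U)%N by rewrite mxrank_ker mxrank_tr.
have KU : K *m U^T = 0 by exact: mulmx_ker.
have st (d : 'M[R]_7) : is_der d -> (U *m d^T <= U)%MS -> (K *m d^T <= K)%MS.
  move=> hd /submxP [E eE]; apply/sub_kermxP.
  have -> : K *m d^T *m U^T = - (K *m (U *m d^T)^T).
    by rewrite trmx_mul trmxK der_skew // mulmxA mulmxN mulNmx.
  by rewrite eE trmx_mul mulmxA KU mul0mx oppr0.
have dis : (U :&: K)%MS = 0.
  apply/eqP/rowV0P => x; rewrite sub_capmx => /andP [/submxP [E ->] /sub_kermxP e].
  by apply/eqP; rewrite -dot_eq0 /dot trmx_mul mulmxA e mul0mx mxE.
have full : (1%:M <= U + K)%MS.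
  apply: submx_full; rewrite /row_full mxrank_disjoint_sum // rK subnKC // ltnW //.
clearbody K; have [[X Y] /= e1] := sub_addsmxP full.
have := principal_exp6 hp; apply/negP; rewrite negbK; apply/eqP/trmx_inj.
rewrite trmx0 -[LHS]mul1mx -(map_mx1 (real_complex R)) e1 map_mxD !map_mxM mulmxDl -!mulmxA.
rewrite !complex_stable_exp6 ?mulmx0 ?addr0 ?rK //; try exact: st.
by move: r0 r7; lia.
Qed.
End Invariant.

(** * Maximal Lie triple subsystems *)

Section Grading.
Variables (R : realType) (V : 'M[R]_7).
Hypothesis hV : inMS V.
Implicit Types (x y z u v w : 'rV[R]_7) (A B d : 'M[R]_7) (P L : 'M[R]_7 -> Prop).

Lemma m4_subsp : subsp (m4 V).
Proof.
split; first by split; [exact: is_der0 | split=> x _; rewrite app_0mx ?sub0mx // => y _; rewrite dot0l].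
move=> k A B [a1 [a2 a3]] [b1 [b2 b3]]; split; first exact: is_der_lin.
split=> x hx; rewrite app_addmx app_scalemx; last by rewrite addmx_sub ?scalemx_sub ?a3 ?b3.
by move=> y hy; rewrite !dot_lin a2 // b2 // mulr0 addr0.
Qed.

Lemma inperp_lin k x y : inperp V x -> inperp V y -> inperp V (k *: x + y).
Proof. by move=> hx hy z hz; rewrite !dot_lin hx // hy // mulr0 addr0. Qed.

Lemma inperpB x y : inperp V x -> inperp V y -> inperp V (x - y).
Proof. by move=> hx hy; rewrite addrC -scaleN1r; apply: inperp_lin. Qed.

Lemma submxB (x y : 'rV[R]_7) : (x <= V)%MS -> (y <= V)%MS -> (x - y <= V)%MS.
Proof. by move=> hx hy; rewrite addmx_sub ?eqmx_opp. Qed.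

Lemma m4_lts : lts (m4 V).
Proof.
move=> A B E [a1 [a2 a3]] [b1 [b2 b3]] [e1 [e2 e3]]; split; first by do 2?apply: is_der_lie.
split=> x hx; rewrite !app_lie.
  by apply: inperpB; [apply: inperpB; auto | apply: e2; apply: submxB; auto].
by apply: submxB; [apply: submxB; auto | apply: e3; apply: inperpB; auto].
Qed.

Lemma perp_perp x : (forall y, inperp V y -> dot x y = 0) -> (x <= V)%MS.
Proof.
have [g [ga go gV gVp]] := frame_ex hV; move=> h.
rewrite -(app_trK x go); apply/gV.
have e (i : 'I_7) : inVp0 (delta_mx 0 i : 'rV[R]_7) -> app g^T x 0 i = 0.
  by move/gVp/h; rewrite -delta_v7 dot_app_tr.
by split; apply: e; split; rewrite !mxE.
Qed.

Lemma h4_V d x : h4 V d -> (x <= V)%MS -> (app d x <= V)%MS.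
Proof.
case=> hd h hx; apply: perp_perp => y hy; rewrite der_dot_skew //.
by rewrite dotC h ?oppr0.
Qed.

Lemma lie_m4_h4 A B : m4 V A -> m4 V B -> h4 V (lie A B).
Proof.
move=> [a1 [a2 a3]] [b1 [b2 b3]]; split; first exact: is_der_lie.
by move=> x hx; rewrite app_lie; apply: inperpB; auto.
Qed.

Lemma lie_h4_m4 A B : h4 V A -> m4 V B -> m4 V (lie A B).
Proof.
move=> hA [b1 [b2 b3]]; have [a1 a2] := hA; split; first exact: is_der_lie.
split=> x hx; rewrite app_lie; first by apply: inperpB; [auto | apply/b2/h4_V].
by apply: submxB; [apply: h4_V => //; auto | auto].
Qed.

(** By [kills_perp_line_maximal] all of [m4 V] would kill e3 in the model, but R1 does not. Through
    [proper_of_in_maximal] this gives properness of the killing and stabilizing subsystems. *)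
Lemma m4_not_in_maximal : ~ in_maximal (fun x => (x <= V)%MS) (inperp V) (m4 V) (m4 V).
Proof.
have [g hg] := frame_ex hV => /(in_maximal_std hg) h.
have hm a b t1 t2 t3 r1 r2 r3 : m4 V (cj g (Mx a b t1 t2 t3 r1 r2 r3)).
  by apply/(frame_m4 _ hg); apply: Mx_m4std.
have := kills_perp_line_maximal _ h (hm 0 0 0 0 0 1 0 0).
rewrite delta_v7E app_Mx => /(_ _)/(congr1 (fun v : 'rV_7 => v 0 'o_0)); rewrite !mxE /= => e.
have {e} e : 2 = 0 :> R by rewrite -e //; ring.
by move/eqP: e; rewrite pnatr_eq0.
Qed.

Lemma proper_of_in_maximal P : in_maximal (fun x => (x <= V)%MS) (inperp V) (m4 V) P ->
  exists A, m4 V A /\ ~ P A.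
Proof.
move=> h; apply: Classical_Prop.NNPP => n; apply: m4_not_in_maximal.
apply: in_maximal_sub h => A hA; apply: Classical_Prop.NNPP => hP; apply: n; by exists A.
Qed.

(** Four independent elements of [m4 V] do not fit into dimension three. *)
Lemma proper_of_rank3 (h : 'M[R]_(7 * 7)) : \rank h = 3 -> exists A, m4 V A /\ ~ inS h A.
Proof.
move=> rh; have [g hg] := frame_ex hV; have [_ go _ _] := hg.
apply: Classical_Prop.NNPP => n.
have hm a b t1 t2 : inS h (cj g (Mx a b t1 t2 0 0 0 0)).
  apply: Classical_Prop.NNPP => hn; apply: n; eexists; split; last exact: hn.
  by apply/(frame_m4 _ hg); apply: Mx_m4std.
pose F (i : 'I_4) := cj g (nth 0 [:: Mx 1 0 0 0 0 0 0 0; Mx 0 1 0 0 0 0 0 0; Mx 0 0 1 0 0 0 0 0; Mx 0 0 0 1 0 0 0 0] i).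
have [||c c0] := @dependent_in_small_space _ _ 4 h F; first by rewrite rh.
  by rewrite /F; case=> [[|[|[|[|//]]]] hi] /=; apply: hm.
have cjZ k d : k *: cj g d = cj g (k *: d) by rewrite -[k *: d]addr0 cj_lin cj0 addr0.
rewrite !big_ord_recl big_ord0 /F /= addr0 [X in _ + (_ + (_ + X))]cjZ -!cj_lin.
move/(congr1 (cj g^T)); rewrite cjK // cj0 !Mx_scale !Mx_add.
case/Mx_inj0; rewrite !(mulr0, mulr1, addr0, add0r) => z0 z1 z2 z3 _; case/eqP: c0.
apply/rowP; case=> [[|[|[|[|//]]]] hi]; rewrite [RHS]mxE; [rewrite -z0 | rewrite -z1 | rewrite -z2 | rewrite -z3];
  congr (c _ _); exact: val_inj.
Qed.

Definition kills l A := m4 V A /\ app A l = 0.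
Definition stabilizes v w A := m4 V A /\ preserves_perp v w A.

Lemma kills_subsp l : subsp (kills l).
Proof.
have [h0 hl] := m4_subsp; split; first by split=> //; rewrite app_0mx.
move=> k A B [hA eA] [hB eB]; split; first exact: hl.
by rewrite app_addmx app_scalemx eA eB scaler0 addr0.
Qed.

Lemma app_lie0 l A B : app A l = 0 -> app B l = 0 -> app (lie A B) l = 0.
Proof. by move=> eA eB; rewrite app_lie eA eB !app0 subrr. Qed.

Lemma kills_lts l : lts (kills l).
Proof.
move=> A B E [hA eA] [hB eB] [hE eE]; split; first exact: m4_lts.
by do 2?apply: app_lie0.
Qed.

Lemma preserves_perp_lie v w A B : preserves_perp v w A -> preserves_perp v w B -> preserves_perp v w (lie A B).
Proof.
move=> hA hB z h1 h2 h3; have [a1 a2 a3] := hA z h1 h2 h3; have [b1 b2 b3] := hB z h1 h2 h3.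
have [c1 c2 c3] := hA _ b1 b2 b3; have [d1 d2 d3] := hB _ a1 a2 a3.
by rewrite app_lie !dotDl !dotNl c1 c2 c3 d1 d2 d3 subrr.
Qed.

Lemma preserves_perp_subsp v w : subsp (preserves_perp v w : 'M[R]_7 -> Prop).
Proof.
split; first by move=> z _ _ _; rewrite app_0mx !dot0l.
move=> k A B hA hB z h1 h2 h3; have [a1 a2 a3] := hA z h1 h2 h3; have [b1 b2 b3] := hB z h1 h2 h3.
by rewrite app_addmx app_scalemx !dotDl !dotZl a1 a2 a3 b1 b2 b3 mulr0 addr0.
Qed.

Lemma stabilizes_subsp v w : subsp (stabilizes v w).
Proof.
have [h0 hl] := m4_subsp; have [p0 pl] := preserves_perp_subsp v w; split; first by [].
by move=> k A B [hA eA] [hB eB]; split; [exact: hl | exact: pl].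
Qed.

Lemma stabilizes_lts v w : lts (stabilizes v w).
Proof.
by move=> A B E [hA eA] [hB eB] [hE eE]; split; [exact: m4_lts | exact: preserves_perp_lie (preserves_perp_lie eA eB) eE].
Qed.
End Grading.

(** * Adapted principal subalgebras are generated by their part in [m4 V] *)

Section Principal.
Variables (R : realType) (V : 'M[R]_7).
Hypothesis hV : inMS V.
Implicit Types (x y z u v w : 'rV[R]_7) (A B d : 'M[R]_7) (P L : 'M[R]_7 -> Prop) (h : 'M[R]_(7 * 7)).

Definition subalg L := subsp L /\ forall A B, L A -> L B -> L (lie A B).

Lemma inS_subsp m (S : 'M[R]_(m, 7 * 7)) : subsp (fun A => (mxvec A <= S)%MS).
Proof.
split; first by rewrite linear0 sub0mx.
by move=> k A B hA hB; rewrite linearD linearZ /= addmx_sub ?scalemx_sub.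
Qed.

Lemma jacobi A B d : lie d (lie A B) = lie (lie d A) B + lie A (lie d B).
Proof.
rewrite /lie !(mulmxBr, mulmxBl) !mulmxA.
move: (d *m A *m B) (d *m B *m A) (A *m B *m d) (B *m A *m d) (A *m d *m B) (B *m d *m A) => a b c e f k.
by apply/matrixP => i j; rewrite !mxE; ring.
Qed.

(* The subalgebra generated by [h :&: m4 V] is an ideal of [h], since [h :&: h4 V] normalizes it. *)
Lemma adapted_generated h L : principal_subalg h -> adapted V h -> subalg L ->
  (forall A, inS h A -> m4 V A -> L A) -> forall A, inS h A -> L A.
Proof.
move=> [hg2 rh hlie [_ simple] [e1 [e2 [he1 he2 pe]]]] had hL hm.
(* The generated subalgebra, as the intersection of h with all subalgebras that contain its part in
   [m4 V]. *)
pose J A := inS h A /\ forall L', subalg L' -> (forall B, inS h B -> m4 V B -> L' B) -> L' A.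
have [h0 hlin] := inS_subsp h.
have mJ A : inS h A -> m4 V A -> J A by move=> a1 a2; split=> // L' _; apply.
have Jlie A B : J A -> J B -> J (lie A B).
  move=> [a1 a2] [b1 b2]; split; first exact: hlie.
  by move=> L' hL' hmL'; case: (hL') => _; apply; [exact: a2 | exact: b2].
have Jsub : subsp J.
  split; first by split=> // L' [[l0 _] _] _.
  move=> k A B [a1 a2] [b1 b2]; split; first exact: hlin.
  by move=> L' hL' hmL'; case: (hL') => -[_ +] _; apply; [exact: a2 | exact: b2].
have [_ Jlin] := Jsub.
have kJ k A : inS h k -> h4 V k -> J A -> J (lie k A).
  move=> hk k4 JA; have [_ a2] := JA.
  suff [] : J (lie k A) /\ J A by [].
  (* Minimality of J is applied to the subalgebra of those elements of J whose bracket with k stays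
     in J; the Jacobi identity closes it under brackets. *)
  apply: (a2 (fun A => J (lie k A) /\ J A)).
  - split; first split.
    + by rewrite lie0r; case: Jsub.
    + by move=> c B E [b1 b2] [c1 c2]; rewrite lieDr lieZr; split; apply: Jlin.
    + move=> B E [b1 b2] [c1 c2]; split; last exact: Jlie.
      by rewrite jacobi; apply: subspD => //; apply: Jlie.
  - by move=> B hB mB; split; apply: mJ => //; [exact: hlie | exact: lie_h4_m4].
have [I hI] := subspace_mx Jsub.
have Jh A : inS h A -> J A.
  have [||I0|hI'] := simple I; last by move=> /submx_trans/(_ hI')/hI.
  - apply/row_subP => i; rewrite -[row i I]vec_mxK; have : J (vec_mx (row i I)).
      by apply/hI; rewrite vec_mxK row_sub.
    by case.
  - move=> E B hE /hI JB; apply/hI; have [A1 [A2 [a1 a2 a3 a4 ->]]] := had E hE.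
    by rewrite lieDl; apply: (subspD Jsub); [exact: kJ | apply: Jlie => //; apply: mJ].
  (* If the ideal is zero, h lies in [h4 V] and leaves V invariant, which contradicts
     [principal_no_invariant]. *)
  move/eqP: I0; rewrite mxrank_eq0 => /eqP I0.
  have m0 E : inS h E -> h4 V E.
    move=> hE; have [A1 [A2 [a1 a2 a3 a4 ->]]] := had E hE.
    have /hI := mJ _ a3 a4; rewrite I0 submx0 => /eqP e.
    by have -> : A2 = 0; [apply: (can_inj mxvecK); rewrite e linear0 | rewrite addr0].
  have st E : inS h E -> (V *m E^T <= V)%MS.
    move=> /m0 hE; apply/row_subP => i; rewrite row_mul; apply: (h4_V hV hE); exact: row_sub.
  exfalso; apply: (principal_no_invariant (hg2 _ he1) (hg2 _ he2) pe _ (st _ he1) (st _ he2)).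
  by case: hV => ->.
by move=> A /Jh [_]; apply.
Qed.

Lemma adapted_not_kills h u : principal_subalg h -> adapted V h -> u != 0 ->
  ~ (forall A, inS h A -> m4 V A -> app A u = 0).
Proof.
move=> hp had u0 hk; have [hg2 _ _ _ [A [B [hA hB pe]]]] := hp.
have H E : inS h E -> app E u = 0.
  apply: (@adapted_generated h (fun E => app E u = 0)) => //; split; last by move=> *; apply: app_lie0.
  split; first exact: app_0mx.
  by move=> k E1 E2 e f; rewrite app_addmx app_scalemx e f scaler0 addr0.
apply: (principal_no_invariant (U := u) (hg2 _ hA) (hg2 _ hB) pe).
- by rewrite rank_rV u0.
- by have := H _ hA; rewrite /app => ->; apply: sub0mx.
- by have := H _ hB; rewrite /app => ->; apply: sub0mx.
Qed.

Definition plane_mx v w : 'M[R]_(3, 7) := \matrix_(i < 3) nth 0 [:: v; w; cross v w] i.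

Lemma dot_plane_mx v w x : (x *m (plane_mx v w)^T == 0) <->
  [/\ dot x v = 0, dot x w = 0 & dot x (cross v w) = 0].
Proof.
have e (i : 'I_3) : (x *m (plane_mx v w)^T) 0 i = dot x (nth 0 [:: v; w; cross v w] i).
  by rewrite /dot !mxE; apply: eq_bigr => k _; rewrite !mxE.
split=> [/eqP h | [h1 h2 h3]].
  have {}e (i : 'I_3) := etrans (esym (e i)) (congr1 (fun v : 'rV_3 => v 0 i) h).
  by split; [have := e ord0 | have := e (lift ord0 ord0) | have := e (lift ord0 (lift ord0 ord0))]; rewrite mxE.
by apply/eqP/rowP => i; rewrite e mxE; case: i => [[|[|[|//]]] hi].
Qed.

Lemma adapted_not_stabilizes h v w : principal_subalg h -> adapted V h -> v != 0 ->
  ~ (forall A, inS h A -> m4 V A -> preserves_perp v w A).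
Proof.
move=> hp had v0 hk; have [hg2 _ _ _ [A [B [hA hB pe]]]] := hp.
have H E : inS h E -> preserves_perp v w E.
  apply: (@adapted_generated h (preserves_perp v w)) => //; split; first exact: preserves_perp_subsp.
  by move=> *; apply: preserves_perp_lie.
have st E : inS h E -> (kermx (plane_mx v w)^T *m E^T <= kermx (plane_mx v w)^T)%MS.
  move=> /H hE; apply/row_subP => i; rewrite row_mul; apply/sub_kermxP/eqP/dot_plane_mx.
  have /sub_kermxP/eqP/dot_plane_mx [h1 h2 h3] := row_sub i (kermx (plane_mx v w)^T).
  exact: hE.
apply: (principal_no_invariant (hg2 _ hA) (hg2 _ hB) pe _ (st _ hA) (st _ hB)).
(* Since v is nonzero, <v, w, v × w> has dimension 1 to 3, so its invariant complement has dimension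
   4 to 6. *)
rewrite mxrank_ker mxrank_tr.
have r3 := rank_leq_row (plane_mx v w).
have r1 : (0 < \rank (plane_mx v w))%N.
  rewrite lt0n mxrank_eq0; apply: contraNneq v0 => e.
  by have := rowK (fun i : 'I_3 => nth 0 [:: v; w; cross v w] i) ord0; rewrite -/(plane_mx v w) e row0 /= => <-.
by move: r1 r3; lia.
Qed.

(** If the part of h in [m4 V] were commutative, it would be a subalgebra, hence all of h, and h
    would be abelian. *)
Lemma adapted_noncommuting h : principal_subalg h -> adapted V h ->
  exists A B, [/\ inS h A, m4 V A, inS h B, m4 V B & lie A B != 0].
Proof.
move=> hp had; apply: Classical_Prop.NNPP => n.
have ab A B : inS h A -> m4 V A -> inS h B -> m4 V B -> lie A B = 0.
  move=> h1 h2 h3 h4; apply/eqP; apply: Classical_Prop.NNPP => h5; apply: n.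
  by exists A, B; split=> //; apply/negP.
have hm A : inS h A -> inS h A /\ m4 V A.
  apply: (@adapted_generated h (fun A => inS h A /\ m4 V A)) => //.
  have [s0 sl] := inS_subsp h; have [m0 ml] := m4_subsp V; split.
    by split=> // k E F [e1 e2] [f1 f2]; split; [exact: sl | exact: ml].
  by move=> E F [e1 e2] [f1 f2]; rewrite /= ab.
have [_ _ _ [[A [B [/hm [a1 a2] /hm [b1 b2] ne]]] _] _] := hp.
by move: ne; rewrite ab // eqxx.
Qed.
End Principal.

(** * Three-dimensional spans: quaternionic subspaces and principal pairs *)

Section Span3.
Variables (F : fieldType) (n : nat).
Implicit Types (x : 'rV[F]_n).

(** [<<_>>] makes the matrix square, the format used for subspaces in [inMS] and
    [principal_subalg]. *)
Definition span3 x1 x2 x3 : 'M[F]_n := <<\matrix_(i < 3) nth 0 [:: x1; x2; x3] i>>%MS.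

Lemma mul_span3 (c : 'rV[F]_3) x1 x2 x3 : c *m (\matrix_(i < 3) nth 0 [:: x1; x2; x3] i)
  = c 0 ord0 *: x1 + c 0 (lift ord0 ord0) *: x2 + c 0 (lift ord0 (lift ord0 ord0)) *: x3.
Proof. by rewrite mulmx_sum_row !big_ord_recl big_ord0 !rowK /= addr0 addrA. Qed.

Lemma sub_span3 x x1 x2 x3 : (x <= span3 x1 x2 x3)%MS <-> exists a b c, x = a *: x1 + b *: x2 + c *: x3.
Proof.
rewrite genmxE; split=> [/submxP [c ->]|[a [b [c ->]]]].
  by rewrite mul_span3; do 3!eexists.
apply/submxP; exists (\row_(i < 3) nth 0 [:: a; b; c] i); by rewrite mul_span3 !mxE.
Qed.

Lemma rank_span3 x1 x2 x3 : (forall a b c, a *: x1 + b *: x2 + c *: x3 = 0 -> [/\ a = 0, b = 0 & c = 0]) ->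
  \rank (span3 x1 x2 x3) = 3.
Proof.
move=> h; rewrite mxrank_gen; apply/eqP; rewrite -/(row_free _) -kermx_eq0.
apply/rowV0P => c /sub_kermxP; rewrite mul_span3 => /h [h1 h2 h3].
apply/rowP; case=> [[|[|[|//]]] hi]; rewrite [RHS]mxE; [rewrite -h1|rewrite -h2|rewrite -h3]; congr (c _ _); exact: val_inj.
Qed.
End Span3.

Section Plane.
Variable R : realType.
Implicit Types (x y z u v w : 'rV[R]_7) (A B d V W : 'M[R]_7).

Local Notation plane v w := (span3 v w (cross v w)).

Lemma inperp_plane v w z : inperp (plane v w) z <-> [/\ dot z v = 0, dot z w = 0 & dot z (cross v w) = 0].
Proof.
split=> [h|[h1 h2 h3] y /sub_span3 [a [b [c ->]]]]; last by rewrite !dotDr !dotZr h1 h2 h3 !mulr0 !addr0.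
split; apply: h; apply/sub_span3; [exists 1, 0, 0|exists 0, 1, 0|exists 0, 0, 1];
  by rewrite !scale0r scale1r ?addr0 ?add0r.
Qed.

Lemma h4_plane v w d : h4 (plane v w) d <-> is_der d /\ preserves_perp v w d.
Proof.
split=> -[hd h]; split=> //; first by move=> z h1 h2 h3; apply/inperp_plane/h/inperp_plane.
by move=> x /inperp_plane [h1 h2 h3]; apply/inperp_plane/h.
Qed.

Lemma orthonormal_cross v w : dot v v = 1 -> dot w w = 1 -> dot v w = 0 ->
  cross v (cross v w) = - w /\ cross w (cross v w) = v.
Proof.
move=> vv ww vw; split; first by rewrite cross_crossx vv vw scale0r scale1r sub0r.
by rewrite (crossC v w) crossNr cross_crossx ww dotC vw scale0r scale1r sub0r opprK.
Qed.

Lemma rank_plane v w : dot v v = 1 -> dot w w = 1 -> dot v w = 0 -> \rank (plane v w) = 3.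
Proof.
move=> vv ww vw; apply: rank_span3 => a b c e.
have vc : dot (cross v w) v = 0 by rewrite dotC dot_crossl.
have wc : dot (cross v w) w = 0 by rewrite dotC dot_crossr.
have cc : dot (cross v w) (cross v w) = 1 by rewrite dot_cross2 vv ww vw mulr1 mulr0 subr0.
have h t : dot (a *: v + b *: w + c *: cross v w) t = 0 by rewrite e dot0l.
have := (h v, h w, h (cross v w)).
rewrite !dotDl !dotZl vv ww vc wc cc (dotC w) vw (dotC v) (dotC w) vc wc.
by rewrite !(mulr0, mulr1, addr0, add0r) => -[[]].
Qed.

Lemma inMS_plane v w : dot v v = 1 -> dot w w = 1 -> dot v w = 0 -> inMS (plane v w).
Proof.
move=> vv ww vw; split; first exact: rank_plane.
have [cv cw] := orthonormal_cross vv ww vw.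
move=> x y /sub_span3 [a [b [c ->]]] /sub_span3 [a' [b' [c' ->]]]; apply/sub_span3.
exists (b * c' - c * b'), (c * a' - a * c'), (a * b' - b * a').
rewrite !(crossDl, crossDr, crossZl, crossZr, crossxx) (crossC w v) (crossC (cross v w) v) (crossC (cross v w) w).
rewrite cv cw; move: (cross v w) => z.
by apply/rowP => i; rewrite !mxE; ring.
Qed.

Lemma inMS_plane_eq W v w : inMS W -> (v <= W)%MS -> (w <= W)%MS -> dot v v = 1 -> dot w w = 1 -> dot v w = 0 ->
  (W :=: plane v w)%MS.
Proof.
move=> [rW clW] vW wW vv ww vw; apply/eqmxP; rewrite andbC.
have s : (plane v w <= W)%MS.
  apply/row_subP => i; have /sub_span3 [a [b [c ->]]] := row_sub i (plane v w).
  by rewrite !addmx_sub ?scalemx_sub ?clW.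
by apply/andP; split=> //; rewrite -(geq_leqif (mxrank_leqif_sup s)) rW rank_plane.
Qed.

Lemma h4_eqmx W W' d : (W :=: W')%MS -> h4 W d <-> h4 W' d.
Proof.
move=> e; have p x : inperp W x <-> inperp W' x by split=> h y hy; apply: h; rewrite ?e // -e.
by split=> -[hd h]; split=> // x /p/h/p.
Qed.
End Plane.

Section PrincipalSpan.
Variables (R : realType) (V : 'M[R]_7).
Implicit Types (A B x y : 'M[R]_7).

Definition pair_span x y := span3 (mxvec x) (mxvec y) (mxvec (lie x y)).

Lemma inS_pair_span x y A : inS (pair_span x y) A <-> exists a b c, A = a *: x + b *: y + c *: lie x y.
Proof.
rewrite /inS sub_span3; split=> -[a [b [c e]]]; exists a, b, c; last by rewrite e !linearD !linearZ.
by apply: (can_inj mxvecK); rewrite e !linearD !linearZ.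
Qed.

(** x, y, z satisfy the so(3) relations. Simplicity: double brackets extract from a nonzero element
    of an ideal a nonzero multiple of a basis vector, and brackets of it give the other two. *)
Lemma principal_pair_subalg x y : is_der x -> is_der y -> principal_pair x y -> principal_subalg (pair_span x y).
Proof.
move=> hx hy [zx zy pe]; set z := lie x y in zx zy pe; have zE : lie x y = z by [].
have yz : lie y z = x by rewrite lieC zy opprK.
have xz : lie x z = - y by rewrite lieC zx.
have yx : lie y x = - z by rewrite lieC zE.
have hz : is_der z by exact: is_der_lie.
clearbody z.
(* If z vanished, so would y = [z,x] and the nilpotent y + i z, whose sixth power is nonzero. *)
have z0 : z != 0.
  have := principal_exp6 pe; apply: contra_neq => e; have ey : y = 0 by rewrite -zx e lie0l.
  have -> : complexify y z = 0; last by rewrite expr0n.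
  by rewrite e ey; apply/matrixP => i j; rewrite !mxE.
have y0 : y != 0 by apply: contra_neq z0 => e; rewrite -zE e lie0r.
have x0 : x != 0 by apply: contra_neq z0 => e; rewrite -zE e lie0l.
have bx a b c : lie x (a *: x + b *: y + c *: z) = b *: z - c *: y.
  by rewrite !lieDr !lieZr liexx xz zE scaler0 add0r scalerN.
have by_ a b c : lie y (a *: x + b *: y + c *: z) = c *: x - a *: z.
  by rewrite !lieDr !lieZr liexx yx yz scaler0 addr0 scalerN addrC.
have bz a b c : lie z (a *: x + b *: y + c *: z) = a *: y - b *: x.
  by rewrite !lieDr !lieZr liexx zx zy scaler0 addr0 scalerN.
(* These three double brackets isolate one coordinate each; they serve for linear independence as
   well as for ideals. *)
have xy2 a b c : lie x (lie y (a *: x + b *: y + c *: z)) = a *: y.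
  by rewrite by_ lieDr lieNr !lieZr liexx xz scaler0 add0r scalerN opprK.
have yx2 a b c : lie y (lie x (a *: x + b *: y + c *: z)) = b *: x.
  by rewrite bx lieDr lieNr !lieZr liexx yz scaler0 subr0.
have zx2 a b c : lie z (lie x (a *: x + b *: y + c *: z)) = c *: x.
  by rewrite bx lieDr lieNr !lieZr liexx zy scaler0 add0r scalerN opprK.
have hin := inS_pair_span x y; rewrite zE in hin.
split.
- move=> A /hin [a [b [c ->]]]; rewrite -addrA; do 2![apply: is_der_lin => //].
  by rewrite -[c *: z]addr0; apply: is_der_lin => //; exact: is_der0.
- apply: rank_span3 => a b c; rewrite zE -!linearZ -!linearD => /(congr1 vec_mx); rewrite mxvecK linear0 => e.
  have sc (k : R) A : A != 0 -> k *: A = 0 -> k = 0.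
    by move=> A0 /eqP; rewrite scaler_eq0 (negPf A0) orbF => /eqP.
  by split; [apply: (sc _ y) | apply: (sc _ x) | apply: (sc _ x)] => //; rewrite -?(xy2 a b c) -?(yx2 a b c) -?(zx2 a b c) e !lie0r.
- move=> A B /hin [a [b [c ->]]] /hin [a' [b' [c' ->]]]; apply/hin.
  exists (b * c' - c * b'), (c * a' - a * c'), (a * b' - b * a').
  rewrite !(lieDl, lieZl) bx by_ bz; move: (x) (y) (z) => p q r.
  by apply/matrixP => i j; rewrite !mxE; ring.
- split; first exists x, y.
    split; [apply/hin; exists 1, 0, 0 | apply/hin; exists 0, 1, 0 | by rewrite zE];
      by rewrite !scale0r scale1r ?addr0 ?add0r.
  move=> I hI ideal; have [/eqP|I0] := eqVneq I 0; first by rewrite -mxrank_eq0 => /eqP; left.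
  right; have /rowV0Pn [v vI v0] := I0.
  have I0' := inS_subsp I.
  have xh : inS (pair_span x y) x by apply/hin; exists 1, 0, 0; rewrite !scale0r scale1r !addr0.
  have yh : inS (pair_span x y) y by apply/hin; exists 0, 1, 0; rewrite !scale0r scale1r addr0 add0r.
  have zh : inS (pair_span x y) z by apply/hin; exists 0, 0, 1; rewrite !scale0r scale1r !add0r.
  have xI : inS I x.
    have yI : inS I y -> inS I x by move=> h; rewrite -yz lieC -lieNr; apply: ideal => //; exact: (subspN I0').
    move: vI v0; rewrite -[v]vec_mxK; move: (vec_mx v) => A hA A0.
    have /hin [a [b [c eA]]] : inS (pair_span x y) A by exact: submx_trans hA hI.
    have nz : [|| a != 0, b != 0 | c != 0].
      apply: contraNT A0; rewrite !negb_or !negbK => /and3P [/eqP a0 /eqP b0 /eqP c0].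
      by rewrite eA a0 b0 c0 !scale0r !addr0 linear0.
    case/or3P: nz => k0; [apply: yI | | ]; apply: (subspZr I0' k0); rewrite -?(xy2 a b c) -?(yx2 a b c) -?(zx2 a b c) -eA;
      by apply: (ideal) => //; apply: (ideal).
  have zI : inS I z by rewrite -zE lieC -lieNr; apply: ideal => //; exact: (subspN I0').
  have yI : inS I y by rewrite -zx; apply: ideal.
  apply/row_subP => i; rewrite -[row i _]vec_mxK.
  have /hin [a [b [c ->]]] : inS (pair_span x y) (vec_mx (row i (pair_span x y))).
    by rewrite /inS vec_mxK row_sub.
  by apply: (subspD I0'); [apply: (subspD I0') | ]; apply: (subspZ I0').
- exists y, z; split; [apply/hin; exists 0, 1, 0 | apply/hin; exists 0, 0, 1 | exact: pe];
    by rewrite !scale0r scale1r ?addr0 ?add0r.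
Qed.

Lemma principal_pair_adapted x y : m4 V x -> m4 V y -> adapted V (pair_span x y).
Proof.
move=> hx hy A /inS_pair_span [a [b [c ->]]]; exists (c *: lie x y), (a *: x + b *: y).
have [hz hz'] := lie_m4_h4 hx hy; have [m0 ml] := m4_subsp V.
split; last by rewrite addrC.
- by apply/inS_pair_span; exists 0, 0, c; rewrite !scale0r !add0r.
- split; first by rewrite -[_ *: _]addr0; apply: is_der_lin => //; exact: is_der0.
  by move=> u /hz' hu t ht; rewrite app_scalemx dotZl hu // mulr0.
- by apply/inS_pair_span; exists a, b, 0; rewrite scale0r addr0.
- by apply: (ml) => //; rewrite -[_ *: _]addr0; apply: ml.
Qed.
End PrincipalSpan.

(** * The maximality criterion and its four cases *)

Section Maximal.
Variables (R : realType) (V : 'M[R]_7).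
Hypothesis hV : inMS V.
Implicit Types (x y z u v w : 'rV[R]_7) (A B d W : 'M[R]_7) (P Q : 'M[R]_7 -> Prop) (S : 'M[R]_(7 * 7)).

Local Notation in_max P := (in_maximal (fun x => (x <= V)%MS) (inperp V) (m4 V) P).

Lemma lts_in_maximal S : lts_m4 V S -> proper_m4 V S -> in_max (inS S).
Proof.
move=> [h1 h2] hp; apply: (lts_classification (@principal_pair_nilpotent R)) => //; exact: inS_subsp.
Qed.

Lemma maximal_eq S Q : maximal_lts_m4 V S -> subsp Q -> lts Q -> (forall A, Q A -> m4 V A) ->
  (exists A, m4 V A /\ ~ Q A) -> (forall A, inS S A -> Q A) -> forall A, inS S A <-> Q A.
Proof.
move=> [_ _ hmax] hQ hL hM [B [mB nB]] hS A; split; first exact: hS.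
have [T hT] := subspace_mx hQ.
have sT : (S <= T)%MS.
  apply/row_subP => i; rewrite -[row i S]vec_mxK; apply/hT/hS; by rewrite /inS vec_mxK row_sub.
have lT : lts_m4 V T.
  by split=> [E /hT/hM //|E1 E2 E3 /hT h1 /hT h2 /hT h3]; apply/hT/hL.
have pT : proper_m4 V T by exists B; split=> // /hT.
by move=> /hT hA; apply: submx_trans hA (hmax T lT pT sT).
Qed.

(** A proper Lie triple subsystem T containing S falls under the classification, so only the four
    kinds of containment have to be compared with Q. *)
Lemma maximal_of_containment S Q : (forall A, inS S A <-> Q A) -> lts Q -> (forall A, Q A -> m4 V A) ->
  (exists A, m4 V A /\ ~ Q A) ->
  (forall P, (forall A, P A -> m4 V A) -> (forall A, Q A -> P A) -> in_max P -> forall A, P A -> Q A) ->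
  maximal_lts_m4 V S.
Proof.
move=> hS hL hM [B [mB nB]] hmax; split.
- by split=> [A /hS/hM //|E1 E2 E3 /hS h1 /hS h2 /hS h3]; apply/hS/hL.
- by exists B; split=> // /hS.
move=> T lT pT sT; apply/row_subP => i; rewrite -[row i T]vec_mxK; apply/hS.
apply: (hmax (inS T)); last by rewrite /inS vec_mxK row_sub.
- by case: lT.
- by move=> A /hS hA; apply: submx_trans hA sT.
- exact: lts_in_maximal.
Qed.

Lemma adapted_frame v w : (v <= V)%MS -> inperp V w -> dot v v = 1 -> dot w w = 1 ->
  exists g, [/\ frame V g, app g (delta_mx 0 'o_0) = v & app g (delta_mx 0 'o_3) = - w].
Proof.
move=> vV wV vv ww; have [u [uV uu vu]] := inMS_orthogonal v hV.
by have [h h0 _ h3] := frame_triple hV vV uV wV vv uu ww vu; eexists; split; [exact: h|exact: h0|exact: h3].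
Qed.

Lemma kills_scale k l A : k != 0 -> app A (k *: l) = 0 <-> app A l = 0.
Proof.
move=> k0; rewrite appZ; split=> [/eqP|->]; last exact: scaler0.
by rewrite scaler_eq0 (negPf k0) => /eqP.
Qed.

Lemma kills_perp_maximal l P : l != 0 -> inperp V l -> (forall A, P A -> m4 V A) ->
  (forall A, kills V l A -> P A) -> in_max P -> forall A, P A -> kills V l A.
Proof.
move=> l0 lV hM hP hin; have [k k0 kk] := normalize l0.
have [v [_ [vV vv _ _]]] := inMS_nonzero hV.
have klV : inperp V (k *: l) by move=> y hy; rewrite dotZl lV ?mulr0.
have [g [hg _ g3]] := adapted_frame vV klV vv kk; have [ga go _ _] := hg.
have eq A : app A l = 0 <-> app A (app g (delta_mx 0 'o_3)) = 0.
  by rewrite g3 -scaleNr; split=> /kills_scale; apply; rewrite oppr_eq0 gt_eqF.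
have h := kills_perp_line_maximal _ (in_maximal_std hg hin).
move=> A hA; split; first exact: hM.
apply/eq; have := h _ (cj g^T A); rewrite cjVK // app_cj trmxK => e.
rewrite -[LHS](app_trK _ go) e ?app0 // => a b t1 t2 t3.
apply: hP; split; first by apply/(frame_m4 _ hg)/Mx_m4std.
apply/eq; rewrite app_cj app_Ktr // -[RHS](app0 g); congr app.
by rewrite delta_v7E app_Mx; apply: row7P; rewrite !mxE /=; ring.
Qed.

Lemma kills_vec_maximal u P : u != 0 -> (u <= V)%MS -> (forall A, P A -> m4 V A) ->
  (forall A, kills V u A -> P A) -> in_max P -> forall A, P A -> kills V u A.
Proof.
move=> u0 uV hM hP hin; have [k k0 kk] := normalize u0.
have [_ [w [_ _ wV ww]]] := inMS_nonzero hV.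
have [g [hg g0 _]] := adapted_frame (scalemx_sub k uV) wV kk ww; have [ga go _ _] := hg.
have eq A : app A u = 0 <-> app A (app g (delta_mx 0 'o_0)) = 0.
  by rewrite g0; split=> /kills_scale; apply; rewrite gt_eqF.
have h := kills_vector_maximal _ (in_maximal_std hg hin).
move=> A hA; split; first exact: hM.
apply/eq; have := h _ (cj g^T A); rewrite cjVK // app_cj trmxK => e.
rewrite -[LHS](app_trK _ go) e ?app0 // => b t1 t2 t3.
apply: hP; split; first by apply/(frame_m4 _ hg)/Mx_m4std.
apply/eq; rewrite app_cj app_Ktr // -[RHS](app0 g); congr app.
by rewrite delta_v7E app_Mx; apply: row7P; rewrite !mxE /=; ring.
Qed.

Lemma stabilizes_maximal v w P : (v <= V)%MS -> inperp V w -> dot v v = 1 -> dot w w = 1 ->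
  (forall A, P A -> m4 V A) -> (forall A, stabilizes V v w A -> P A) -> in_max P ->
  forall A, P A -> stabilizes V v w A.
Proof.
move=> vV wV vv ww hM hP hin.
have [g [hg g0 g3]] := adapted_frame vV wV vv ww; have [ga go _ _] := hg.
have gD x y : dot x (app g y) = dot (app g^T x) y by rewrite dot_app_tr.
have eq A : preserves_perp v w (cj g A) <-> preserves_perp (delta_mx 0 'o_0) (delta_mx 0 'o_3) A.
  have w3 : w = - app g (delta_mx 0 'o_3) by rewrite g3 opprK.
  have e z : [/\ dot z v = 0, dot z w = 0 & dot z (cross v w) = 0] <->
    [/\ dot (app g^T z) (delta_mx 0 'o_0) = 0, dot (app g^T z) (delta_mx 0 'o_3) = 0
      & dot (app g^T z) (cross (delta_mx 0 'o_0) (delta_mx 0 'o_3)) = 0].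
    rewrite w3 -g0 crossNr -aut_cross // !dotNr !gD.
    have o (t : R) : - t = 0 -> t = 0 by move=> /eqP; rewrite oppr_eq0 => /eqP.
    by split=> -[h1 h2 h3]; split=> //; first [exact: o | by rewrite h2 oppr0 | by rewrite h3 oppr0].
  split=> h z h1 h2 h3.
    have /e [q1 q2 q3] : [/\ dot (app g^T (app g z)) (delta_mx 0 'o_0) = 0, dot (app g^T (app g z)) (delta_mx 0 'o_3) = 0
      & dot (app g^T (app g z)) (cross (delta_mx 0 'o_0) (delta_mx 0 'o_3)) = 0] by rewrite app_Ktr.
    by have := h _ q1 q2 q3; move=> /e; rewrite app_cj !app_Ktr.
  have /e [q1 q2 q3] := And3 h1 h2 h3.
  by apply/e; rewrite app_cj app_Ktr //; apply: h.
have h := preserves_plane_maximal _ (in_maximal_std hg hin).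
move=> A hA; split; first exact: hM.
rewrite -(cjVK A go); apply/eq; apply: h; last by rewrite cjVK.
move=> a b t r; apply: hP; split; first by apply/(frame_m4 _ hg)/Mx_m4std.
apply/eq; exact: preserves_perp1.
Qed.

(** A common kernel vector or a stabilized W would pass from the part in [m4 V] to all of h. If P
    lies in the span of a pair x, y, two noncommuting elements of h in [m4 V] already span that
    plane, so it lies in h. *)
Lemma principal_maximal h P : principal_subalg h -> adapted V h -> (forall A, P A -> m4 V A) ->
  (forall A, inS h A /\ m4 V A -> P A) -> in_max P -> forall A, P A -> inS h A /\ m4 V A.
Proof.
move=> hp had hM hP; case.
- case=> x [y [hx hy _ hxy]].
  have [A [B [hA mA hB mB nAB]]] := adapted_noncommuting hV hp had.
  have [a [b eA]] := hxy _ (hP A (conj hA mA)); have [c [d eB]] := hxy _ (hP B (conj hB mB)).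
  (* The bracket [A,B] is this determinant times [x,y]. *)
  have D0 : a * d - b * c != 0.
    apply: contra_neq nAB => e; have -> : lie A B = (a * d - b * c) *: lie x y; last by rewrite e scale0r.
    rewrite eA eB !(lieDl, lieZl) !(lieDr, lieZr) !liexx (lieC y x); move: (lie x y) => z.
    by apply/matrixP => i j; rewrite !mxE; ring.
  have xE : (a * d - b * c) *: x = d *: A - b *: B.
    by rewrite eA eB; apply/matrixP => i j; rewrite !mxE; ring.
  have yE : (a * d - b * c) *: y = a *: B - c *: A.
    by rewrite eA eB; apply/matrixP => i j; rewrite !mxE; ring.
  have hs := inS_subsp h.
  have xh : inS h x by apply: (subspZr hs D0); rewrite xE; apply: (subspB hs); apply: (subspZ hs).
  have yh : inS h y by apply: (subspZr hs D0); rewrite yE; apply: (subspB hs); apply: (subspZ hs).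
  move=> E hE; split; last exact: hM.
  by have [p [q ->]] := hxy _ hE; apply: (subspD hs); apply: (subspZ hs).
- case=> l [l0 _ hl]; case: (adapted_not_kills hV hp had l0) => A hA mA; apply: hl; exact: hP.
- case=> l [l0 _ hl]; case: (adapted_not_kills hV hp had l0) => A hA mA; apply: hl; exact: hP.
- case=> v [w [_ _ vv _ hvw]]; case: (adapted_not_stabilizes (v := v) (w := w) hV hp had).
    by apply/eqP => e; move: vv; rewrite e dot0l => /eqP; rewrite eq_sym oner_eq0.
  by move=> A hA mA; apply: hvw; exact: hP.
Qed.
End Maximal.

Theorem mainTheorem13 (R : realType) (V : 'M[R]_7) (hV : inMS V)
    (S : 'M[R]_(7 * 7)) :
  maximal_lts_m4 V S <->
  [\/ (exists h1 : 'M[R]_(7 * 7),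
         [/\ principal_subalg h1, adapted V h1 &
             forall A, inS S A <-> (inS h1 A /\ m4 V A)]),
      (exists l : 'rV[R]_7,
         [/\ l != 0, inperp V l &
             forall A, inS S A <-> (h2 l A /\ m4 V A)]),
      (exists u : 'rV[R]_7,
         [/\ u != 0, (u <= V)%MS &
             forall A, inS S A <-> (h2 u A /\ m4 V A)]) |
      (exists W : 'M[R]_7,
         [/\ inMS W,
             (exists x : 'rV[R]_7, [/\ x != 0, (x <= W)%MS & (x <= V)%MS]),
             (exists y : 'rV[R]_7, [/\ y != 0, (y <= W)%MS & inperp V y]) &
             forall A, inS S A <-> (h4 W A /\ m4 V A)])].
Proof.
have nz (v : 'rV[R]_7) : dot v v = 1 -> v != 0.
  by move=> vv; apply/eqP => e; move: vv; rewrite e dot0l => /eqP; rewrite eq_sym oner_eq0.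
have killsE l A : h2 l A /\ m4 V A <-> kills V l A.
  by split=> [[[_ e] mA]|[mA e]]; split=> //; split=> //; case: mA.
have stabE v w A : h4 (span3 v w (cross v w)) A /\ m4 V A <-> stabilizes V v w A.
  split=> [[/h4_plane [_ e] mA]|[mA e]]; split=> //; apply/h4_plane; split=> //; by case: mA.
have span_lts h : principal_subalg h -> lts (fun A => inS h A /\ m4 V A).
  move=> [_ _ hlie _ _] A B E [a1 a2] [b1 b2] [c1 c2]; split; last exact: m4_lts.
  by apply: (hlie) => //; apply: hlie.
split=> [hS | ].
- have [lS pS _] := hS; have [hM _] := lS.
  (* An inclusion of S into a proper Lie triple subsystem of the list suffices: maximality turns it
     into equality. *)
  have main Q : subsp Q -> lts Q -> (forall A, Q A -> m4 V A) -> (exists A, m4 V A /\ ~ Q A) ->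
      (forall A, inS S A -> Q A) -> forall A, inS S A <-> Q A by exact: maximal_eq.
  have [[x [y [mx my pxy hxy]]]|[l [l0 lV hl]]|[u [u0 uV hu]]|[v [w [vV wV vv ww hvw]]]] := lts_in_maximal hV lS pS.
  + constructor 1; exists (pair_span x y).
    have hp : principal_subalg (pair_span x y) by apply: principal_pair_subalg => //; [case: mx | case: my].
    split; [exact: hp | exact: principal_pair_adapted |].
    apply: main; [| exact: span_lts | by move=> A [] | |].
    * have [s0 sl] := inS_subsp (pair_span x y); have [m0 ml] := m4_subsp V.
      by split=> // k A B [a1 a2] [b1 b2]; split; [exact: sl | exact: ml].
    * have [_ rh _ _ _] := hp; have [A [mA nA]] := proper_of_rank3 hV rh.
      by exists A; split=> // -[].
    * move=> A hA; split; last exact: hM.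
      by apply/inS_pair_span; have [a [b ->]] := hxy _ hA; exists a, b, 0; rewrite scale0r addr0.
  + constructor 2; exists l; split=> // A; rewrite killsE; move: A.
    apply: main; [exact: kills_subsp | exact: kills_lts | by move=> A [] | |].
      by apply: proper_of_in_maximal => //; constructor 2; exists l; split=> // A [].
    by move=> A hA; split; [exact: hM | exact: hl].
  + constructor 3; exists u; split=> // A; rewrite killsE; move: A.
    apply: main; [exact: kills_subsp | exact: kills_lts | by move=> A [] | |].
      by apply: proper_of_in_maximal => //; constructor 3; exists u; split=> // A [].
    by move=> A hA; split; [exact: hM | exact: hu].
  + constructor 4; exists (span3 v w (cross v w)).
    have vw : dot v w = 0 by rewrite dotC wV.
    have inW (a b c : R) z : z = a *: v + b *: w + c *: cross v w -> (z <= span3 v w (cross v w))%MS.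
      by move=> ->; apply/sub_span3; exists a, b, c.
    split; first exact: inMS_plane.
    * by exists v; split; [exact: nz | apply: (inW 1 0 0); rewrite scale1r !scale0r !addr0 | ].
    * by exists w; split; [exact: nz | apply: (inW 0 1 0); rewrite scale1r !scale0r addr0 add0r | ].
    move=> A; rewrite stabE; move: A.
    apply: main; [exact: stabilizes_subsp | exact: stabilizes_lts | by move=> A [] | |].
      by apply: proper_of_in_maximal => //; constructor 4; exists v, w; split=> // A [].
    by move=> A hA; split; [exact: hM | exact: hvw].
- case=> [[h [hp had hS]]|[l [l0 lV hS]]|[u [u0 uV hS]]|[W [hW [x [x0 xW xV]] [y [y0 yW yV]] hS]]].
  + apply: (maximal_of_containment hV hS); [exact: span_lts | by move=> A [] | | by move=> P; apply: principal_maximal].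
    have [_ rh _ _ _] := hp; have [A [mA nA]] := proper_of_rank3 hV rh.
    by exists A; split=> // -[].
  + apply: (maximal_of_containment (Q := kills V l) hV).
    * by move=> A; rewrite hS killsE.
    * exact: kills_lts.
    * by move=> A [].
    * by apply: proper_of_in_maximal => //; constructor 2; exists l; split=> // A [].
    * by move=> P; apply: kills_perp_maximal.
  + apply: (maximal_of_containment (Q := kills V u) hV).
    * by move=> A; rewrite hS killsE.
    * exact: kills_lts.
    * by move=> A [].
    * by apply: proper_of_in_maximal => //; constructor 3; exists u; split=> // A [].
    * by move=> P; apply: kills_vec_maximal.
  (* Unit vectors in the intersections of W with V and with its complement, together with their
     product, span W by dimension; this is the form of W that [stabilizes] uses. *)
  + have [k _ vv] := normalize x0; have [k' _ ww] := normalize y0.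
    set v := k *: x in vv; set w := k' *: y in ww.
    have vV : (v <= V)%MS by exact: scalemx_sub.
    have wV : inperp V w by move=> z hz; rewrite dotZl yV // mulr0.
    have vw : dot v w = 0 by rewrite dotC wV.
    have eW := inMS_plane_eq hW (scalemx_sub k xW) (scalemx_sub k' yW) vv ww vw.
    apply: (maximal_of_containment (Q := stabilizes V v w) hV).
    * by move=> A; rewrite hS -stabE (h4_eqmx _ eW).
    * exact: stabilizes_lts.
    * by move=> A [].
    * by apply: proper_of_in_maximal => //; constructor 4; exists v, w; split=> // A [].
    * by move=> P; apply: stabilizes_maximal.
Qed.
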